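(* Let $n\ge2$ and let $(v,x)\in\mathfrak{N}$ with $\mathrm{eType}(v,x)=((n-2),(2))$. For $1\le i\le n-1$, we have $\overline{C_n^{i,i+1}}\simeq\Sigma_{-2}$.
   Context: All varieties are over $\mathbb{C}$. Let $U$ be an $n$-dimensional complex vector space and $V=U\oplus U^*$ with the symplectic form $\langle (u,f),(u',f')\rangle=f'(u)-f(u')$; $W^\perp$ denotes the perpendicular space of $W$. Let $\mathcal{S}=\{x\in\mathrm{End}(V): \langle xv,w\rangle=\langle v,xw\rangle\ \forall v,w\in V\}$. The exotic nilpotent cone is $\mathfrak{N}=\{(v,x): v\in V,\ x\in\mathcal{S},\ x \text{ nilpotent}\}$; the same definitions apply to any finite-dimensional symplectic space. Exotic type. A bipartition of $n$ is a pair $(\mu,\nu)$ of partitions with $|\mu|+|\nu|=n$; let $\lambda=\mu+\nu$ (partwise sum) and $\ell(\cdot)$ be the number of nonzero parts. One writes $\mathrm{eType}(v,x)=(\mu,\nu)$ iff $V$ has a basis $\{v_{ij},v_{ij}^*: 1\le i\le \ell(\lambda),1\le j\le \lambda_i\}$ with $\langle v_{ij},v^*_{i'j'}\rangle=\delta_{ii'}\delta_{jj'}$, $\langle v_{ij},v_{i'j'}\rangle=\langle v^*_{ij},v^*_{i'j'}\rangle=0$, $v=\sum_{i=1}^{\ell(\mu)}v_{i,\mu_i}$, $xv_{ij}=v_{i,j-1}$ (zero if $j=1$), $xv^*_{ij}=v^*_{i,j+1}$ (zero if $j=\lambda_i$). Every $(v,x)\in\mathfrak{N}$ has a unique exotic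 type. Exotic Springer fibre. $\mathcal{C}_{(v,x)}$ is the variety of complete flags $F_\bullet=(0=F_0\subset F_1\subset\dots\subset F_{2n}=V)$, $\dim F_i=i$, with $F_i^\perp=F_{2n-i}$, $v\in F_n$, and $x(F_i)\subseteq F_{i-1}$ for all $i\ge1$. For $0\le k\le n$ put $\Phi^k(F_\bullet)=\mathrm{eType}(v+F_k,x|_{F_k^\perp/F_k})$, a bipartition of $n-k$, computed in the symplectic space $F_k^\perp/F_k$. For a standard bitableau $T$ with $n$ boxes (a pair of tableaux filled with $1,\dots,n$, each used once, increasing along rows and down columns), $\Phi^{-1}(T)$ is the set of $F_\bullet\in\mathcal{C}_{(v,x)}$ such that for every $0\le k\le n$, $\Phi^{n-k}(F_\bullet)$ is the shape formed by the entries $\le k$ of $T$. For $1\le i<j\le n$, let $T_{i,j}$ be the standard bitableau of shape $((n-2),(2))$ whose second tableau contains $\{i,j\}$ in a single row and whose first tableau contains the other $n-2$ numbers in a single row. Put $C_n^{i,j}=\Phi^{-1}(T_{i,j})$, and let $\overline{C_n^{i,j}}$ be its closure in $\mathcal{C}_{(v,x)}$. For $m>0$, $\Sigma_{-m}$ denotes the $\mathbb{P}^1$-bundle over $\mathbb{P}^1$ obtained by projectivising fibrewise (taking lines in fibres) the rank-two vector bundle $\mathcal{O}\oplus\mathcal{O}(-m)$ over $\mathbb{P}^1$. *)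

(* Defs.v *)
From HB Require Import structures.
From mathcomp Require Import all_boot all_order all_algebra.
From mathcomp Require Import sesquilinear mpoly complex.
From mathcomp Require Import boolp classical_sets reals.

Set Implicit Arguments.
Unset Strict Implicit.
Unset Printing Implicit Defensive.

Import Order.TTheory GRing.Theory.
Local Open Scope ring_scope.
Local Open Scope classical_set_scope.

(* A (reduced) variety over an algebraically closed field K is determined by
   its points, its Zariski topology, and the K-valued functions that are regular
   on each open set.  The points are the elements of [dom X]; [opn X A] says that
   the trace of [A] on [dom X] is open, and, for such an [A], [reg X A f] says
   that [f] is regular on that trace.  Values outside [dom X] are irrelevant. *)
Record fspace (K : fieldType) := FSpace {
  pt : Type;
  dom : set pt;
  opn : set (set pt);
  reg : set pt -> set (pt -> K) }.
Arguments dom {K} X _ : rename.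
Arguments opn {K} X _ : rename.
Arguments reg {K} X _ _ : rename.

Section Varieties.
Variable K : fieldType.
Implicit Types X Y : fspace K.

Definition affine_space (d : nat) : fspace K :=
  @FSpace K 'rV[K]_d setT
    [set A | exists I : set {mpoly K[d]},
       A = [set z : 'rV[K]_d | exists2 p, I p & p.@[z 0] != 0]]
    (fun A => [set f | forall z : 'rV[K]_d, A z -> exists p q : {mpoly K[d]},
       q.@[z 0] != 0 /\
       forall y : 'rV[K]_d, A y -> q.@[y 0] != 0 -> f y = p.@[y 0] / q.@[y 0]]).

(* The subset S of X, with the induced topology and with the functions that
   locally extend to regular functions on X: the reduced structure when S is
   locally closed. *)
Definition subspace X (S : set (pt X)) : fspace K :=
  @FSpace K (pt X) (dom X `&` S)
    [set A | exists2 B, opn X B & dom X `&` S `&` A = dom X `&` S `&` B]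
    (fun A => [set f | forall y, (dom X `&` S `&` A) y ->
       exists B g, [/\ opn X B, B y, reg X B g &
         forall z, (dom X `&` S `&` A `&` B) z -> f z = g z]]).

(* The image of X under q, with the quotient topology and functions. *)
Definition quotient_space X (T : Type) (q : pt X -> T) : fspace K :=
  @FSpace K T (q @` dom X) [set A | opn X (q @^-1` A)]
    (fun A => [set f : T -> K | reg X (q @^-1` A) (f \o q)]).

Definition morphism X Y (f : pt X -> pt Y) : Prop :=
  [/\ forall z, dom X z -> dom Y (f z),
      forall A, opn Y A -> opn X (f @^-1` A)
    & forall A g, opn Y A -> reg Y A g -> reg X (f @^-1` A) (g \o f)].

Definition isomorphic X Y : Prop :=
  exists (f : pt X -> pt Y) (g : pt Y -> pt X),
    [/\ morphism f, morphism g,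
        forall z, dom X z -> g (f z) = z
      & forall z, dom Y z -> f (g z) = z].

Definition zariski_closed X (Z : set (pt X)) : Prop := opn X (~` Z).

Definition zariski_closure X (S : set (pt X)) : set (pt X) :=
  dom X `&` [set z | forall Z, zariski_closed Z -> dom X `&` S `<=` Z -> Z z].

End Varieties.

Section FlagVariety.
Variables (K : fieldType) (V : vectType K).
Let d := \dim {:V}.

(* Complete flags F_0 < ... < F_d are indexed by nat, with F_k = V for k > d. *)
Definition complete_flag (F : nat -> {vspace V}) : Prop :=
  forall k, (F k <= F k.+1)%VS /\ \dim (F k) = minn k d.

Definition frame (M : 'M[K]_d) : seq V :=
  [seq \sum_(j < d) M i j *: (vbasis {:V})`_j | i <- enum 'I_d].

Definition flag_of_frame (z : 'rV[K]_(d * d)) (k : nat) : {vspace V} :=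
  <<take k (frame (vec_mx z))>>%VS.

(* GL(V) / B: the bases of V modulo "spanning the same flag".  By [dom_flags]
   below, its points are exactly the complete flags of V. *)
Definition flag_variety : fspace K :=
  quotient_space
    (X := subspace (X := affine_space K (d * d)) [set z | vec_mx z \in unitmx])
    flag_of_frame.

End FlagVariety.

Section Hirzebruch.
Variable K : fieldType.

(* P^(a-1) x P^(b-1), as pairs of lines. *)
Definition biproj (a b : nat) : fspace K :=
  quotient_space
    (X := subspace (X := affine_space K (a + b))
            [set z | lsubmx z != 0 /\ rsubmx z != 0])
    (fun z : 'rV[K]_(a + b) =>
       (<[lsubmx z : 'rV[K]_a]>%VS, <[rsubmx z : 'rV[K]_b]>%VS)).

(* The m-th power of u in Sym^m(K^2) = K^(m+1), in the basis
   'C(m, i) e_0^(m-i) e_1^i (K has characteristic 0 below). *)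
Definition veronese (m : nat) (u : 'rV[K]_2) : 'rV[K]_m.+1 :=
  \row_(i < m.+1) (u 0 0 ^+ (m - i) * u 0 1 ^+ i).

(* The fibre L^m over the line L of O(-m), seen as the m-th tensor power of the
   tautological bundle O(-1): a subbundle of the trivial bundle with fibre
   Sym^m(K^2).  The choice of a generator of L does not matter. *)
Definition taut_power (m : nat) (L : {vspace 'rV[K]_2}) : {vspace 'rV[K]_m.+1} :=
  <[veronese m (vpick L)]>%VS.

(* The fibre over L of O + O(-m), inside K + Sym^m(K^2). *)
Definition bundle_fibre (m : nat) (L : {vspace 'rV[K]_2})
  (w : 'rV[K]_(1 + m.+1)) : Prop := rsubmx w \in taut_power m L.

(* P(O + O(-m)): pairs of a point L of P^1 and a line in the fibre over L. *)
Definition Sigma_neg (m : nat) : fspace K :=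
  subspace (X := biproj 2 (1 + m.+1))
    [set p : {vspace 'rV[K]_2} * {vspace 'rV[K]_(1 + m.+1)} |
       forall w, w \in p.2 -> bundle_fibre p.1 w].

End Hirzebruch.

Section Exotic.
Variables (K : fieldType) (V : vectType K) (form : {skew_symmetric V}).
Local Notation "''[' v , w ]" := (form v%R w%R).

Definition exotic_cone (v : V) (x : 'End(V)) : Prop :=
  (forall u w, '[x u, w] = '[u, x w]) /\ (exists k, forall w, iter k x w = 0).

(* Partitions are weakly decreasing sequences of naturals, up to trailing
   zeros. *)
Definition partition_seq (mu : seq nat) : bool := sorted geq mu.
Definition nparts (mu : seq nat) : nat := count (leq 1) mu.
Definition padd (mu nu : seq nat) : seq nat :=
  mkseq (fun i => nth 0 mu i + nth 0 nu i)%N (maxn (size mu) (size nu)).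

(* Here i starts at 0, whereas j starts at 1. *)
Definition cells (la : seq nat) : seq (nat * nat) :=
  [seq (i, j) | i <- iota 0 (nparts la), j <- iota 1 (nth 0%N la i)].

Record normal_basis (v : V) (x : 'End(V)) (mu nu : seq nat)
    (e f : nat -> nat -> V) : Prop := NormalBasis {
  la := padd mu nu;
  nb_basis : basis_of {:V} ([seq e c.1 c.2 | c <- cells la]
                            ++ [seq f c.1 c.2 | c <- cells la]);
  nb_dual : {in cells la &, forall c c', '[e c.1 c.2, f c'.1 c'.2] = (c == c')%:R};
  nb_ee : {in cells la &, forall c c', '[e c.1 c.2, e c'.1 c'.2] = 0};
  nb_ff : {in cells la &, forall c c', '[f c.1 c.2, f c'.1 c'.2] = 0};
  nb_v : v = \sum_(0 <= i < nparts mu) e i (nth 0%N mu i);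
  nb_xe : {in cells la, forall c,
    x (e c.1 c.2) = if c.2 == 1%N then 0 else e c.1 c.2.-1};
  nb_xf : {in cells la, forall c,
    x (f c.1 c.2) = if c.2 == nth 0%N la c.1 then 0 else f c.1 c.2.+1} }.

Definition eType (v : V) (x : 'End(V)) (mu nu : seq nat) : Prop :=
  [/\ partition_seq mu, partition_seq nu & exists e f, normal_basis v x mu nu e f].

End Exotic.

Section Subquotient.
Variables (K : fieldType) (V : vectType K) (form : {skew_symmetric V}).
Variable F : {vspace V}.

(* The symplectic space F^perp / F, for F contained in F^perp, is realised on a
   complement of F in F^perp; see the lemmas perp_class_* below. *)
Definition perp_quo : vectType K := subvs_of (orthov form F :\: F)%VS.

(* The class of w; meaningful for w in F^perp. *)
Definition perp_class (w : V) : perp_quo :=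
  vsproj (orthov form F :\: F)%VS (addv_pi1 (orthov form F) F w).

Fact perp_class_linear : linear perp_class.
Proof. by move=> k a b; rewrite /perp_class !linearP. Qed.
HB.instance Definition _ :=
  GRing.isLinear.Build K V perp_quo _ perp_class perp_class_linear.

Definition perp_form (a b : perp_quo) : K := form (vsval a) (vsval b).

Fact perp_form_bilinear : bilinear_for *%R *%R perp_form.
Proof.
by split=> a k u w; rewrite /perp_form linearP ?linearPl ?linearPr.
Qed.
HB.instance Definition _ :=
  bilinear_isBilinear.Build K perp_quo perp_quo K *%R *%R perp_form
    perp_form_bilinear.

Fact perp_form_skew (a b : perp_quo) :
  perp_form a b = (-1) ^+ true * idfun (perp_form b a).
Proof. by rewrite /perp_form hermC. Qed.
HB.instance Definition _ :=
  isHermitianSesquilinear.Build K perp_quo true idfun perp_form perp_form_skew.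

(* Meaningful when x preserves F and F^perp. *)
Definition perp_end (x : 'End(V)) : 'End(perp_quo) :=
  linfun (perp_class \o (x \o vsval)).

End Subquotient.

Section SpringerFibre.
Variables (K : fieldType) (V : vectType K) (form : {skew_symmetric V}).
Variables (n : nat) (v : V) (x : 'End(V)).
Implicit Type F : nat -> {vspace V}.

Definition exotic_flag F : Prop :=
  [/\ complete_flag F,
      forall i, (i <= 2 * n)%N -> orthov form (F i) = F (2 * n - i)%N,
      v \in F n
    & forall i, (1 <= i)%N -> (x @: F i <= F i.-1)%VS].

Definition springer_fibre : fspace K :=
  subspace (X := flag_variety V) [set F | exotic_flag F].

Definition Phi k F (mu nu : seq nat) : Prop :=
  eType (perp_form (form := form) (F := F k)) (perp_class form (F k) v)
        (perp_end form (F k) x) mu nu.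

Definition bitableau := (seq (seq nat) * seq (seq nat))%type.

(* Rows without entries <= k contribute trailing zeros. *)
Definition shape_upto (k : nat) (t : seq (seq nat)) : seq nat :=
  [seq count (geq k) r | r <- t].

Definition Phi_fibre (T : bitableau) : set (nat -> {vspace V}) :=
  [set F | exotic_flag F /\ forall k, (k <= n)%N ->
     Phi (n - k) F (shape_upto k T.1) (shape_upto k T.2)].

Definition Tab (i j : nat) : bitableau :=
  ([:: [seq k <- iota 1 n | (k != i) && (k != j)]], [:: [:: i; j]]).

Definition C_closure (i j : nat) : fspace K :=
  subspace (X := springer_fibre)
    (zariski_closure (X := springer_fibre) (Phi_fibre (Tab i j))).

End SpringerFibre.

Section Double.
Variables (K : fieldType) (U : vectType K).

Definition dbl : vectType K := (U * 'Hom(U, K^o))%type.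

Definition omega (p q : dbl) : K := q.2 p.1 - p.2 q.1.

Fact omega_bilinear : bilinear_for *%R *%R omega.
Proof.
split=> [[u f]|[u f]] k [u1 f1] [u2 f2]; rewrite /omega /=.
- by rewrite linearP add_lfunE scale_lfunE /= opprD addrACA -mulrBr.
- by rewrite linearP add_lfunE scale_lfunE /= opprD addrACA -mulrBr.
Qed.
HB.instance Definition _ :=
  bilinear_isBilinear.Build K dbl dbl K *%R *%R omega omega_bilinear.

Fact omega_skew (p q : dbl) : omega p q = (-1) ^+ true * idfun (omega q p).
Proof. by rewrite /omega expr1 mulN1r opprB. Qed.
HB.instance Definition _ :=
  isHermitianSesquilinear.Build K dbl true idfun omega omega_skew.

End Double.


Lemma omega_symplectic (K : fieldType) (U : vectType K) :
  is_psymplectic (@omega K U : {skew_symmetric (dbl U)}).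
Proof.
split=> //; last by move=> [u f]; rewrite /= /omega /= subrr.
rewrite /nondegenerate -subv0; apply/subvP=> -[u f] /mem_orthovP ortho0.
rewrite memv0; apply/eqP; congr pair.
  apply/eqP; rewrite -memv0; apply: contraT => u_neq0.
  have u0 : free [:: u] by rewrite seq1_free -memv0.
  pose g : 'Hom(U, K^o) := linfun (coord [tuple u] 0 : U -> K^o).
  have /eqP := ortho0 (0, g) (memvf _).
  have g1 : g u = 1 by rewrite lfunE /= (@coord_free _ _ _ [tuple u] 0 0 u0) eqxx.
  by rewrite /= /omega /= linear0 subr0 g1 oner_eq0.
apply/lfunP=> w; have := ortho0 (w, 0) (memvf _).
by rewrite /= /omega /= !lfunE /= sub0r => /eqP; rewrite oppr_eq0 => /eqP.
Qed.

Section FlagTheory.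
Variables (K : fieldType) (V : vectType K).
Local Notation d := (\dim {:V}).

Lemma size_frame (M : 'M[K]_d) : size (frame M) = d.
Proof. by rewrite size_map size_enum_ord. Qed.

Lemma nth_frame (M : 'M[K]_d) (i : 'I_d) :
  (frame M)`_i = \sum_(j < d) M i j *: (vbasis {:V})`_j.
Proof. by rewrite (nth_map i) ?size_enum_ord // nth_ord_enum. Qed.

Lemma frame_free (M : 'M[K]_d) : (M \in unitmx) = free (frame M).
Proof.
have szM := size_frame M; have szB := size_tuple (vbasis {:V}).
apply/idP/idP=> [Mu | frM0].
  rewrite /free szM eqn_leq -{1}szM dim_span /=; apply/dimvS/subvP => w _.
  rewrite (coord_vbasis (memvf w)); apply: rpred_sum => j _; apply: rpredZ.
  have -> : (vbasis {:V})`_j = \sum_(i < d) invmx M j i *: (frame M)`_i.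
    under eq_bigr => i _ do rewrite nth_frame scaler_sumr.
    rewrite exchange_big /= (bigD1 j) //= [X in _ + X]big1 ?addr0 => [|l lj].
      under eq_bigr => i _ do rewrite scalerA.
      rewrite -scaler_suml; have /matrixP/(_ j j) := mulVmx Mu.
      by rewrite !mxE eqxx => ->; rewrite scale1r.
    under eq_bigr => i _ do rewrite scalerA.
    rewrite -scaler_suml; have /matrixP/(_ j l) := mulVmx Mu.
    by rewrite !mxE eq_sym (negPf lj) => ->; rewrite scale0r.
  apply: rpred_sum => i _; apply/rpredZ/memv_span/mem_nth.
  by rewrite szM.
have /freeP frM : free (in_tuple (frame M)) by [].
rewrite -row_free_unit -kermx_eq0; apply/eqP/row_matrixP => i0.
set u := row i0 _; have uM : u *m M = 0 by rewrite -row_mul mulmx_ker row0.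
rewrite row0; apply/rowP => i.
pose u' (l : 'I_(size (frame M))) : K := u 0 (cast_ord szM l).
have : \sum_l u' l *: (in_tuple (frame M))`_l = 0.
  rewrite (reindex (cast_ord (esym szM))) /=; last first.
    exists (cast_ord szM) => l _; [exact: cast_ordKV | exact: cast_ordK].
  transitivity (\sum_(j < d) (u *m M) 0 j *: (vbasis {:V})`_j); last first.
    by rewrite uM big1 // => j _; rewrite mxE scale0r.
  under eq_bigr => l _.
    rewrite /u' cast_ordKV nth_frame scaler_sumr.
    under eq_bigr => j _ do rewrite scalerA.
    over.
  rewrite exchange_big /=; apply: eq_bigr => j _.
  by rewrite mxE scaler_suml.
move=> h; have := frM _ h (cast_ord (esym szM) i).
by rewrite /u' cast_ordKV => ->; rewrite mxE.
Qed.

Lemma dom_flags (F : nat -> {vspace V}) :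
  dom (flag_variety V) F <-> complete_flag F.
Proof.
split=> [[z [_ /=]] | cF].
  rewrite frame_free => frz <- k; rewrite /flag_of_frame.
  set s := frame _ in frz *; have szs : size s = d := size_frame _.
  split.
    by apply: sub_span => w; rewrite -(take_takel s (leqnSn k)) => /mem_take.
  have : free (take k s) by move: frz; rewrite -{1}(cat_take_drop k s) => /catl_free.
  by move=> /eqP ->; rewrite size_take_min szs.
pose v k := vpick (F k.+1 :\: F k).
have Fmono k : (F k <= F k.+1)%VS by case: (cF k).
have dimF k : \dim (F k) = minn k d by case: (cF k).
have vP k : (k < d)%N -> (F k + <[v k]>)%VS = F k.+1.
  move=> kd; have vD : v k \in (F k.+1 :\: F k)%VS := memv_pick _.
  have vF1 : v k \in F k.+1 by exact: (subvP (diffvSl (F k.+1) (F k)) _ vD).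
  have v0 : v k != 0.
    rewrite vpick0 -dimv_eq0; have := dimv_cap_compl (F k.+1) (F k).
    rewrite (capv_idPr (Fmono k)) !dimF (minn_idPl kd) (minn_idPl (ltnW kd)).
    by case: (\dim _) => //; rewrite addn0 => /n_Sn.
  have vF : v k \notin F k.
    apply: contra v0 => vFk; rewrite -memv0 -(capv_diff (F k.+1) (F k)).
    by rewrite memv_cap vD.
  apply/eqP; rewrite eqEdim subv_add Fmono -memvE vF1 /=.
  rewrite dimF (minn_idPl kd).
  have cap0 : (F k :&: <[v k]> = 0)%VS.
    apply/eqP; rewrite -subv0; apply/subvP => w.
    rewrite memv_cap => /andP[wF /vlineP[a wE]]; rewrite memv0 wE.
    case: (eqVneq a 0) => [->|a0]; first by rewrite scale0r.
    by move: wF; rewrite wE rpredZeq (negPf a0) (negPf vF).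
  by rewrite dimv_disjoint_sum // dimF (minn_idPl (ltnW kd)) dim_vline v0 addn1.
have spanv k : (k <= d)%N -> <<mkseq v k>>%VS = F k.
  elim: k => [_|k IH kd].
    by rewrite span_nil; apply/esym/eqP; rewrite -dimv_eq0 dimF min0n.
  by rewrite mkseqS -cats1 span_cat span_seq1 IH ?vP // ltnW.
pose M : 'M[K]_d := \matrix_(i, j) coord (vbasis {:V}) j (v i).
have frM : frame M = mkseq v d.
  apply: (@eq_from_nth _ 0); rewrite ?size_frame ?size_mkseq // => i id.
  rewrite nth_mkseq // (nth_frame M (Ordinal id)) /=.
  rewrite [RHS](coord_vbasis (memvf _)).
  by apply: eq_bigr => j _; rewrite mxE.
exists (mxvec M).
  split=> //=; rewrite mxvecK frame_free frM /free spanv // size_mkseq dimF.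
  by rewrite minnn.
apply/funext => k; rewrite /flag_of_frame mxvecK frM.
case: (leqP k d) => kd.
  rewrite -spanv //; congr span; apply: (@eq_from_nth _ 0).
    by rewrite size_take_min !size_mkseq; apply/minn_idPl.
  move=> i; rewrite size_take_min !size_mkseq (minn_idPl kd) => ik.
  by rewrite nth_take // !nth_mkseq // (leq_trans ik).
rewrite take_oversize ?size_mkseq ?(ltnW kd) // spanv //.
have full l : \dim (F l) = d -> F l = fullv.
  by move=> Fl; apply/eqP; rewrite eqEdim subvf Fl /=.
have Fd : F d = fullv by apply: full; rewrite dimF minnn.
have Fk : F k = fullv by apply: full; rewrite dimF; apply/minn_idPr/ltnW.
exact: etrans Fd (esym Fk).
Qed.

End FlagTheory.

Lemma dom_biproj (K : fieldType) (a b : nat)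
    (p : {vspace 'rV[K]_a} * {vspace 'rV[K]_b}) :
  dom (biproj K a b) p <-> \dim p.1 = 1%N /\ \dim p.2 = 1%N.
Proof.
split=> [[z [_ /= [z1 z2]] <-] /= | []]; first by rewrite !dim_vline z1 z2.
have line (W : vectType K) (L : {vspace W}) : \dim L = 1%N ->
    vpick L != 0 /\ <[vpick L]>%VS = L.
  move=> dL; have L0 : vpick L != 0 by rewrite vpick0 -dimv_eq0 dL.
  split=> //; apply/eqP; rewrite eqEdim -memvE memv_pick dL dim_vline L0.
  by [].
move=> /line[n1 e1] /line[n2 e2].
exists (row_mx (vpick p.1) (vpick p.2)).
  by split=> //=; rewrite row_mxKl row_mxKr.
by rewrite row_mxKl row_mxKr e1 e2; case: (p).
Qed.

Lemma taut_power_line (K : fieldType) (m : nat) (u : 'rV[K]_2) :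
  u != 0 -> taut_power m <[u]> = <[veronese m u]>%VS.
Proof.
move=> u0; have /vlineP[k pk] := memv_pick <[u]>.
have k0 : k != 0.
  have : vpick <[u]> != 0 by rewrite vpick0 -dimv_eq0 dim_vline u0.
  by rewrite pk scaler_eq0 negb_or => /andP[].
have -> : taut_power m <[u]> = <[k ^+ m *: veronese m u]>%VS.
  rewrite /taut_power pk; congr (<[_]>)%VS; apply/rowP => i.
  rewrite !mxE !exprMn mulrACA -exprD subnK //.
  by rewrite -ltnS ltn_ord.
apply/eqP; rewrite eqEsubv -!memvE memvZ ?memv_line //=.
have {1}<- : k ^- m *: (k ^+ m *: veronese m u) = veronese m u.
  by rewrite scalerA mulVf ?scale1r // expf_neq0.
by rewrite memvZ // memv_line.
Qed.

Section SubquotientTheory.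
Variables (K : fieldType) (V : vectType K) (form : {skew_symmetric V}).
Variable F : {vspace V}.
Hypothesis F_isotropic : (F <= orthov form F)%VS.

Lemma vsval_perp_class w :
  vsval (perp_class form F w) = addv_pi1 (orthov form F) F w.
Proof. by rewrite vsprojK // memv_pi. Qed.

Lemma perp_class_sub w : w \in orthov form F ->
  w - vsval (perp_class form F w) \in F.
Proof.
move=> Pw; rewrite vsval_perp_class.
have /addv_pi1_pi2 {1}<- : w \in (orthov form F + F)%VS.
  by rewrite (subvP (addvSl _ _)).
by rewrite addrC addKr memv_pi2.
Qed.

Lemma perp_quo_mem (a : perp_quo form F) : vsval a \in orthov form F.
Proof. exact: (subvP (diffvSl _ _) _ (subvsP a)). Qed.

Lemma perp_class_eq0 w : w \in orthov form F ->
  (perp_class form F w == 0) = (w \in F).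
Proof.
move=> Pw; have Fw := perp_class_sub Pw.
apply/eqP/idP=> [w0|wF]; first by rewrite w0 (linear0 vsval) subr0 in Fw.
apply/val_inj/eqP => /=; rewrite -memv0 -(capv_diff (orthov form F) F) memv_cap.
rewrite subvsP -[X in X \in _](subKr w) rpredB //.
Qed.

Lemma perp_class_surj (a : perp_quo form F) : perp_class form F (vsval a) = a.
Proof.
apply/val_inj => /=; rewrite vsval_perp_class daddv_pi_id ?capv_diff //.
exact: subvsP.
Qed.

Lemma perp_class_form w w' : w \in orthov form F -> w' \in orthov form F ->
  perp_form (perp_class form F w) (perp_class form F w') = form w w'.
Proof.
move=> Pw Pw'; rewrite /perp_form.
set u := vsval _; set u' := vsval _.
have Pu : u \in orthov form F by apply: perp_quo_mem.
have h1 : form (w - u) w' = 0.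
  by rewrite hermC (mem_orthovP Pw') ?perp_class_sub ?rmorph0 ?mulr0.
have h2 : form u (w' - u') = 0 by rewrite (mem_orthovP Pu) ?perp_class_sub.
move: h1 h2; rewrite linearBl linearB /= => /eqP; rewrite subr_eq0 => /eqP->.
by move=> /eqP; rewrite subr_eq0 => /eqP->.
Qed.

Lemma perp_class_end (x : 'End(V)) w : w \in orthov form F ->
    (x @: F <= F)%VS ->
  perp_end form F x (perp_class form F w) = perp_class form F (x w).
Proof.
move=> Pw xF; rewrite /perp_end lfunE /=; apply/eqP.
rewrite -subr_eq0 -!linearB -opprB !linearN oppr_eq0 perp_class_eq0.
  by apply: (subvP xF); apply: memv_img; apply: perp_class_sub.
apply: (subvP F_isotropic); apply: (subvP xF); apply: memv_img.
exact: perp_class_sub.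
Qed.

End SubquotientTheory.

(* Main.v *)
(* In a Jordan basis e_1 .. e_n, f_1 .. f_n of (v, x) one has v = e_{n-2}.  Put
   m = n - k - 1 and E = <e_1 .. e_m>.  A flag of C_n^{k,k+1} satisfies F_m = E;
   F_{m+1} = E + <a e_{m+1} + b f_n>, where ker x = <e_1, f_n>, and F_{m+2} lies in
   x^{-1}(F_{m+1}) = E + <e_{m+1}, f_n, a e_{m+2} + b f_{n-1}>, while F_i is determined
   by F_{m+1} for m + 3 <= i <= n, and by duality for i > n.  So the closure is the
   bundle of the lines in x^{-1}(F_{m+1}) / F_{m+1} over P^1 = {(a : b)}.  The Pluecker
   coordinates of F_{m+2} / E are (c : D a^2 : D ab : D b^2), which is exactly a line
   in K + O(-2)_(a:b) inside K + Sym^2, and this identifies the bundle with P(O + O(-2)).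
   Both maps have polynomial lifts to frames: minors in one direction, explicit
   sections, completed by a dual frame, in the other.  The cell is dense, because it
   contains the open part b <> 0, D <> 0, where the exotic types of the subquotients can
   be computed. *)

Require Import Defs.
From mathcomp Require Import all_boot all_order all_algebra.
From mathcomp Require Import sesquilinear complex.
From mathcomp Require Import reals.
From mathcomp Require Import mpoly boolp classical_sets zify ring.

Set Implicit Arguments.
Unset Strict Implicit.
Unset Printing Implicit Defensive.

Import Order.TTheory GRing.Theory.
Local Open Scope ring_scope.
Local Open Scope classical_set_scope.

(** * Morphisms between subspaces of quotients of affine cones *)

Section PolynomialFunctions.
Variable K : fieldType.

(** The twist -2 comes from [x]. A vector completing [F_{m+1}] to [F_{m+2}] is sent by [x] into
    [F_{m+1}], so modulo [E] its last two coordinates form a multiple [D (a, b)]; wedging it with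
    [a e_{m+1} + b f_n] then gives coordinates quadratic in [(a, b)]. The main obstacle is that a
    point of the flag variety is a class of frames. Regularity has to be checked on polynomial maps
    between frames that respect the classes on a whole neighbourhood, also off the component. Minors
    do this for every flag at which they give two nonzero blocks. In the other direction no single
    family of sections is free everywhere: a vector [(al, be)] independent of [(a, b)] and the
    outcome of the test [D == 0] are frozen at the point under consideration, and only freeness at
    that point is required. Density uses that the field is infinite: through every point of the
    component runs a curve on which all but finitely many parameters satisfy [b D <> 0]. *)

Definition polyfun d (f : 'rV[K]_d -> K) : Prop :=
  exists p : {mpoly K[d]}, forall z, f z = p.@[z 0].

Definition polymap d e (P : 'rV[K]_d -> 'rV[K]_e) : Prop :=
  forall j, polyfun (fun z => P z 0 j).

Lemma polyfun_ext d (f g : 'rV[K]_d -> K) : f =1 g -> polyfun f -> polyfun g.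
Proof. by move=> fg [p pE]; exists p => z; rewrite -fg. Qed.

Lemma polyfun_cst d c : polyfun (fun _ : 'rV[K]_d => c).
Proof. by exists c%:MP => z; rewrite mevalC. Qed.

Lemma polyfun_coord d (i : 'I_d) : polyfun (fun z : 'rV[K]_d => z 0 i).
Proof. by exists 'X_i => z; rewrite mevalXU. Qed.

Lemma polyfunD d (f g : 'rV[K]_d -> K) :
  polyfun f -> polyfun g -> polyfun (fun z => f z + g z).
Proof. by move=> [p pE] [q qE]; exists (p + q) => z; rewrite pE qE mevalD. Qed.

Lemma polyfunM d (f g : 'rV[K]_d -> K) :
  polyfun f -> polyfun g -> polyfun (fun z => f z * g z).
Proof. by move=> [p pE] [q qE]; exists (p * q) => z; rewrite pE qE mevalM. Qed.

Lemma polyfunN d (f : 'rV[K]_d -> K) : polyfun f -> polyfun (fun z => - f z).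
Proof. by move=> [p pE]; exists (- p) => z; rewrite pE mevalN. Qed.

Lemma polyfun_sum d I (r : seq I) (P : pred I) (f : I -> 'rV[K]_d -> K) :
  (forall i, polyfun (f i)) -> polyfun (fun z => \sum_(i <- r | P i) f i z).
Proof.
move=> pf; elim: r => [|i r IH].
  by apply: polyfun_ext (polyfun_cst d 0) => z; rewrite big_nil.
case Pi: (P i); last by apply: polyfun_ext IH => z; rewrite big_cons Pi.
by apply: polyfun_ext (polyfunD (pf i) IH) => z; rewrite big_cons Pi.
Qed.

Lemma polyfun_prod d I (r : seq I) (P : pred I) (f : I -> 'rV[K]_d -> K) :
  (forall i, polyfun (f i)) -> polyfun (fun z => \prod_(i <- r | P i) f i z).
Proof.
move=> pf; elim: r => [|i r IH].
  by apply: polyfun_ext (polyfun_cst d 1) => z; rewrite big_nil.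
case Pi: (P i); last by apply: polyfun_ext IH => z; rewrite big_cons Pi.
by apply: polyfun_ext (polyfunM (pf i) IH) => z; rewrite big_cons Pi.
Qed.

Lemma polyfun_det d r (M : 'rV[K]_d -> 'M[K]_r) :
  (forall i j, polyfun (fun z => M z i j)) -> polyfun (fun z => \det (M z)).
Proof.
move=> pM; apply: polyfun_sum => s; apply: polyfunM; first exact: polyfun_cst.
by apply: polyfun_prod => i; apply: pM.
Qed.

Lemma polyfun_adj d r (M : 'rV[K]_d -> 'M[K]_r) i j :
  (forall i j, polyfun (fun z => M z i j)) -> polyfun (fun z => (\adj (M z)) i j).
Proof.
move=> pM; apply: (polyfun_ext (f := fun z => cofactor (M z) j i)) => [z|].
  by rewrite mxE.
apply: polyfunM; first exact: polyfun_cst.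
apply: polyfun_det => a b.
by apply: polyfun_ext (pM (lift j a) (lift i b)) => z; rewrite !mxE.
Qed.

Lemma polyfun_comp d e (P : 'rV[K]_d -> 'rV[K]_e) (f : 'rV[K]_e -> K) :
  polymap P -> polyfun f -> polyfun (f \o P).
Proof.
move=> /fin_all_exists[p pE] [q qE].
exists (q \mPo [tuple p i | i < e]) => z; rewrite comp_mpoly_meval /= qE.
by apply: meval_eq => i; rewrite tnth_mktuple.
Qed.

Lemma polyfun_curve d (f : 'rV[K]_d -> K) (q : 'I_d -> {poly K}) :
  polyfun f -> exists p : {poly K}, forall t, f (\row_i (q i).[t]) = p.[t].
Proof.
move=> [p pE]; exists (\sum_(m <- msupp p) p@_m *: \prod_i q i ^+ m i) => t.
rewrite pE mevalE horner_sum; apply: eq_bigr => m _.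
rewrite hornerZ horner_prod; congr (_ * _); apply: eq_bigr => i _.
by rewrite mxE horner_exp.
Qed.

End PolynomialFunctions.

Section Ringed.
Variable K : fieldType.

(** These closure properties allow openness in a subspace to be tested point by point and iterated
    subspaces to be flattened. *)
Definition ringed (X : fspace K) : Prop :=
  [/\ forall A B, opn X A -> opn X B -> opn X (A `&` B),
      forall P : set (pt X) -> Prop, (forall A, P A -> opn X A) ->
        opn X [set t | exists2 A, P A & A t]
    & forall A B f, B `<=` A -> reg X A f -> reg X B f].

Variable X : fspace K.
Hypothesis ringedX : ringed X.
Let opnI := let: And3 h _ _ := ringedX in h.
Let opnU := let: And3 _ h _ := ringedX in h.
Let regS := let: And3 _ _ h := ringedX in h.

(** The union of all open sets whose trace lies in [A] is a global witness, so neighbourhoods of the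
    single points suffice. *)
Lemma opn_subspaceP Y A :
  opn (subspace (X := X) Y) A <->
  forall t, dom X t -> Y t -> A t ->
    exists B, [/\ opn X B, B t & forall s, dom X s -> Y s -> B s -> A s].
Proof.
split=> [[B oB tr] t Qt Yt At | loc].
  have mem s : (dom X `&` Y `&` A) s <-> (dom X `&` Y `&` B) s by rewrite tr.
  exists B; split=> //; first by case/mem: (conj (conj Qt Yt) At).
  by move=> s Qs Ys Bs; case/mem: (conj (conj Qs Ys) Bs).
exists [set t | exists2 B, opn X B /\ (forall s, dom X s -> Y s -> B s -> A s) & B t].
  by apply: (opnU (P := fun B => _ /\ _)) => B [].
apply/seteqP; split=> t [[Qt Yt] Ht]; split; try by [].
  by have [B [oB Bt BA]] := loc _ Qt Yt Ht; exists B.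
by case: Ht => B [_ BA] Bt; apply: BA.
Qed.

(** The closure of the cell is taken inside the Springer fibre, itself a subspace of the flag
    variety; this removes the intermediate space. A regular function on the inner subspace extends
    locally twice, and the two neighbourhoods are intersected. *)
Lemma subspace_subspace_iso Y1 Y2 Y :
  (forall t, dom X t -> (Y t <-> Y1 t /\ Y2 t)) ->
  isomorphic (subspace (X := subspace (X := X) Y1) Y2) (subspace (X := X) Y).
Proof.
move=> YE; have YI t : dom X t -> Y t -> Y1 t /\ Y2 t by move=> /YE[].
have IY t : dom X t -> Y1 t -> Y2 t -> Y t by move=> /YE[_ h] *; apply: h.
have eqI (U V : set (pt X)) (t : pt X) : U = V -> U t -> V t by move=> ->.
exists id, id; split=> [||t _|t _]; [| |by []|by []]; split.
- by move=> t [[Qt Y1t] Y2t]; split; [|apply: IY].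
- move=> A [B oB tr]; exists B; first by exists B.
  apply/seteqP; split=> t [[[Qt Y1t] Y2t] Ht]; split; try by [].
    by case: (eqI _ _ t tr (conj (conj Qt (IY _ Qt Y1t Y2t)) Ht)).
  by case: (eqI _ _ t (esym tr) (conj (conj Qt (IY _ Qt Y1t Y2t)) Ht)).
- move=> A f _ rf t [[[Qt Y1t] Y2t] At].
  have [B [g [oB Bt rg fg]]] := rf t (conj (conj Qt (IY _ Qt Y1t Y2t)) At).
  exists B, g; split=> //; first by exists B.
    by move=> s [[Qs Y1s] Bs]; exists B, g; split=> // ? [].
  move=> s [[[[Qs Y1s] Y2s] As] Bs].
  exact: fg (conj (conj (conj Qs (IY _ Qs Y1s Y2s)) As) Bs).
- by move=> t [Qt Yt]; have [] := YI _ Qt Yt.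
- move=> A [B [B' oB' trB] tr]; exists B' => //.
  apply/seteqP; split=> t [[Qt Yt] Ht]; split; try by [].
    have [Y1t Y2t] := YI _ Qt Yt.
    have [_ Bt] := eqI _ _ t tr (conj (conj (conj Qt Y1t) Y2t) Ht).
    by case: (eqI _ _ t trB (conj (conj Qt Y1t) Bt)).
  have [Y1t Y2t] := YI _ Qt Yt.
  have [_ Bt] := eqI _ _ t (esym trB) (conj (conj Qt Y1t) Ht).
  by case: (eqI _ _ t (esym tr) (conj (conj (conj Qt Y1t) Y2t) Bt)).
- move=> A f _ rf t [[Qt Yt] At]; have [Y1t Y2t] := YI _ Qt Yt.
  have [B [g [[B' oB' trB] Bt rg fg]]] := rf t (conj (conj (conj Qt Y1t) Y2t) At).
  have [C [h [oC Ct rh gh]]] := rg t (conj (conj Qt Y1t) Bt).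
  have [_ B't] := eqI _ _ t trB (conj (conj Qt Y1t) Bt).
  exists (B' `&` C), h; split.
  + exact: opnI.
  + by split.
  + by apply: regS rh => s [].
  + move=> s [[[Qs Ys] As] [B's Cs]]; have [Y1s Y2s] := YI _ Qs Ys.
    have [_ Bs] := eqI _ _ s (esym trB) (conj (conj Qs Y1s) B's).
    apply: etrans (fg _ (conj (conj (conj (conj Qs Y1s) Y2s) As) Bs)) _.
    exact: gh (conj (conj (conj Qs Y1s) Bs) Cs).
Qed.

End Ringed.

(** * Open sets and regular functions of a quotient of affine space, tested upstairs *)

Section AffineQuotients.
Variable K : fieldType.

Lemma opn_affineP d (A : set 'rV[K]_d) :
  opn (affine_space K d) A <->
  forall z, A z -> exists p, [/\ polyfun p, p z != 0 & forall y, p y != 0 -> A y].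
Proof.
split=> [[I ->] z [p Ip pz] | loc].
  exists (fun y : 'rV_d => p.@[y 0]); split=> // [|y py]; last by exists p.
  by exists p.
exists [set p : {mpoly K[d]} | forall y : 'rV_d, p.@[y 0] != 0 -> A y].
apply/seteqP; split=> [z Az|z [p Ip]].
  have [q [[p pE] qz qA]] := loc _ Az.
  by exists p => [y|] /=; rewrite -pE //; apply: qA.
exact: Ip.
Qed.

Lemma reg_affineP d A (f : 'rV[K]_d -> K) :
  reg (affine_space K d) A f <->
  forall z, A z -> exists p q, [/\ polyfun p, polyfun q, q z != 0 &
    forall y, A y -> q y != 0 -> f y = p y / q y].
Proof.
split=> regf z Az.
  have [p [q [qz fE]]] := regf _ Az.
  exists (fun y : 'rV_d => p.@[y 0]), (fun y : 'rV_d => q.@[y 0]).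
  by split=> //; [exists p|exists q].
have [g [h [[p pE] [q qE] qz fE]]] := regf _ Az.
exists p, q; rewrite -qE; split=> // y Ay; rewrite -qE => qy.
by rewrite fE // pE qE.
Qed.

Section Quotient.
Variables (d : nat) (S : set 'rV[K]_d) (T : Type) (q : 'rV[K]_d -> T).
Local Notation Q := (quotient_space (X := subspace (X := affine_space K d) S) q).

Lemma dom_quotP t : dom Q t <-> exists2 z, S z & q z = t.
Proof.
split=> [[z [_ Sz] <-]|[z Sz <-]]; first by exists z.
by exists z => //; split.
Qed.

Lemma opn_quotP A : opn Q A <->
  forall z, S z -> A (q z) ->
    exists p, [/\ polyfun p, p z != 0 & forall y, S y -> p y != 0 -> A (q y)].
Proof.
split=> [[B oB tr] z Sz Az | loc].
  have Bz : B z by have : (setT `&` S `&` (q @^-1` A)) z by []; rewrite tr => -[].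
  have [p [pf pz pB]] := (opn_affineP B).1 oB _ Bz.
  exists p; split=> // y Sy py.
  have : (setT `&` S `&` B) y by split=> //; apply: pB.
  by rewrite -tr => -[].
exists [set z | exists p, [/\ polyfun p, p z != 0 &
          forall y, S y -> p y != 0 -> A (q y)]].
  apply/opn_affineP => z [p [pf pz pA]].
  by exists p; split=> // y py; exists p.
apply/seteqP; split=> z [[_ Sz] /= Az]; split=> //; first exact: loc.
by case: Az => p [_ pz pA]; apply: pA.
Qed.

Lemma reg_quotP A f : reg Q A f <->
  forall z, S z -> A (q z) ->
    exists p1 p2, [/\ polyfun p1, polyfun p2, p2 z != 0 &
      forall y, S y -> A (q y) -> p2 y != 0 -> f (q y) = p1 y / p2 y].
Proof.
split=> [regf z Sz Az | loc].
  have [|B [g [oB Bz rg fg]]] := regf z; first by [].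
  have [b [bf bz bB]] := (opn_affineP B).1 oB _ Bz.
  have [p1 [p2 [pf1 pf2 p2z gE]]] := (reg_affineP B g).1 rg _ Bz.
  (* The factor [b] leaves the fraction unchanged and confines the nonvanishing locus of the
     denominator to [B], where [g] agrees with [f \o q]. *)
  exists (fun y => p1 y * b y), (fun y => p2 y * b y).
  split; try exact: polyfunM; first by rewrite mulf_neq0.
  move=> y Sy Ay; rewrite mulf_eq0 negb_or => /andP[p2y by0].
  rewrite -mulf_div divff // mulr1 -gE //; last exact: bB.
  by apply: fg; split=> //; apply: bB.
move=> z [[_ Sz] Az]; have [p1 [p2 [pf1 pf2 p2z fE]]] := loc _ Sz Az.
exists [set y | p2 y != 0], (fun y => p1 y / p2 y); split=> //.
- by apply/opn_affineP => y /= py; exists p2.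
- by apply/reg_affineP => y /= py; exists p1, p2.
- by move=> y [[[_ Sy] Ay] py]; apply: fE.
Qed.

Lemma opn_quotI A B : opn Q A -> opn Q B -> opn Q (A `&` B).
Proof.
move=> /opn_quotP oA /opn_quotP oB; apply/opn_quotP => z Sz [Az Bz].
have [p [pf pz pA]] := oA _ Sz Az; have [r [rf rz rB]] := oB _ Sz Bz.
exists (fun y => p y * r y); split; [exact: polyfunM | by rewrite mulf_neq0 |].
move=> y Sy; rewrite mulf_eq0 negb_or => /andP[py ry].
by split; [apply: pA | apply: rB].
Qed.

Lemma reg_quotS A B f : B `<=` A -> reg Q A f -> reg Q B f.
Proof.
move=> BA /reg_quotP rf; apply/reg_quotP => z Sz Bz.
have [p1 [p2 [pf1 pf2 p2z fE]]] := rf _ Sz (BA _ Bz).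
by exists p1, p2; split=> // y Sy By; apply: fE => //; apply: BA.
Qed.

Lemma opn_quot_bigcup (P : set (set T)) :
  (forall A, P A -> opn Q A) -> opn Q [set t | exists2 A, P A & A t].
Proof.
move=> oP; apply/opn_quotP => z Sz [A PA Az].
have [p [pf pz pA]] := (opn_quotP A).1 (oP _ PA) _ Sz Az.
by exists p; split=> // y Sy py; exists A => //; apply: pA.
Qed.

Lemma ringed_quot : ringed Q.
Proof.
by split; [apply: opn_quotI | apply: opn_quot_bigcup | apply: reg_quotS].
Qed.

End Quotient.

Section Lift.
Variables (d e : nat) (S : set 'rV[K]_d) (S' : set 'rV[K]_e) (T T' : Type).
Variables (q : 'rV[K]_d -> T) (q' : 'rV[K]_e -> T') (Y : set T) (Y' : set T').
Local Notation Q := (quotient_space (X := subspace (X := affine_space K d) S) q).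
Local Notation Q' := (quotient_space (X := subspace (X := affine_space K e) S') q').

(* The map [f] of Y into Y' extends to a neighbourhood of [q z0] in Q, and this
   extension has a polynomial lift. *)
Definition local_lift (f : T -> T') (z0 : 'rV[K]_d) : Prop :=
  exists P : 'rV[K]_d -> 'rV[K]_e, [/\ polymap P, S' (P z0),
    forall z y, S z -> S y -> q z = q y -> S' (P z) ->
      S' (P y) /\ q' (P z) = q' (P y)
  & forall z, S z -> Y (q z) -> S' (P z) -> q' (P z) = f (q z)].

(** A regular function on the target subspace is a local restriction of one on [Q']. Its pullback
    must in turn extend to an open set of [Q], which is why a lift has to be constant on classes off
    [Y] as well. *)
Lemma morphism_of_lifts (f : T -> T') :
  opn (affine_space K e) S' ->
  (forall z, S z -> Y (q z) -> Y' (f (q z))) ->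
  (forall z, S z -> Y (q z) -> local_lift f z) ->
  morphism (X := subspace (X := Q) Y) (Y := subspace (X := Q') Y') f.
Proof.
move=> /opn_affineP oS' YY' lifts.
(* By invariance, if one representative of a point lands in [S'] over [B'], then all do, so
   nonvanishing of polynomials in the lift describes this set upstairs. *)
have openC P (B' : set T') : polymap P ->
    (forall z y, S z -> S y -> q z = q y -> S' (P z) ->
      S' (P y) /\ q' (P z) = q' (P y)) -> opn Q' B' ->
    opn Q [set t | exists z, [/\ S z, q z = t, S' (P z) & B' (q' (P z))]].
  move=> pP inv /opn_quotP oB'; apply/opn_quotP => z Sz [y [Sy yz S'y B'y]].
  have [S'z qE] := inv _ _ Sy Sz yz S'y; rewrite qE in B'y.
  have [p1 [pf1 p1z p1S]] := oS' _ S'z.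
  have [p2 [pf2 p2z p2B]] := oB' _ S'z B'y.
  exists (fun y => p1 (P y) * p2 (P y)); split=> [||x Sx].
  - by apply: polyfunM; [apply: polyfun_comp pP pf1 | apply: polyfun_comp pP pf2].
  - by rewrite mulf_neq0.
  rewrite mulf_eq0 negb_or => /andP[p1x p2x].
  by exists x; split=> //; [apply: p1S | apply: p2B => //; apply: p1S].
split.
- move=> t [/dom_quotP[z Sz <-] Yt]; split; last exact: YY'.
  have [P [_ S'z _ PE]] := lifts _ Sz Yt.
  by apply/dom_quotP; exists (P z) => //; apply: PE.
- move=> A /(opn_subspaceP (ringed_quot _ _)) oA; apply/(opn_subspaceP (ringed_quot _ _)).
  move=> t /dom_quotP[z Sz <-] Yt At.
  have [P [pP S'z inv PE]] := lifts _ Sz Yt.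
  have Q'f : dom Q' (f (q z)) by apply/dom_quotP; exists (P z) => //; apply: PE.
  have [B' [oB' B't B'A]] := oA _ Q'f (YY' _ Sz Yt) At.
  eexists; split; first exact: (openC P B').
    by exists z; rewrite PE.
  move=> s _ Ys [y [Sy ys S'y]]; subst s; rewrite PE // => B'y; apply: B'A => //.
    by apply/dom_quotP; exists (P y) => //; apply: PE.
  exact: YY'.
- move=> A g _ rg t [[/dom_quotP[z Sz <-] Yt] At].
  have [P [pP S'z inv PE]] := lifts _ Sz Yt.
  have domf y : S y -> Y (q y) -> S' (P y) -> dom Q' (f (q y)).
    by move=> Sy Yy S'y; apply/dom_quotP; exists (P y) => //; apply: PE.
  have [|B' [g' [oB' B't rg' gg']]] := rg (f (q z)).
    by split=> //; split; [apply: domf | apply: YY'].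
  (* The extension to [Q] is defined through an arbitrary representative [h t] of [t]; invariance of
     the lift makes the value independent of the choice. *)
  pose C := [set t | exists z, [/\ S z, q z = t, S' (P z) & B' (q' (P z))]].
  have /choice[h hP] : forall t, exists y, C t -> [/\ S y, q y = t, S' (P y) & B' (q' (P y))].
    by move=> t'; case: (pselect (C t')) => [[y Cy]|nC]; [exists y | exists z].
  exists C, (fun t => g' (q' (P (h t)))); split.
  + exact: openC.
  + by exists z; rewrite PE.
  + apply/reg_quotP => y Sy Cy.
    have hE x : S x -> C (q x) -> S' (P x) /\ q' (P (h (q x))) = q' (P x).
      by move=> Sx /hP[Sh qh S'h _]; have [? ?] := inv _ _ Sh Sx qh S'h.
    have BE x : S x -> C (q x) -> B' (q' (P x)).
      by move=> Sx Cx; rewrite -(hE _ Sx Cx).2; case: (hP _ Cx).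
    have [p1 [p2 [pf1 pf2 p2y gE]]] :=
      (reg_quotP _ _).1 rg' _ (hE _ Sy Cy).1 (BE _ Sy Cy).
    exists (p1 \o P), (p2 \o P); split=> //; try exact: polyfun_comp.
    move=> x Sx Cx p2x; have [S'x ->] := hE _ Sx Cx.
    by apply: gE => //; apply: BE.
  + move=> s [[[/dom_quotP[y Sy <-] Yy] Ay] Cy].
    have [Sh qh S'h B'h] := hP _ Cy; rewrite /= PE // qh // in B'h *.
    apply: gg'; split=> //; split=> //; split; last exact: YY'.
    by rewrite -qh; apply: domf; rewrite ?qh.
Qed.

End Lift.

Lemma isomorphic_trans (X Y Z : fspace K) :
  isomorphic X Y -> isomorphic Y Z -> isomorphic X Z.
Proof.
move=> [f [f' [[fd fo fr] [f'd f'o f'r] ff' f'f]]].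
move=> [g [g' [[gd go gr] [g'd g'o g'r] gg' g'g]]].
exists (g \o f), (f' \o g'); split.
- split=> [z Xz|A oA|A h oA rh]; first exact/gd/fd.
    exact: fo (go _ oA).
  exact: fr (go _ oA) (gr _ _ oA rh).
- split=> [z Xz|A oA|A h oA rh]; first exact/f'd/g'd.
    exact: g'o (f'o _ oA).
  exact: g'r (f'o _ oA) (f'r _ _ oA rh).
- by move=> z Xz /=; rewrite gg' ?ff' //; apply: fd.
- by move=> z Xz /=; rewrite f'f ?g'g //; apply: g'd.
Qed.

End AffineQuotients.

(** * Frames and Lagrangian flags *)

Section Span.
Variables (K : fieldType) (V : vectType K).
Implicit Types (w : nat -> V) (p : V).

Lemma mem_span_mkseqP w m p :
  p \in <<mkseq w m>>%VS <-> exists a : nat -> K, p = \sum_(i < m) a i *: w i.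
Proof.
split=> [|[a ->]]; last first.
  by apply: rpred_sum => i _; apply/rpredZ/memv_span/map_f; rewrite mem_iota /=.
move=> pin; have szm := size_mkseq w m.
pose X := Tuple (introT eqP szm).
exists (fun i => if insub i is Some j then coord X j p else 0).
by rewrite {1}(coord_span (X := X) pin); apply: eq_bigr => i _; rewrite valK nth_mkseq.
Qed.

Lemma mem_mkseq_span w m i : (i < m)%N -> w i \in <<mkseq w m>>%VS.
Proof. by move=> im; apply/memv_span/map_f; rewrite mem_iota. Qed.

Lemma span_mkseq_sub w m (F : {vspace V}) :
  (forall i, (i < m)%N -> w i \in F) -> (<<mkseq w m>> <= F)%VS.
Proof.
move=> wF; apply/span_subvP => p; rewrite /mkseq => pin.
have [i im ->] := mapP pin; apply: wF.
by rewrite mem_iota in im.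
Qed.

Lemma span_mkseqS w m : <<mkseq w m.+1>>%VS = (<<mkseq w m>> + <[w m]>)%VS.
Proof. by rewrite mkseqS -cats1 span_cat span_seq1. Qed.

Lemma mkseq_free_le w m m' : (m <= m')%N -> free (mkseq w m') -> free (mkseq w m).
Proof.
move=> mm'; rewrite -(subnKC mm') /mkseq iotaD map_cat; exact: catl_free.
Qed.

Lemma dim_mkseq_free w m : free (mkseq w m) -> \dim <<mkseq w m>> = m.
Proof. by rewrite /free size_mkseq => /eqP. Qed.

Lemma free_notin w m i :
  free (mkseq w m) -> (i < m)%N -> w i \notin <<mkseq w i>>%VS.
Proof.
move=> fw ip; apply/negP => wi.
have := dim_mkseq_free (mkseq_free_le ip fw); rewrite span_mkseqS.
rewrite (addv_idPl _) -?memvE // dim_mkseq_free; last exact: mkseq_free_le (ltnW ip) fw.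
by move=> h; case: (n_Sn _ h).
Qed.

Lemma span_mkseq_free w m (F : {vspace V}) :
  free (mkseq w m) -> (forall i, (i < m)%N -> w i \in F) -> (\dim F <= m)%N ->
  <<mkseq w m>>%VS = F.
Proof.
move=> fw wF dF; apply/eqP; rewrite eqEdim span_mkseq_sub //=.
by rewrite dim_mkseq_free.
Qed.

Lemma free_mkseqP w m :
  (forall a : nat -> K, \sum_(i < m) a i *: w i = 0 -> forall i, (i < m)%N -> a i = 0) ->
  free (mkseq w m).
Proof.
move=> h; have szm := size_mkseq w m.
suff : free (Tuple (introT eqP szm)) by [].
apply/freeP => k k0 i.
pose a j := if insub j is Some j' then k j' else 0.
have aE (j : 'I_m) : a j = k j by rewrite /a valK.
rewrite -aE; apply: h => //; rewrite -[RHS]k0.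
by apply: eq_bigr => j _; rewrite aE /= nth_mkseq.
Qed.

End Span.

Section Frames.
Variables (K : fieldType) (V : vectType K).
Local Notation d := (\dim {:V}).

Lemma coord_vbasisE (j l : 'I_d) :
  coord (vbasis {:V}) j (vbasis {:V})`_l = (l == j)%:R.
Proof. by rewrite coord_free // (basis_free (vbasisP _)). Qed.

Definition frame_mx (w : nat -> V) : 'M[K]_d :=
  \matrix_(i, j) coord (vbasis {:V}) j (w i).

Lemma frame_frame_mx w : frame (frame_mx w) = mkseq w d.
Proof.
apply: (@eq_from_nth _ 0); rewrite ?size_frame ?size_mkseq // => i id.
rewrite nth_mkseq // (nth_frame _ (Ordinal id)) /=.
rewrite [RHS](coord_vbasis (memvf _)).
by apply: eq_bigr => j _; rewrite mxE.
Qed.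

Lemma frame_mkseq (M : 'M[K]_d) : frame M = mkseq (fun i => (frame M)`_i) d.
Proof. by rewrite -[LHS](mkseq_nth 0) size_frame. Qed.

Lemma take_mkseq (w : nat -> V) m k : (k <= m)%N -> take k (mkseq w m) = mkseq w k.
Proof. by move=> km; rewrite /mkseq -map_take take_iota (minn_idPl km). Qed.

Lemma flag_of_frameE z k : (k <= d)%N ->
  flag_of_frame z k = <<mkseq (fun i => (frame (vec_mx z : 'M[K]_d))`_i) k>>%VS.
Proof. by move=> kd; rewrite /flag_of_frame [in LHS]frame_mkseq take_mkseq. Qed.

Lemma complete_flag_full (F : nat -> {vspace V}) k :
  complete_flag F -> (d <= k)%N -> F k = fullv.
Proof.
move=> cF dk; apply/eqP; rewrite eqEdim subvf /=; case: (cF k) => _ ->.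
by rewrite (minn_idPr dk).
Qed.

Lemma complete_flag_le (F : nat -> {vspace V}) i j :
  complete_flag F -> (i <= j)%N -> (F i <= F j)%VS.
Proof.
move=> cF; elim: j => [|j IH]; first by rewrite leqn0 => /eqP->.
rewrite leq_eqVlt => /orP[/eqP-> //|ij].
by apply: subv_trans (IH ij) _; case: (cF j).
Qed.

Lemma flag_of_frame_mx w (F : nat -> {vspace V}) :
  complete_flag F -> free (mkseq w d) -> (forall l, (l < d)%N -> w l \in F l.+1) ->
  flag_of_frame (mxvec (frame_mx w)) = F.
Proof.
move=> cF fw wF; apply/funext => k; rewrite /flag_of_frame mxvecK frame_frame_mx.
case: (leqP k d) => kd; last first.
  rewrite take_oversize ?size_mkseq 1?ltnW // (complete_flag_full cF (ltnW kd)).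
  by apply/eqP; rewrite eqEdim subvf /= dim_mkseq_free.
rewrite take_mkseq //; apply: span_mkseq_free; first exact: mkseq_free_le fw.
  move=> i ik; apply: subvP (complete_flag_le cF ik) _ _.
  exact/wF/leq_trans/kd.
by case: (cF k) => _ ->; apply: geq_minl.
Qed.

Definition polysec e (w : 'rV[K]_e -> V) : Prop :=
  forall j, polyfun (fun z => coord (vbasis {:V}) j (w z)).

Lemma polysec_cst e p : polysec (fun _ : 'rV[K]_e => p).
Proof. by move=> j; apply: polyfun_cst. Qed.

Lemma polysecD e (w w' : 'rV[K]_e -> V) :
  polysec w -> polysec w' -> polysec (fun z => w z + w' z).
Proof.
move=> pw pw' j; apply: polyfun_ext (polyfunD (pw j) (pw' j)) => z.
by rewrite linearD.
Qed.

Lemma polysecZ e f (w : 'rV[K]_e -> V) :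
  polyfun f -> polysec w -> polysec (fun z => f z *: w z).
Proof.
move=> pf pw j; apply: polyfun_ext (polyfunM pf (pw j)) => z.
by rewrite linearZ.
Qed.

Lemma polysec_sum e I (r : seq I) (P : pred I) (w : I -> 'rV[K]_e -> V) :
  (forall i, polysec (w i)) -> polysec (fun z => \sum_(i <- r | P i) w i z).
Proof.
move=> pw j; apply: polyfun_ext (polyfun_sum r P (fun i => pw i j)) => z.
by rewrite linear_sum.
Qed.

Lemma polysec_linear e (W : vectType K) (g : {linear V -> W}) (w : 'rV[K]_e -> V) :
  polysec w -> forall j, polyfun (fun z => coord (vbasis {:W}) j (g (w z))).
Proof.
move=> pw j.
apply: (polyfun_ext (f := fun z =>
  \sum_i coord (vbasis {:V}) i (w z) * coord (vbasis {:W}) j (g (vbasis {:V})`_i))).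
  move=> z; rewrite [in RHS](coord_vbasis (memvf (w z))) !linear_sum.
  by apply: eq_bigr => i _; rewrite !linearZ.
by apply: polyfun_sum => i; apply: polyfunM => //; apply: polyfun_cst.
Qed.

Lemma polysec_frame i : polysec (fun z : 'rV[K]_(d * d) => (frame (vec_mx z))`_i).
Proof.
move=> j; case: (ltnP i d) => [id|di]; last first.
  apply: polyfun_ext (polyfun_cst _ 0) => z.
  by rewrite nth_default ?size_frame // linear0.
have pc := polyfun_coord K (mxvec_index (Ordinal id) j).
apply: polyfun_ext pc => z.
rewrite (nth_frame _ (Ordinal id)) linear_sum (bigD1 j) //= big1 => [|l lj].
  rewrite addr0 linearZ /= coord_vbasisE.
  by rewrite eqxx mulr1 mxE.
rewrite /= linearZ /= coord_vbasisE.
by rewrite (negPf lj) mulr0.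
Qed.

Lemma polymap_frame_mx e (w : nat -> 'rV[K]_e -> V) :
  (forall i, (i < d)%N -> polysec (w i)) ->
  polymap (fun z => mxvec (frame_mx (w^~ z))).
Proof.
move=> pw j; case/mxvec_indexP: j => i j.
by apply: polyfun_ext (pw i (ltn_ord i) j) => z; rewrite mxvecE mxE.
Qed.

(* Cramer's rule: [w] lies in the span of the first [i] vectors of the frame M iff
   the coordinates of index [>= i] of [w * adj M] vanish. *)
Lemma open_notin (w : 'rV[K]_(d * d) -> V) i z :
  polysec w -> vec_mx z \in unitmx -> (i <= d)%N -> w z \notin flag_of_frame z i ->
  exists p, [/\ polyfun p, p z != 0 &
    forall y, vec_mx y \in unitmx -> p y != 0 -> w y \notin flag_of_frame y i].
Proof.
move=> pw zu id wz.
pose r y : 'rV[K]_d := \row_j coord (vbasis {:V}) j (w y).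
pose kappa y := r y *m \adj (vec_mx y).
have rE y (a : 'rV_d) :
    w y = \sum_(l < d) a 0 l *: (frame (vec_mx y))`_l <-> r y = a *m vec_mx y.
  have aE : \sum_(l < d) a 0 l *: (frame (vec_mx y))`_l =
      \sum_j (a *m vec_mx y) 0 j *: (vbasis {:V})`_j.
    under eq_bigr => l _.
      rewrite nth_frame scaler_sumr; under eq_bigr => j _ do rewrite scalerA.
      over.
    by rewrite exchange_big; apply: eq_bigr => j _; rewrite mxE scaler_suml.
  rewrite aE; split=> [wE|rE].
    apply/rowP => j; rewrite mxE wE linear_sum (bigD1 j) //= big1 => [|l lj].
      by rewrite addr0 linearZ /= coord_vbasisE eqxx mulr1.
    rewrite /= linearZ /= coord_vbasisE.
    by rewrite (negPf lj) mulr0.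
  rewrite -rE [LHS](coord_vbasis (memvf _)).
  by apply: eq_bigr => j _; rewrite mxE.
have kE y (a : 'rV_d) : r y = a *m vec_mx y -> kappa y = \det (vec_mx y) *: a.
  by rewrite /kappa => ->; rewrite -mulmxA mul_mx_adj mul_mx_scalar.
have [l [il kl]] : exists l : 'I_d, (i <= l)%N /\ kappa z 0 l != 0.
  apply: contrapT => nl; move: wz; rewrite flag_of_frameE // => /negP; apply.
  have rz : r z = (r z *m invmx (vec_mx z)) *m vec_mx z by rewrite mulmxKV.
  have /rE := rz; set a := r z *m _ in rz * => wE; rewrite wE.
  apply: rpred_sum => l _; case: (ltnP l i) => il.
    by apply/rpredZ/(mem_mkseq_span (fun i => (frame (vec_mx z))`_i)).
  have /eqP : kappa z 0 l = 0.
    by apply: contrapT => /eqP kl; apply: nl; exists l.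
  rewrite (kE _ _ rz) mxE mulf_eq0.
  move: zu; rewrite unitmxE unitfE => /negPf -> /eqP ->.
  by rewrite scale0r rpred0.
exists (fun y => kappa y 0 l); split=> //.
  apply: (polyfun_ext (f := fun y => \sum_j coord (vbasis {:V}) j (w y)
             * (\adj (vec_mx y)) j l)).
    by move=> y; rewrite mxE; apply: eq_bigr => j _; rewrite [in RHS]mxE.
  apply: polyfun_sum => j; apply: polyfunM; first exact: pw.
  apply: polyfun_adj => a b.
  by apply: polyfun_ext (polyfun_coord K (mxvec_index a b)) => y; rewrite mxE.
move=> y yu; apply: contra; rewrite flag_of_frameE // => /mem_span_mkseqP[a aE].
have /rE/kE -> : w y = \sum_(l < d) (\row_(l < d) if (l < i)%N then a l else 0) 0 l
                        *: (frame (vec_mx y))`_l.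
  rewrite [LHS]aE (big_ord_widen d (fun l => a l *: (frame (vec_mx y))`_l)) //.
  rewrite big_mkcond /=; apply: eq_bigr => j _; rewrite mxE.
  by case: ifP => // _; rewrite scale0r.
by rewrite !mxE ltnNge il mulr0.
Qed.

End Frames.

(** * Orthogonality, dual families and Lagrangian flags *)

Section Symplectic.
Variables (K : fieldType) (V : vectType K) (form : {skew_symmetric V}).
Local Notation "''[' v , w ]" := (form v%R w%R).
Local Notation d := (\dim {:V}).
Implicit Types (w : nat -> V) (U W : {vspace V}).

Lemma skewC u v : '[u, v] = - '[v, u].
Proof. by rewrite hermC /= expr1 mulN1r. Qed.

Lemma skewDl u v p : '[u + v, p] = '[u, p] + '[v, p].
Proof. exact: linearDl. Qed.
Lemma skewZl a u p : '[a *: u, p] = a * '[u, p].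
Proof. exact: linearZl_LR. Qed.
Lemma skew_suml I (r : seq I) P (F : I -> V) p :
  '[\sum_(i <- r | P i) F i, p] = \sum_(i <- r | P i) '[F i, p].
Proof. exact: linear_sumlz. Qed.
Lemma skewDr u v p : '[p, u + v] = '[p, u] + '[p, v].
Proof. exact: linearD. Qed.
Lemma skewZr a u p : '[p, a *: u] = a * '[p, u].
Proof. exact: linearZ. Qed.
Lemma skew_sumr I (r : seq I) P (F : I -> V) p :
  '[p, \sum_(i <- r | P i) F i] = \sum_(i <- r | P i) '[p, F i].
Proof. exact: linear_sum. Qed.

Lemma skewNl u p : '[- u, p] = - '[u, p].
Proof. exact: linearNl. Qed.
Lemma skewNr u p : '[p, - u] = - '[p, u].
Proof. exact: linearN. Qed.
Lemma skew0l p : '[0, p] = 0.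
Proof. exact: linear0l. Qed.
Lemma skew0r p : '[p, 0] = 0.
Proof. exact: linear0. Qed.

(** Pairing a relation with [p i] kills the terms of index below [i], so the coefficients vanish one
    after the other from the last downwards. *)
Lemma free_triangular w (p : nat -> V) m :
  (forall l j, (j < l < m)%N -> '[w j, p l] = 0) ->
  (forall l, (l < m)%N -> '[w l, p l] != 0) -> free (mkseq w m).
Proof.
move=> lower diag; apply: free_mkseqP => a a0.
suff low k i : (i < m)%N -> (m - i <= k)%N -> a i = 0.
  by move=> i im; apply: low im (leqnn _).
elim: k i => [|k IH] i im; first by rewrite leqn0 subn_eq0 leqNgt im.
move=> mik; have := congr1 (form^~ (p i)) a0.
rewrite skew_suml linear0l (bigD1 (Ordinal im)) //= big1 => [|j ji].
  by rewrite addr0 skewZl => /eqP; rewrite mulf_eq0 (negPf (diag _ im)) orbF => /eqP.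
case: (ltngtP j i) => [lt_ji|lt_ij|].
- by rewrite skewZl lower ?mulr0 // lt_ji.
- rewrite (IH j) ?scale0r ?linear0l //.
  by rewrite -ltnS; apply: leq_trans mik; apply: ltn_sub2l.
- by move=> ij; move: ji; rewrite -val_eqE /= ij eqxx.
Qed.

Lemma orthovS U W : (U <= W)%VS -> (orthov form W <= orthov form U)%VS.
Proof.
move=> UW; apply/subvP => p /mem_orthovP pW; apply/mem_orthovP => u uU.
exact/pW/(subvP UW).
Qed.

Lemma mem_orthov_span w m p :
  (forall i, (i < m)%N -> '[p, w i] = 0) -> p \in orthov form <<mkseq w m>>.
Proof.
move=> h; apply/mem_orthovP => _ /mem_span_mkseqP[a ->].
by rewrite skew_sumr big1 // => i _; rewrite skewZr h ?mulr0.
Qed.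

Lemma sub_orthov_orthov U : (U <= orthov form (orthov form U))%VS.
Proof. by rewrite orthov_sym. Qed.

Hypothesis nd : nondegenerate form.

Lemma form_eq0 p : (forall q, '[p, q] = 0) -> p = 0.
Proof.
move=> p0; apply/eqP; rewrite -memv0 -(eqP nd).
by apply/mem_orthovP => q _.
Qed.

(** Each vector cuts a dimension by at most one. A basis of [U] thus bounds the dimension of the
    orthogonal from below; a basis of a complement of [U] bounds it from above, since by
    nondegeneracy the two orthogonals meet in 0. *)
Lemma dim_orthov U : (\dim (orthov form U) + \dim U)%N = d.
Proof.
have drop (s : seq V) W : (\dim W <= \dim (W :&: orthov form <<s>>) + size s)%N.
  elim: s W => [|a s IH] W; first by rewrite span_nil orthov0 capvf addn0.
  have -> : orthov form <<a :: s>> = (orthov form <[a]> :&: orthov form <<s>>)%VS.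
    rewrite span_cons; apply/eqP; rewrite eqEsubv; apply/andP; split.
      by rewrite subv_cap !orthovS ?addvSl ?addvSr.
    by rewrite orthovD capvSl capvSr.
  rewrite capvA /= addnS; have := @leq_dim_orthov1 _ _ _ _ form a W.
  move: (IH (W :&: orthov form <[a]>)%VS) => le1 le2.
  by case: (\dim W) le2 => // k le2; apply: leq_trans le2 le1.
have n1 : (\dim U + \dim U^C = d)%N by rewrite dimv_compl subnKC ?dimvS ?subvf.
apply/eqP; rewrite eqn_leq; apply/andP; split; last first.
  have := drop (vbasis U) fullv; rewrite (span_basis (vbasisP U)) size_tuple.
  by rewrite capfv.
have := drop (vbasis U^C) (orthov form U).
rewrite (span_basis (vbasisP _)) size_tuple.
suff -> : (orthov form U :&: orthov form U^C = 0)%VS by rewrite dimv0; lia.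
apply/eqP; rewrite -subv0; apply/subvP => p; rewrite memv_cap => /andP[p1 p2].
rewrite memv0; apply/eqP/form_eq0 => q.
have : q \in (U + U^C)%VS by rewrite addv_complf memvf.
move=> /memv_addP[u uU [u' u'U ->]].
by rewrite skewDr (mem_orthovP p1) // (mem_orthovP p2) ?addr0.
Qed.

Lemma orthovK U : orthov form (orthov form U) = U.
Proof.
apply/eqP; rewrite eq_sym eqEdim sub_orthov_orthov /=.
by have := dim_orthov U; have := dim_orthov (orthov form U); lia.
Qed.

Lemma form_separates U p : p \notin U -> exists2 t, t \in orthov form U & '[p, t] != 0.
Proof.
by rewrite -{1}(orthovK U) => /mem_orthovPn.
Qed.

(** Since [w m] lies outside the span of its predecessors, some [u] is orthogonal to them but not to
    [w m]. Rescaled, it is the new dual vector, and it also corrects the pairings of the earlier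
    ones with [w m]. *)
Lemma dual_family w m : free (mkseq w m) ->
  exists t : nat -> V, forall i j, (i < m)%N -> (j < m)%N -> '[w i, t j] = (i == j)%:R.
Proof.
elim: m => [|m IH] fw; first by exists w.
have [t tP] := IH (mkseq_free_le (leqnSn m) fw).
have wm := free_notin fw (leqnn m.+1).
have [u /mem_orthovP uw wu] := form_separates wm.
have {}uw i : (i < m)%N -> '[w i, u] = 0.
  by move=> im; rewrite skewC uw ?oppr0 // mem_mkseq_span.
pose u' := '[w m, u]^-1 *: u.
have wu' : '[w m, u'] = 1 by rewrite skewZr mulVf.
exists (fun j => if j == m then u' else t j - '[w m, t j] *: u') => i j.
rewrite ltnS leq_eqVlt => /orP[/eqP->|im]; rewrite ltnS leq_eqVlt => /orP[/eqP->|jm].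
- by rewrite eqxx.
- rewrite (ltn_eqF jm) linearB /= skewZr wu' mulr1 subrr.
  by rewrite eq_sym (ltn_eqF jm).
- have uw' := uw i im.
  by rewrite eqxx (ltn_eqF im) skewZr uw' mulr0.
- have uw' := uw i im; rewrite (ltn_eqF jm) linearB /= !skewZr uw' !mulr0 subr0.
  by apply: tP.
Qed.

Section Lagrangian.
Variable n : nat.
Hypothesis dimV : d = (2 * n)%N.

Definition lagrangian_flag (F : nat -> {vspace V}) : Prop :=
  complete_flag F /\
  forall i, (i <= 2 * n)%N -> orthov form (F i) = F (2 * n - i)%N.

Definition flag_of_half w i : {vspace V} :=
  if (i <= n)%N then <<mkseq w i>>%VS else orthov form <<mkseq w (2 * n - i)>>.

Lemma flag_of_half_lagrangian w :
  free (mkseq w n) -> (forall i j, (i < n)%N -> (j < n)%N -> '[w i, w j] = 0) ->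
  lagrangian_flag (flag_of_half w).
Proof.
move=> fw iso.
have fwi i : (i <= n)%N -> free (mkseq w i) by move=> /mkseq_free_le; apply.
have dimF i : (i <= n)%N -> \dim <<mkseq w i>> = i by move=> /fwi/dim_mkseq_free.
have mono i j : (i <= j)%N -> (<<mkseq w i>> <= <<mkseq w j>>)%VS.
  by move=> ij; apply: span_mkseq_sub => l li; apply/mem_mkseq_span/leq_trans/ij.
have isoV : (<<mkseq w n>> <= orthov form <<mkseq w n>>)%VS.
  by apply: span_mkseq_sub => i im; apply: mem_orthov_span => j; apply: iso.
have lag : orthov form <<mkseq w n>> = <<mkseq w n>>%VS.
  apply/esym/eqP; rewrite eqEdim isoV /=.
  by have := dim_orthov <<mkseq w n>>; rewrite dimV dimF //; lia.
split=> [k|i i2n]; rewrite /flag_of_half; last first.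
  case: (ltngtP i n) => [lt_in|lt_ni|->].
  - by rewrite ifN ?subKn //; lia.
  - by rewrite ifT ?orthovK //; lia.
  - by rewrite ifT ?lag; [congr <<mkseq _ _>>%VS; lia | lia].
split.
  case: (ltngtP k n) => [lt_kn|lt_nk|->].
  - by apply: mono.
  - by apply/orthovS/mono; lia.
  - by rewrite -{1}lag; apply/orthovS/mono; lia.
rewrite dimV; case: ifPn => kn; first by rewrite dimF // (minn_idPl _) //; lia.
have := dim_orthov <<mkseq w (2 * n - k)>>; rewrite dimV dimF; lia.
Qed.

Lemma lagrangian_flag_dim F i : lagrangian_flag F -> (i <= 2 * n)%N -> \dim (F i) = i.
Proof. by move=> [cF _] i2n; case: (cF i) => _ ->; rewrite dimV; apply/minn_idPl. Qed.

Lemma eq_lagrangian_flag F F' : lagrangian_flag F -> lagrangian_flag F' ->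
  (forall i, (i <= n)%N -> F i = F' i) -> F = F'.
Proof.
move=> [cF oF] [cF' oF'] FF'; apply/funext => i.
case: (leqP i n) => [|ni]; first exact: FF'.
case: (leqP i (2 * n)) => i2n.
  rewrite -(subKn i2n) -oF ?leq_subr // -oF' ?leq_subr //.
  by rewrite FF' //; lia.
by rewrite !complete_flag_full ?dimV // ltnW.
Qed.

Lemma lagrangian_flag_span F w : lagrangian_flag F ->
  free (mkseq w n) -> (forall l, (l < n)%N -> w l \in F l.+1) ->
  forall i, (i <= n)%N -> <<mkseq w i>>%VS = F i.
Proof.
move=> lF fw wF i i_n; apply: span_mkseq_free; first exact: mkseq_free_le fw.
  move=> l li; apply: subvP (complete_flag_le lF.1 li) _ _.
  exact/wF/leq_trans/i_n.
by rewrite (lagrangian_flag_dim lF) //; lia.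
Qed.

Lemma polyfun_form e (w : 'rV[K]_e -> V) p :
  polysec w -> polyfun (fun z => '[w z, p]).
Proof.
move=> pw; apply: (polyfun_ext (f := fun z =>
  \sum_j coord (vbasis {:V}) j (w z) * '[(vbasis {:V})`_j, p])) => [z|].
  rewrite [in RHS](coord_vbasis (memvf (w z))) skew_suml.
  by apply: eq_bigr => j _; rewrite skewZl.
by apply: polyfun_sum => j; apply: polyfunM => //; apply: polyfun_cst.
Qed.

(** Column [l] of the adjugate consists of cofactors that omit row [l], so it is multiplied by the
    product of the other row factors. Hence rescaling the sections rescales each of the dual vectors
    that complete them. *)
Lemma adj_row_scale m (A : 'M[K]_m) (mu : 'I_m -> K) (l : 'I_m) :
  (forall i, mu i != 0) ->
  exists2 c, c != 0 &
    forall j, \adj (\matrix_(i, j) (mu i * A i j)) j l = c * \adj A j l.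
Proof.
move=> mu0; exists (\prod_i mu (lift l i)); first by apply/prodf_neq0 => i _.
move=> j; rewrite !mxE /cofactor mulrCA; congr (_ * _).
have -> : row' l (col' j (\matrix_(i, j) (mu i * A i j))) =
    diag_mx (\row_i mu (lift l i)) *m row' l (col' j A).
  by rewrite mul_diag_mx; apply/matrixP => a b; rewrite !mxE.
rewrite det_mulmx det_diag; congr (_ * _).
by apply: eq_bigr => i _; rewrite mxE.
Qed.

Lemma scaled_span (w w' : nat -> V) m :
  (forall l, (l < m)%N -> exists2 c, c != 0 & w' l = c *: w l) ->
  <<mkseq w' m>>%VS = <<mkseq w m>>%VS.
Proof.
move=> sc; apply/eqP; rewrite eqEsubv; apply/andP; split; apply: span_mkseq_sub => l lm.
  by have [c _ ->] := sc l lm; apply/rpredZ/mem_mkseq_span.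
have [c c0 wE] := sc l lm.
have -> : w l = c^-1 *: w' l by rewrite wE scalerA mulVf ?scale1r.
exact/rpredZ/mem_mkseq_span.
Qed.

(* The vectors [w_0 .. w_{n-1}] of a Lagrangian flag are completed to a frame of the
   whole flag by dual vectors, which the adjugate of a matrix of pairings makes
   polynomial in the parameter. *)
Lemma lift_of_sections e (S : set 'rV[K]_e) (T : Type) (q : 'rV[K]_e -> T) (Y : set T)
    (Fl : T -> nat -> {vspace V}) (w : nat -> 'rV[K]_e -> V) z0 :
  S z0 -> Y (q z0) ->
  (forall l, (l < n)%N -> polysec (w l)) ->
  (forall l z y, (l < n)%N -> S z -> S y -> q z = q y ->
     exists2 c, c != 0 & w l y = c *: w l z) ->
  (forall z, S z -> Y (q z) -> lagrangian_flag (Fl (q z)) /\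
     forall l, (l < n)%N -> w l z \in Fl (q z) l.+1) ->
  free (mkseq (w^~ z0) n) ->
  local_lift S [set z | vec_mx z \in unitmx] q (@flag_of_frame K V) Y Fl z0.
Proof.
move=> Sz0 Yz0 pw hw Flw fw.
(* The vectors [c] are dual to the sections at [z0] and stay fixed. The adjugate of their pairings
   with the moving sections gives vectors [U] dual to the sections up to the factor [\det (A z)],
   without any division. *)
have [c cP] := dual_family fw.
pose A z : 'M[K]_n := \matrix_(i, j) '[w i z, c j].
pose U z (i : 'I_n) := \sum_(j < n) \adj (A z) j i *: c j.
(* For [l < n] the index [2 * n - l.+1] is at least [n] and [insub] fails. The dual vectors come in
   reverse order: [U z i], being orthogonal to [w j z] for [j < i], belongs to the orthogonal of
   [F_i], which is [F_{2n-i}]. *)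
pose W l z := if insub (2 * n - l.+1)%N is Some i then U z i else w l z.
have Wlt l z : (l < n)%N -> W l z = w l z.
  by move=> ln; rewrite /W insubN // -leqNgt; lia.
have Wge (i : 'I_n) z : W (2 * n - i.+1)%N z = U z i.
  have i_n := ltn_ord i.
  have -> : W (2 * n - i.+1)%N z =
      if insub (val i) is Some j then U z j else w (2 * n - i.+1)%N z.
    by rewrite /W (_ : (2 * n - (2 * n - i.+1).+1)%N = i) //; lia.
  by rewrite valK.
have idx l : (l < 2 * n)%N -> (l < n)%N \/ exists i : 'I_n, l = (2 * n - i.+1)%N.
  move=> l2n; case: (ltnP l n) => ln; [by left | right].
  have h : (2 * n - l.+1 < n)%N by lia.
  by exists (Ordinal h) => /=; lia.
have wU z i (j : 'I_n) : (i < n)%N -> '[w i z, U z j] = \det (A z) * (i == j)%:R.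
  move=> i_n; have /matrixP/(_ (Ordinal i_n) j) := mul_mx_adj (A z).
  rewrite !mxE mulr_natr => <-; rewrite skew_sumr; apply: eq_bigr => k _.
  by rewrite skewZr !mxE mulrC.
have A1 : A z0 = 1%:M.
  by apply/matrixP => i j; rewrite !mxE; apply: cP.
have U0 i : U z0 i = c i.
  rewrite /U A1 adj1 (bigD1 i) //= big1 => [|j ji].
    by rewrite mxE eqxx scale1r addr0.
  by rewrite mxE (negPf ji) scale0r.
have unitP z : (vec_mx (mxvec (frame_mx (W^~ z))) \in unitmx) = free (mkseq (W^~ z) d).
  by rewrite mxvecK frame_free frame_frame_mx.
exists (fun z => mxvec (frame_mx (W^~ z))); split.
- apply: polymap_frame_mx => l; rewrite dimV => /idx[ln|[i ->]] j.
    by apply: polyfun_ext (pw l ln j) => z; rewrite Wlt.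
  suff pU : polysec (fun z => U z i) by apply: polyfun_ext (pU j) => z; rewrite Wge.
  apply: polysec_sum => k; apply: polysecZ; last exact: polysec_cst.
  apply: polyfun_adj => a b.
  by apply: polyfun_ext (polyfun_form (c b) (pw a (ltn_ord a))) => z; rewrite mxE.
- rewrite /= unitP dimV.
  (* The roles are exchanged in the test vectors: the dual vectors test the lower half of the frame
     and the sections at [z0] test the upper half. *)
  pose p l := if insub (2 * n - l.+1)%N is Some i then w (val (i : 'I_n)) z0 else c l.
  have plt l : (l < n)%N -> p l = c l.
    by move=> ln; rewrite /p insubN // -leqNgt; lia.
  have pge (i : 'I_n) : p (2 * n - i.+1)%N = w i z0.
    have i_n := ltn_ord i.
    have -> : p (2 * n - i.+1)%N = if insub (val i) is Some j then w (val (j : 'I_n)) z0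
                                  else c (2 * n - i.+1)%N.
      by rewrite /p (_ : (2 * n - (2 * n - i.+1).+1)%N = i) //; lia.
    by rewrite valK.
  have [lagF wF] := Flw _ Sz0 Yz0.
  have iso i j : (i < n)%N -> (j < n)%N -> '[w i z0, w j z0] = 0.
    have wn l : (l < n)%N -> w l z0 \in Fl (q z0) n.
      by move=> ln; apply: subvP (complete_flag_le lagF.1 ln) _ (wF _ ln).
    move=> i_n j_n; apply: (mem_orthovP _ _ (wn j j_n)).
    have /(_ _)-> := lagF.2 n; last by lia.
    by rewrite (_ : 2 * n - n = n)%N ?wn //; lia.
  apply: (@free_triangular (W^~ z0) p) => [l j /andP[jl]|l] /idx[ln|[i lE]].
  + by rewrite Wlt ?plt ?cP ?(ltn_eqF jl) // (ltn_trans jl).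
  + have j2n : (j < 2 * n)%N by lia.
    subst l; rewrite pge; case: (idx j j2n) => [jn|[k jE]]; first by rewrite Wlt ?iso.
    subst j; rewrite Wge U0 skewC cP // ltn_eqF ?oppr0 //.
    by have := ltn_ord i; have := ltn_ord k; lia.
  + by rewrite Wlt ?plt ?cP ?eqxx ?oner_eq0.
  + by subst l; rewrite pge Wge U0 skewC cP // eqxx oppr_eq0 oner_eq0.
(* Two representatives of a point rescale the sections, hence the rows of [A], hence each vector of
   the frame separately; freeness and all the spans are unchanged. *)
- move=> z y Sz Sy qzy; rewrite /= !unitP => fz.
  have muP l : exists c, ((l < n)%N -> w l y = c *: w l z) /\ c != 0.
    case: (ltnP l n) => ln; last by exists 1; rewrite oner_eq0.
    by have [a a0 aE] := hw l z y ln Sz Sy qzy; exists a.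
  have [mu mu2] := choice muP.
  have AE : A y = \matrix_(i, j) (mu i * A z i j).
    by apply/matrixP => i j; rewrite !mxE (mu2 i).1 // skewZl.
  have sc l : (l < d)%N -> exists2 c, c != 0 & W l y = c *: W l z.
    rewrite dimV => /idx[ln|[i ->]].
      by exists (mu l); rewrite ?Wlt ?(mu2 l).1 ?(mu2 l).2.
    have [a a0 aE] := @adj_row_scale _ (A z) (fun i => mu i) i (fun i => (mu2 i).2).
    exists a => //; rewrite !Wge scaler_sumr; apply: eq_bigr => j _.
    by rewrite AE aE scalerA.
  have sp k : (k <= d)%N -> <<mkseq (W^~ y) k>>%VS = <<mkseq (W^~ z) k>>%VS.
    by move=> kd; apply: scaled_span => l lk; apply/sc/leq_trans/kd.
  split.
    by move: fz; rewrite /free sp // !size_mkseq.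
  apply/funext => k; rewrite /flag_of_frame !mxvecK !frame_frame_mx.
  case: (leqP k d) => kd; first by rewrite !take_mkseq // sp.
  by rewrite !take_oversize ?size_mkseq 1?ltnW // sp.
- move=> z Sz Yz; rewrite /= unitP => fz; have [lagF wF] := Flw _ Sz Yz.
  apply: flag_of_frame_mx => // [|l]; first exact: lagF.1.
  rewrite dimV => /idx[ln|[i ->]]; first by rewrite Wlt ?wF.
  have i_n := ltn_ord i; rewrite Wge.
  have -> : (2 * n - i.+1).+1 = (2 * n - i)%N by lia.
  rewrite -lagF.2; last by lia.
  have fzn : free (mkseq (w^~ z) n).
    have := mkseq_free_le (w := W^~ z) (m := n) (m' := d) _ fz.
    rewrite dimV leq_pmull // => /(_ isT); congr (free _).
    by apply/eq_in_map => k; rewrite mem_iota => /andP[_ kn]; apply: Wlt.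
  rewrite -(lagrangian_flag_span lagF fzn wF) 1?ltnW //.
  apply: mem_orthov_span => j ji; rewrite skewC wU ?(ltn_trans ji) //.
  by rewrite (ltn_eqF ji) mulr0 oppr0.
Qed.

(** The pairing induced by [form] on exterior powers, applied to the wedges of the first [r]
    vectors. For fixed [p] it is a linear combination of Pluecker coordinates of the span of [y]. *)
Definition gram r (y p : nat -> V) : K := \det (\matrix_(i < r, j < r) '[y i, p j]).

Lemma gram_span r (y w : nat -> V) :
  (forall i, (i < r)%N -> y i \in <<mkseq w r>>%VS) ->
  exists t, forall p, gram r y p = t * gram r w p.
Proof.
move=> yw.
have /choice[a aP] : forall i, exists a : nat -> K,
    (i < r)%N -> y i = \sum_(j < r) a j *: w j.
  move=> i; case: (ltnP i r) => ir; last by exists (fun=> 0).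
  by have /mem_span_mkseqP[a aE] := yw i ir; exists a.
exists (\det (\matrix_(i < r, j < r) a i j)) => p.
rewrite /gram -det_mulmx; congr (\det _); apply/matrixP => i j.
rewrite !mxE aP // skew_suml; apply: eq_bigr => l _.
by rewrite skewZl !mxE.
Qed.

End Lagrangian.
End Symplectic.

Section GramBlock.
Variables (K : fieldType) (V : vectType K) (form : {skew_symmetric V}).
Local Notation "''[' v , w ]" := (form v%R w%R).

(** Reduces minors of [F_{m+1}] and [F_{m+2}] to minors of size 1 and 2 modulo [E], when the first
    [m] test vectors are dual to the basis of [E]. *)
Lemma gram_block m r (w p : nat -> V) :
  (forall i j, (i < m)%N -> (j < m)%N -> '[w i, p j] = (i == j)%:R) ->
  (forall i j, (i < m)%N -> (j < r)%N -> '[w i, p (m + j)%N] = 0) ->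
  gram form (m + r) w p = gram form r (fun i => w (m + i)%N) (fun j => p (m + j)%N).
Proof.
move=> h1 h2; rewrite /gram -[X in \det X = _]submxK.
set M := \matrix_(_, _) _.
have -> : ulsubmx M = 1%:M by apply/matrixP => i j; rewrite !mxE /= h1.
have -> : ursubmx M = 0 by apply/matrixP => i j; rewrite !mxE /= h2.
rewrite det_lblock det1 mul1r; congr (\det _).
by apply/matrixP => i j; rewrite !mxE.
Qed.

Lemma gram1 (w p : nat -> V) : gram form 1 w p = '[w 0%N, p 0%N].
Proof. by rewrite /gram det_mx11 mxE. Qed.

Lemma gram2 (w p : nat -> V) :
  gram form 2 w p = '[w 0%N, p 0%N] * '[w 1%N, p 1%N] - '[w 0%N, p 1%N] * '[w 1%N, p 0%N].
Proof.
rewrite /gram (expand_det_row _ ord0) big_ord_recl big_ord1 /cofactor !det_mx11.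
by rewrite !mxE /= /bump /= expr0 expr1 mul1r mulN1r mulrN.
Qed.

Lemma polyfun_gram r (p : nat -> V) :
  polyfun (fun z : 'rV[K]_(\dim {:V} * \dim {:V}) =>
    gram form r (fun i => (frame (vec_mx z : 'M[K]_(\dim {:V})))`_i) p).
Proof.
apply: polyfun_det => i j.
by apply: polyfun_ext (polyfun_form form (p j) (polysec_frame (V := V) i)) => z; rewrite mxE.
Qed.

(** One factor relates all Gram determinants of two families with the same span. The factors of the
    two changes of basis multiply to 1 as soon as one determinant is nonzero, so neither
    vanishes. *)
Lemma gram_proportional r (y w : nat -> V) :
  (forall i, (i < r)%N -> y i \in <<mkseq w r>>%VS) ->
  (forall i, (i < r)%N -> w i \in <<mkseq y r>>%VS) ->
  exists t, (forall p, gram form r y p = t * gram form r w p) /\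
            forall p, gram form r w p != 0 -> t != 0.
Proof.
move=> /(gram_span form)[t tP] /(gram_span form)[t' t'P]; exists t; split=> // p.
by rewrite t'P tP; apply: contraNneq => ->; rewrite mul0r mulr0.
Qed.

End GramBlock.

(** * The flags of the component *)

Section Flags.
Variables (K : fieldType) (V : vectType K) (form : {skew_symmetric V}).
Local Notation "''[' v , w ]" := (form v%R w%R).
Variables (n m : nat) (v : V) (x : 'End(V)) (e f : nat -> V).

(* [e] and [f] form a symplectic Jordan basis (normalised to vanish outside of
   [1 .. n]) in which [v = e_{n-2}]; [m] is the length of the part of the flag that
   is constant along the component, so that [k = n - m - 1]. *)
Record jordan_basis : Prop := JordanBasis {
  jb_nd : nondegenerate form;
  jb_dim : \dim {:V} = (2 * n)%N;
  jb_mn : (m.+2 <= n)%N;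
  jb_adj : forall u w, '[x u, w] = '[u, x w];
  jb_ee : forall i j, '[e i, e j] = 0;
  jb_ff : forall i j, '[f i, f j] = 0;
  jb_ef : forall i j, '[e i, f j] = ((i == j) && (1 <= i <= n)%N)%:R;
  jb_xe : forall i, (i <= n)%N -> x (e i) = e i.-1;
  jb_xf : forall i, (0 < i)%N -> x (f i) = f i.+1;
  jb_v : v = e (n - 2);
  jb_ext : forall p, (forall i, '[p, f i] = 0) -> (forall i, '[e i, p] = 0) -> p = 0 }.

Hypothesis J : jordan_basis.
Let nd := jb_nd J.
Let dimV := jb_dim J.
Let mn := jb_mn J.
Let x_adj := jb_adj J.
Let form_ee := jb_ee J.
Let form_ff := jb_ff J.
Let form_ef := jb_ef J.
Let x_e := jb_xe J.
Let x_f := jb_xf J.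
Let vE := jb_v J.
Let ef_ext := jb_ext J.

Lemma form_fe i j : '[f j, e i] = - ((i == j) && (1 <= i <= n)%N)%:R.
Proof. by rewrite skewC form_ef. Qed.

Lemma e0 : e 0 = 0.
Proof.
apply: ef_ext => i; last exact: form_ee.
by rewrite form_ef andbF.
Qed.

Lemma fS : f n.+1 = 0.
Proof.
apply: ef_ext => i; first exact: form_ff.
by rewrite form_ef; case: eqP => // ->; rewrite ltnn andbF.
Qed.

(* Modulo [e_m], [x] shifts the last two coordinates into the first two. *)
Definition quad (p q r t : K) : V :=
  locked (p *: e m.+1 + q *: f n + r *: e m.+2 + t *: f n.-1).

Definition dual_quad (p q r t : K) : V :=
  locked (p *: f m.+1 - q *: e n + r *: f m.+2 - t *: e n.-1).

Lemma quadE p q r t :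
  quad p q r t = p *: e m.+1 + q *: f n + r *: e m.+2 + t *: f n.-1.
Proof. by rewrite /quad -lock. Qed.

Lemma dual_quadE p q r t :
  dual_quad p q r t = p *: f m.+1 - q *: e n + r *: f m.+2 - t *: e n.-1.
Proof. by rewrite /dual_quad -lock. Qed.

Lemma quadD p q r t p' q' r' t' :
  quad p q r t + quad p' q' r' t' = quad (p + p') (q + q') (r + r') (t + t').
Proof.
rewrite !quadE !scalerDl addrACA; congr (_ + _).
by rewrite addrACA; congr (_ + _); rewrite addrACA.
Qed.

Lemma quadZ c p q r t : c *: quad p q r t = quad (c * p) (c * q) (c * r) (c * t).
Proof. by rewrite !quadE !scalerDr !scalerA. Qed.

Lemma quadN p q r t : - quad p q r t = quad (- p) (- q) (- r) (- t).
Proof. by rewrite -scaleN1r quadZ !mulN1r. Qed.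

Lemma quad0 : quad 0 0 0 0 = 0.
Proof. by rewrite -[RHS](scale0r (quad 0 0 0 0)) quadZ !mul0r. Qed.

Definition skewE := (@skewDl, @skewDr, @skewZl, @skewZr, @skewNl, @skewNr).

Ltac decide_eqs := repeat match goal with
  | |- context [(?i == ?j) && ?b] =>
     first [have -> : (i == j) && b = false by lia | have -> : (i == j) && b = true by lia]
  end.

Ltac pairing := rewrite ?quadE ?dual_quadE !skewE ?form_ee ?form_ff ?form_ef ?form_fe.

Lemma form_quad_dual p q r t p' q' r' t' :
  '[quad p q r t, dual_quad p' q' r' t'] = p * p' + q * q' + r * r' + t * t'.
Proof. by pairing; decide_eqs; rewrite /=; ring. Qed.

Lemma form_e_dual i p q r t : (i <= m)%N -> '[e i, dual_quad p q r t] = 0.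
Proof. by move=> im; pairing; decide_eqs; rewrite /=; ring. Qed.

Lemma form_e_quad i p q r t : (i.+2 <= n)%N -> '[e i, quad p q r t] = 0.
Proof. by move=> im; pairing; decide_eqs; rewrite /=; ring. Qed.

Lemma form_quad_e i p q r t : (i.+2 <= n)%N -> '[quad p q r t, e i] = 0.
Proof. by move=> im; rewrite skewC form_e_quad ?oppr0. Qed.

Lemma form_quad_f i p q r t : (i != m.+1)%N -> (i != m.+2)%N ->
  '[quad p q r t, f i] = 0.
Proof. by move=> i1 i2; pairing; decide_eqs; rewrite /=; ring. Qed.

(** The index pairs [m+1, m+2] and [n-1, n] meet only when [n] is [m+2] or [m+3]. Only in these two
    cases does isotropy of the sections depend on their particular coordinates. *)
Lemma form_quad_quad p q r t p' q' r' t' :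
  '[quad p q r t, quad p' q' r' t'] =
    (m.+2 == n)%:R * (p * t' - q * r' + r * q' - t * p')
    + (m.+3 == n)%:R * (r * t' - t * r').
Proof.
pairing.
have [m2 | [m3 | m4]] : m.+2 = n \/ m.+3 = n \/ (m.+3 < n)%N by lia.
- have -> : (m.+3 == n) = false by lia.
  by decide_eqs; rewrite m2 eqxx /=; ring.
- decide_eqs; have -> : (m.+2 == n) = false by lia.
  by rewrite m3 eqxx /=; ring.
- decide_eqs; have -> : (m.+2 == n) = false by lia.
  by have -> : (m.+3 == n) = false by [lia]; rewrite /=; ring.
Qed.

Lemma x_quad p q r t : x (quad p q r t) = p *: e m + quad r t 0 0.
Proof.
have n1 : n.-1.+1 = n by lia.
rewrite !quadE !linearD !linearZ /= !x_e ?x_f //=; try lia.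
by rewrite n1 fS !(scaler0, scale0r, addr0) addrA.
Qed.

Lemma dual_quad_e1 : dual_quad 1 0 0 0 = f m.+1.
Proof. by rewrite dual_quadE scale1r !scale0r !subr0 addr0. Qed.

Lemma quad_e1 : quad 1 0 0 0 = e m.+1.
Proof. by rewrite !quadE scale1r !scale0r !addr0. Qed.
Lemma quad_f1 : quad 0 1 0 0 = f n.
Proof. by rewrite !quadE scale1r !scale0r !addr0 add0r. Qed.
Lemma quad_e2 : quad 0 0 1 0 = e m.+2.
Proof. by rewrite !quadE scale1r !scale0r !addr0 add0r. Qed.
Lemma quad_f2 : quad 0 0 0 1 = f n.-1.
Proof. by rewrite !quadE scale1r !scale0r !add0r. Qed.

(** Pairings with the [f i] and the [e i] are, up to sign, coordinates in the Jordan basis; the two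
    hypotheses leave the four coordinates of [quad] and those along [E]. *)
Lemma quad_coord p :
  (forall i, (m.+3 <= i <= n)%N -> '[p, f i] = 0) ->
  (forall i, (1 <= i <= n - 2)%N -> '[e i, p] = 0) ->
  p - quad '[p, f m.+1] '[e n, p] '[p, f m.+2] '[e n.-1, p]
    \in <<mkseq (fun i => e i.+1) m>>%VS.
Proof.
move=> pf pe; apply/mem_span_mkseqP; exists (fun i => '[p, f i.+1]).
apply/eqP; rewrite -subr_eq0; apply/eqP/ef_ext => i.
  rewrite !(skewDl, skewNl) skew_suml.
  case: (leqP i m) => im.
    rewrite [X in _ - X - _](_ : _ = 0); last first.
      by apply: form_quad_f; lia.
    case: i im => [|i] im.
      have f00 : f 0 = 0.
        by apply: ef_ext => j; rewrite ?form_ff // form_ef; case: eqP => //= ->.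
      by rewrite f00 skew0r big1 ?subrr // => j _; rewrite skew0r.
    rewrite (bigD1 (Ordinal im)) //= big1 => [|j ji].
      by rewrite skewZl form_ef; decide_eqs; rewrite /=; ring.
    rewrite skewZl form_ef; move: ji; rewrite -val_eqE /= => ji.
    by decide_eqs; rewrite mulr0.
  rewrite big1 => [|j _]; last first.
    by rewrite skewZl form_ef; have := ltn_ord j => jm; decide_eqs; rewrite mulr0.
  have : i = m.+1 \/ i = m.+2 \/ (m.+3 <= i <= n)%N \/ (n < i)%N by lia.
  case=> [->|[->|[i3|ni]]].
  - by pairing; decide_eqs; rewrite /=; ring.
  - by pairing; decide_eqs; rewrite /=; ring.
  - by rewrite pf // form_quad_f; [ring | lia | lia].
  - have fi : f i = 0.
      by apply: ef_ext => j; rewrite ?form_ff // form_ef; decide_eqs.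
    by rewrite fi !skew0r; ring.
rewrite !(skewDr, skewNr) skew_sumr big1 ?subr0 => [|j _]; last first.
  by rewrite skewZr form_ee mulr0.
have ei : ~~ (1 <= i <= n)%N -> e i = 0.
  by move=> ni; apply: ef_ext => j; rewrite ?form_ee // form_ef (negPf ni) andbF.
have : i = n \/ i = n.-1 \/ (1 <= i <= n - 2)%N \/ ~~ (1 <= i <= n)%N by lia.
case=> [->|[->|[i3|ni]]].
- by pairing; decide_eqs; rewrite /=; ring.
- by pairing; decide_eqs; rewrite /=; ring.
- by rewrite pe // form_e_quad; [ring | lia].
- by rewrite ei // !skew0l; ring.
Qed.

(* [line_vec] spans [F_{m+1}] modulo [E = <e_1 .. e_m>], and [F_{m+2}/E] has the Pluecker
   bivector [c e_{m+1}^f_n + d0 e_{m+1}^e_{m+2} + d1 (e_{m+1}^f_{n-1} + f_n^e_{m+2})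
   + d2 f_n^f_{n-1}], of which [plane_vec1] and [plane_vec2] are contractions. *)
Definition line_vec a b := quad a b 0 0.
Definition plane_vec1 c d0 d1 := quad 0 c d0 d1.
Definition plane_vec2 c d1 d2 := quad (- c) 0 d1 d2.

(* Sections adapted to the flag near a point at which [a * be - b * al] is nonzero;
   [D0] tells whether [D] vanishes at this point. *)
Definition flag_section (al be : K) (D0 : bool) (a b c d0 d1 d2 : K) (l : nat) : V :=
  if (l < m)%N then e l.+1
  else if l == m then line_vec a b
  else if l == m.+1 then be *: plane_vec1 c d0 d1 - al *: plane_vec2 c d1 d2
  else if l == m.+2 then (if D0 then quad 0 0 a b else quad al be 0 0)
  else if l == m.+3 then quad 0 0 al be
  else e l.-1.

Section Cone.
Variables a b c D al be : K.
Let de := a * be - b * al.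

Definition cone_section :=
  flag_section al be (D == 0) a b c (D * a * a) (D * a * b) (D * b * b).
Local Notation w := cone_section.

Lemma cone_section_lt l : (l < m)%N -> w l = e l.+1.
Proof. by move=> lm; rewrite /w /flag_section lm. Qed.

Lemma cone_section0 : w m = quad a b 0 0.
Proof. by rewrite /w /flag_section ltnn eqxx. Qed.

(** This is the contraction of the bivector with the covector [(be, - al)] on the first two
    coordinates, which takes the value [de] on [line_vec] and kills [quad al be 0 0]. It is
    polynomial in the Pluecker coordinates, unlike an expression using [D] itself. *)
Lemma cone_section1 : w m.+1 = quad (c * al) (c * be) (D * de * a) (D * de * b).
Proof.
rewrite /w /flag_section ifN; last by lia.
rewrite ifN; last by lia.
rewrite eqxx /plane_vec1 /plane_vec2 !quadZ quadN quadD /de.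
by congr quad; ring.
Qed.

Lemma cone_section2 : w m.+2 = if D == 0 then quad 0 0 a b else quad al be 0 0.
Proof.
rewrite /w /flag_section ifN; last by lia.
rewrite ifN; last by lia.
by rewrite ifN ?eqxx //; lia.
Qed.

Lemma cone_section3 : w m.+3 = quad 0 0 al be.
Proof.
rewrite /w /flag_section ifN; last by lia.
rewrite ifN; last by lia.
rewrite ifN; last by lia.
by rewrite ifN ?eqxx //; lia.
Qed.

Lemma cone_section_ge l : (m.+4 <= l)%N -> w l = e l.-1.
Proof.
move=> ml; rewrite /w /flag_section ifN; last by lia.
rewrite ifN; last by lia.
rewrite ifN; last by lia.
rewrite ifN; last by lia.
by rewrite ifN //; lia.
Qed.

Lemma sec_index l :
  (l < m)%N \/ l = m \/ l = m.+1 \/ l = m.+2 \/ l = m.+3 \/ (m.+4 <= l)%N.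
Proof. by lia. Qed.

Hypothesis de0 : de != 0.
Hypothesis cD : (c != 0) || (D != 0).

(* [p l] is orthogonal to [w_0 .. w_{l-1}] but not to [w_l]. *)
Let p l : V :=
  if (l < m)%N then f l.+1
  else if l == m then dual_quad be (- al) 0 0
  else if l == m.+1 then (if D == 0 then dual_quad (- b) a 0 0 else dual_quad 0 0 be (- al))
  else if l == m.+2 then
    (if D == 0 then dual_quad 0 0 be (- al)
     else dual_quad (- b * (D * de)) (a * (D * de)) (- c * be) (c * al))
  else if l == m.+3 then dual_quad 0 0 (- b) a
  else f l.-1.

Lemma cone_section_free : free (mkseq w n).
Proof.
(* For [D = 0] the section of index [m+1] is a nonzero multiple of [quad al be 0 0], leaving
   [quad 0 0 a b] for the next index; for [D <> 0] its last two coordinates already give [(a, b)],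
   and [quad al be 0 0] comes next. *)
have c0 : D = 0 -> c != 0 by move=> D0; move: cD; rewrite D0 eqxx orbF.
have m1 : ((m.+1 < m) = false)%N by lia.
have m2 : ((m.+2 < m) = false)%N by lia.
have m3 : ((m.+3 < m) = false)%N by lia.
have n1 : (m.+1 == m) = false by lia.
have n2 : (m.+2 == m) = false by lia.
have n3 : (m.+3 == m) = false by lia.
have n4 : (m.+2 == m.+1) = false by lia.
have n5 : (m.+3 == m.+1) = false by lia.
have n6 : (m.+3 == m.+2) = false by lia.
have plt l : (l < m)%N -> p l = f l.+1 by move=> lm; rewrite /p lm.
have pge l : (m.+4 <= l)%N -> p l = f l.-1.
  by move=> ml; rewrite /p; do 5 (rewrite ifN; last by lia).
have p0 : p m = dual_quad be (- al) 0 0 by rewrite /p ltnn eqxx.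
have p1 : p m.+1 = if D == 0 then dual_quad (- b) a 0 0 else dual_quad 0 0 be (- al).
  by rewrite /p m1 n1 eqxx.
have p2 : p m.+2 = if D == 0 then dual_quad 0 0 be (- al)
     else dual_quad (- b * (D * de)) (a * (D * de)) (- c * be) (c * al).
  by rewrite /p m2 n2 n4 eqxx.
have p3 : p m.+3 = dual_quad 0 0 (- b) a by rewrite /p m3 n3 n5 n6 eqxx.
have quad_f_ge l A B C E : (m.+4 <= l)%N -> '[quad A B C E, f l.-1] = 0.
  by move=> ml; apply: form_quad_f; lia.
apply: (free_triangular (form := form) (p := p)) => [l j /andP[jl ln]|l ln].
  case: (sec_index l) => [lm|[lE|[lE|[lE|[lE|ml]]]]]; try subst l.
  - rewrite plt // cone_section_lt ?(ltn_trans jl) // form_ef; decide_eqs; by [].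
  - by rewrite p0 cone_section_lt // form_e_dual.
  - rewrite p1; case: (sec_index j) => [jm|[jE|[jE|[jE|jE]]]]; try lia.
      by rewrite cone_section_lt //; case: ifP => _; rewrite form_e_dual.
    by subst j; rewrite cone_section0; case: ifP => _; rewrite form_quad_dual; ring.
  - rewrite p2; case: (sec_index j) => [jm|[jE|[jE|[jE|jE]]]]; try lia; try subst j.
    + by rewrite cone_section_lt //; case: ifP => _; rewrite form_e_dual.
    + by rewrite cone_section0; case: ifP => _; rewrite form_quad_dual; ring.
    + rewrite cone_section1; case: eqP => [->|_]; rewrite form_quad_dual; first by ring.
      by rewrite /de; ring.
  - rewrite p3; case: (sec_index j) => [jm|[jE|[jE|[jE|jE]]]]; try lia; try subst j.
    + by rewrite cone_section_lt // form_e_dual.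
    + by rewrite cone_section0 form_quad_dual; ring.
    + by rewrite cone_section1 form_quad_dual; ring.
    + by rewrite cone_section2; case: ifP => _; rewrite form_quad_dual; ring.
  - rewrite pge //; case: (sec_index j) => [jm|[jE|[jE|[jE|[jE|mj]]]]]; try subst j.
    + by rewrite cone_section_lt // form_ef; decide_eqs.
    + by rewrite cone_section0 quad_f_ge.
    + by rewrite cone_section1 quad_f_ge.
    + by rewrite cone_section2; case: ifP => _; rewrite quad_f_ge.
    + by rewrite cone_section3 quad_f_ge.
    + by rewrite cone_section_ge // form_ef; decide_eqs.
case: (sec_index l) => [lm|[lE|[lE|[lE|[lE|ml]]]]]; try subst l.
- by rewrite plt // cone_section_lt // form_ef; decide_eqs; rewrite oner_eq0.
- by rewrite p0 cone_section0 form_quad_dual (_ : _ + _ = de) // /de; ring.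
- rewrite p1 cone_section1; case: (eqVneq D 0) => D0; rewrite form_quad_dual.
    by rewrite (_ : _ + _ = c * de) ?mulf_neq0 ?c0 // D0 /de; ring.
  by rewrite (_ : _ + _ = D * de * de) ?mulf_neq0 // /de; ring.
- rewrite p2 cone_section2; case: (eqVneq D 0) => D0; rewrite form_quad_dual.
    by rewrite (_ : _ + _ = de) // /de; ring.
  by rewrite (_ : _ + _ = D * de * de) ?mulf_neq0 // /de; ring.
- by rewrite p3 cone_section3 form_quad_dual (_ : _ + _ = de) // /de; ring.
- by rewrite pge // cone_section_ge // form_ef; decide_eqs; rewrite oner_eq0.
Qed.

Lemma cone_section_isotropic i j : (i < n)%N -> (j < n)%N -> '[w i, w j] = 0.
Proof.
wlog ij : i j / (i <= j)%N.
  move=> h i_n j_n; case: (leqP i j) => ij; first exact: h.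
  by rewrite skewC h ?oppr0 // ltnW.
move=> _ jn.
have eq_wj k : (k.+2 <= n)%N -> '[e k, w j] = 0.
  move=> kn; case: (sec_index j) => [jm|[jE|[jE|[jE|[jE|mj]]]]]; try subst j.
  - by rewrite cone_section_lt.
  - by rewrite cone_section0 form_e_quad.
  - by rewrite cone_section1 form_e_quad.
  - by rewrite cone_section2; case: ifP => _; rewrite form_e_quad.
  - by rewrite cone_section3 form_e_quad.
  - by rewrite cone_section_ge.
have quad_e A B C E : (m.+4 <= j)%N -> '[quad A B C E, w j] = 0.
  by move=> mj; rewrite cone_section_ge // form_quad_e //; lia.
case: (sec_index i) => [im|[iE|[iE|[iE|[iE|mi]]]]]; try subst i.
- by rewrite cone_section_lt // eq_wj //; lia.
- rewrite cone_section0; case: (sec_index j) => [jm|[jE|[jE|[jE|[jE|mj]]]]]; try lia; try subst j.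
  + by rewrite cone_section0 form_quad_quad; ring.
  + by rewrite cone_section1 form_quad_quad; ring.
  + have m2 : (m.+2 == n) = false by lia.
    by rewrite cone_section2; case: ifP => _; rewrite form_quad_quad m2 /=; ring.
  + have m2 : (m.+2 == n) = false by lia.
    by rewrite cone_section3 form_quad_quad m2 /=; ring.
  + exact: quad_e.
- rewrite cone_section1; case: (sec_index j) => [jm|[jE|[jE|[jE|[jE|mj]]]]]; try lia; try subst j.
  + by rewrite cone_section1 form_quad_quad; ring.
  + have m2 : (m.+2 == n) = false by lia.
    by rewrite cone_section2; case: ifP => _; rewrite form_quad_quad m2 /=; ring.
  + have m2 : (m.+2 == n) = false by lia.
    have m3 : (m.+3 == n) = false by lia.
    by rewrite cone_section3 form_quad_quad m2 m3 /=; ring.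
  + exact: quad_e.
- have m2 : (m.+2 == n) = false by lia.
  rewrite cone_section2; case: (sec_index j) => [jm|[jE|[jE|[jE|[jE|mj]]]]]; try lia; try subst j.
  + by rewrite cone_section2; case: ifP => _; rewrite form_quad_quad m2 /=; ring.
  + have m3 : (m.+3 == n) = false by lia.
    by rewrite cone_section3; case: ifP => _; rewrite form_quad_quad m2 m3 /=; ring.
  + by case: ifP => _; rewrite quad_e.
- rewrite cone_section3; case: (sec_index j) => [jm|[jE|[jE|[jE|[jE|mj]]]]]; try lia; try subst j.
  + by rewrite cone_section3 form_quad_quad; ring.
  + exact: quad_e.
- by rewrite cone_section_ge // eq_wj //; lia.
Qed.

Local Notation H l := <<mkseq w l>>%VS.

Lemma cone_span_e i l : (i <= m)%N -> (i <= l)%N -> e i \in H l.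
Proof.
case: i => [|i] im il; first by rewrite e0 mem0v.
by rewrite -cone_section_lt //; apply: mem_mkseq_span.
Qed.

Lemma cone_span_line_vec l : (m < l)%N -> quad a b 0 0 \in H l.
Proof. by move=> ml; rewrite -cone_section0; apply: mem_mkseq_span. Qed.

Lemma cone_span_s l : (m.+1 < l)%N ->
  quad (c * al) (c * be) (D * de * a) (D * de * b) \in H l.
Proof. by move=> ml; rewrite -cone_section1; apply: mem_mkseq_span. Qed.

Lemma cone_span_plane_vec1 l : (m.+1 < l)%N -> plane_vec1 c (D * a * a) (D * a * b) \in H l.
Proof.
move=> ml; have -> : plane_vec1 c (D * a * a) (D * a * b) =
  de^-1 *: (a *: quad (c * al) (c * be) (D * de * a) (D * de * b)
     + (- (al * c)) *: quad a b 0 0).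
  by rewrite !quadZ quadD quadZ; congr quad; move: de0; rewrite /de => ?; field.
by apply/rpredZ/rpredD; apply: rpredZ; rewrite ?cone_span_s ?cone_span_line_vec // ltnW.
Qed.

Lemma cone_span_plane_vec2 l : (m.+1 < l)%N -> plane_vec2 c (D * a * b) (D * b * b) \in H l.
Proof.
move=> ml; have -> : plane_vec2 c (D * a * b) (D * b * b) =
  de^-1 *: (b *: quad (c * al) (c * be) (D * de * a) (D * de * b)
     + (- (be * c)) *: quad a b 0 0).
  by rewrite !quadZ quadD quadZ; congr quad; move: de0; rewrite /de => ?; field.
by apply/rpredZ/rpredD; apply: rpredZ; rewrite ?cone_span_s ?cone_span_line_vec // ltnW.
Qed.

Lemma cone_span_eps l : (m.+2 < l)%N ->
  quad al be 0 0 \in H l /\ quad 0 0 a b \in H l.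
Proof.
move=> ml; have := @mem_mkseq_span _ _ w _ _ ml; rewrite cone_section2.
have sH : quad (c * al) (c * be) (D * de * a) (D * de * b) \in H l.
  by apply: cone_span_s; lia.
case: (eqVneq D 0) => [D0|D0] h; split=> //.
  have c0 : c != 0 by move: cD; rewrite D0 eqxx orbF.
  have -> : quad al be 0 0 =
      c^-1 *: quad (c * al) (c * be) (D * de * a) (D * de * b).
    by rewrite quadZ D0; congr quad; field.
  exact: rpredZ.
have -> : quad 0 0 a b = (D * de)^-1 *:
    (quad (c * al) (c * be) (D * de * a) (D * de * b) + (- c) *: quad al be 0 0).
  rewrite !quadZ quadD quadZ; congr quad; move: de0; rewrite /de => de0'; field;
    by apply/andP.
by apply/rpredZ/rpredD => //; apply: rpredZ.
Qed.

Lemma cone_span_e1 l : (m.+2 < l)%N -> e m.+1 \in H l /\ f n \in H l.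
Proof.
move=> ml; have [h _] := cone_span_eps ml.
have h1 : quad a b 0 0 \in H l by apply: cone_span_line_vec; lia.
rewrite -quad_e1 -quad_f1.
have -> : quad 1 0 0 0 = de^-1 *: (be *: quad a b 0 0 + (- b) *: quad al be 0 0).
  by rewrite !quadZ quadD quadZ; congr quad; move: de0; rewrite /de => ?; field.
have -> : quad 0 1 0 0 = de^-1 *: ((- al) *: quad a b 0 0 + a *: quad al be 0 0).
  by rewrite !quadZ quadD quadZ; congr quad; move: de0; rewrite /de => ?; field.
by split; apply/rpredZ/rpredD; apply: rpredZ.
Qed.

Lemma cone_span_e2 l : (m.+3 < l)%N -> e m.+2 \in H l /\ f n.-1 \in H l.
Proof.
move=> ml; have [|_ h1] := @cone_span_eps l; first by lia.
have h : quad 0 0 al be \in H l by rewrite -cone_section3; apply: mem_mkseq_span.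
rewrite -quad_e2 -quad_f2.
have -> : quad 0 0 1 0 = de^-1 *: (be *: quad 0 0 a b + (- b) *: quad 0 0 al be).
  by rewrite !quadZ quadD quadZ; congr quad; move: de0; rewrite /de => ?; field.
have -> : quad 0 0 0 1 = de^-1 *: ((- al) *: quad 0 0 a b + a *: quad 0 0 al be).
  by rewrite !quadZ quadD quadZ; congr quad; move: de0; rewrite /de => ?; field.
by split; apply/rpredZ/rpredD; apply: rpredZ.
Qed.

Lemma cone_span_e_ge i l : (m.+3 <= l)%N -> (i.+2 <= l)%N -> e i \in H l.
Proof.
move=> ml il; have : (i <= m)%N \/ i = m.+1 \/ i = m.+2 \/ (m.+3 <= i)%N by lia.
case=> [im|[->|[iE|mi]]].
- by apply: cone_span_e; lia.
- by case: (cone_span_e1 ml).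
- by rewrite iE in il *; case: (cone_span_e2 il).
- by have := @mem_mkseq_span _ _ w _ i.+1 il; rewrite cone_section_ge.
Qed.

(** Since [x] moves the last two coordinates of a [quad] to the first two modulo [e m], it sends the
    sections of index [m] to [m+3] to combinations of strictly earlier ones. *)
Lemma cone_span_x l : (l < n)%N -> x (w l) \in H l.
Proof.
move=> ln; case: (sec_index l) => [lm|[lE|[lE|[lE|[lE|ml]]]]]; try subst l.
- by rewrite cone_section_lt // x_e ?cone_span_e //; lia.
- by rewrite cone_section0 x_quad quad0 addr0 rpredZ ?cone_span_e.
- rewrite cone_section1 x_quad rpredD ?rpredZ ?cone_span_e //.
  have -> : quad (D * de * a) (D * de * b) 0 0 = (D * de) *: quad a b 0 0.
    by rewrite quadZ !mulr0.
  by rewrite rpredZ ?cone_span_line_vec.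
- rewrite cone_section2; case: ifP => _; rewrite x_quad ?quad0 ?scale0r ?add0r ?addr0.
    by rewrite cone_span_line_vec //; lia.
  by rewrite rpredZ ?cone_span_e //; lia.
- rewrite cone_section3 x_quad scale0r add0r.
  by case: (@cone_span_eps m.+3).
- rewrite cone_section_ge // x_e; last by lia.
  by apply: cone_span_e_ge; lia.
Qed.

Lemma cone_span_v : v \in H n.
Proof.
rewrite vE; case: (ltnP m.+2 n) => mn'; last by apply: cone_span_e; lia.
by apply: cone_span_e_ge; lia.
Qed.

End Cone.

(* The closed conditions that cut the closure of [C_n^{k,k+1}] out of the Springer
   fibre. *)
Definition flag_cond (F : nat -> {vspace V}) : Prop :=
  [/\ forall i, (i <= m)%N -> e i \in F i,
      (m.+3 <= n)%N -> forall p, p \in F m.+3 -> x p \in F m.+1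
    & forall i, (m.+4 <= i <= n)%N -> e i.-2 \in F i /\ f n.-1 \in F i].

(* [F] lies over the point [(a : b)], [(c : d0 : d1 : d2)] of P^1 x P^3; on Sigma_{-2},
   [(d0, d1, d2) = D (a^2, ab, b^2)]. *)
Definition cone_rel (a b c d0 d1 d2 : K) (F : nat -> {vspace V}) : Prop :=
  [/\ exotic_flag form n v x F, flag_cond F, line_vec a b \in F m.+1,
      plane_vec1 c d0 d1 \in F m.+2 & plane_vec2 c d1 d2 \in F m.+2].

Lemma exotic_lagrangian F : exotic_flag form n v x F -> lagrangian_flag form n F.
Proof. by case=> cF oF _ _; split. Qed.

Lemma exotic_x F i p : exotic_flag form n v x F -> p \in F i.+1 -> x p \in F i.
Proof. by case=> _ _ _ xF pF; apply: subvP (xF i.+1 isT) _ (memv_img _ pF). Qed.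

Lemma exotic_dim F i : exotic_flag form n v x F -> (i <= 2 * n)%N -> \dim (F i) = i.
Proof. by move=> /exotic_lagrangian; apply: lagrangian_flag_dim. Qed.

Lemma exotic_le F i j p : exotic_flag form n v x F -> (i <= j)%N -> p \in F i -> p \in F j.
Proof. by case=> cF _ _ _ ij; apply/subvP/complete_flag_le. Qed.

Lemma frame_complement (a b : K) : (a != 0) || (b != 0) ->
  exists al be : K, a * be - b * al != 0.
Proof.
case/orP=> h; [exists 0, 1 | exists (-1), 0].
  by rewrite mulr1 mulr0 subr0.
by rewrite mulr0 mulrN1 opprK add0r.
Qed.

Lemma cone_rel_exists (a b c D : K) :
  (a != 0) || (b != 0) -> (c != 0) || (D != 0) ->
  exists F, cone_rel a b c (D * a * a) (D * a * b) (D * b * b) F.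
Proof.
move=> ab cD; have [al [be de0]] := frame_complement ab.
pose w := cone_section a b c D al be.
have fw : free (mkseq w n) by apply: cone_section_free.
have lagF : lagrangian_flag form n (flag_of_half form n w).
  by apply: flag_of_half_lagrangian => // i j; apply: cone_section_isotropic.
exists (flag_of_half form n w); set F := flag_of_half form n w in lagF *.
have FE i : (i <= n)%N -> F i = <<mkseq w i>>%VS by rewrite /F /flag_of_half => ->.
have xH i p : (i < n)%N -> p \in F i.+1 -> x p \in F i.
  move=> i_n; rewrite FE // FE 1?ltnW // => /mem_span_mkseqP[t ->].
  rewrite linear_sum; apply: rpred_sum => l _; rewrite linearZ; apply: rpredZ.
  have ll := ltn_ord l; have : x (w l) \in <<mkseq w l>>%VS.
    by apply: cone_span_x => //; lia.
  apply: subvP; apply: span_mkseq_sub => j jl; apply: mem_mkseq_span; lia.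
have inF i p : (i <= n)%N -> p \in <<mkseq w i>>%VS -> p \in F i by move=> /FE ->.
split.
- split; [exact: lagF.1 | exact: lagF.2 | by apply: inF => //; apply: cone_span_v |].
  case=> // i _; apply/subvP => _ /memv_imgP[p pF ->] /=.
  case: (ltnP i n) => i_n; first exact: xH.
  case: (leqP (2 * n) i) => i2n.
    by rewrite (complete_flag_full lagF.1) ?dimV // memvf.
  (* Above the middle, self-adjointness of [x] turns the inclusion to be shown into the one already
     known from [F_{2n-i}] to [F_{2n-i-1}]. *)
  have E : i = (2 * n - (2 * n - i))%N by lia.
  rewrite E -lagF.2; last by lia.
  apply/mem_orthovP => q; rewrite x_adj => qF.
  have E' : i.+1 = (2 * n - (2 * n - i.+1))%N by lia.
  move: pF; rewrite E' -lagF.2; last by lia.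
  move=> /mem_orthovP; apply; apply: xH; first by lia.
  by rewrite (_ : (2 * n - i.+1).+1 = (2 * n - i)%N) //; lia.
- split=> [i im|mn3 p pF|i /andP[mi i_n]].
  + by apply: inF; [lia | apply: cone_span_e].
  + have xw l : (l < m.+3)%N -> x (w l) \in <<mkseq w m.+1>>%VS.
      rewrite ltnS leq_eqVlt => /orP[/eqP-> | lm].
        rewrite /w cone_section2; case: (D == 0) => /=;
          rewrite x_quad ?quad0 ?addr0 ?scale0r ?add0r.
          by apply: cone_span_line_vec.
        by apply/rpredZ/cone_span_e.
      apply: subvP (cone_span_x de0 cD _); last by lia.
      by apply: span_mkseq_sub => j jl; apply: mem_mkseq_span; lia.
    move: pF; rewrite FE // => /mem_span_mkseqP[t ->]; rewrite linear_sum.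
    apply: inF; first by lia.
    by apply: rpred_sum => l _; rewrite linearZ; apply/rpredZ/xw.
  + split; apply: inF => //; first by apply: cone_span_e_ge; lia.
    by have [] // := @cone_span_e2 a b c D al be de0 cD i; lia.
- by apply: inF; [lia | apply: cone_span_line_vec].
- by apply: inF; [lia | apply: cone_span_plane_vec1].
- by apply: inF; [lia | apply: cone_span_plane_vec2].
Qed.

Lemma ker_x p : x p = 0 -> p \in (<[e 1]> + <[f n]>)%VS.
Proof.
move=> xp; have -> : p = '[p, f 1] *: e 1 + '[e n, p] *: f n; last first.
  by apply: memv_add; apply: rpredZ; apply: memv_line.
apply/eqP; rewrite -subr_eq0 opprD; apply/eqP/ef_ext => i.
  rewrite !(skewDl, skewNl, skewZl) form_ff form_ef.
  have : i = 0 \/ i = 1%N \/ (1 < i)%N by lia.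
  case=> [->|[->|i1]].
  - have f00 : f 0 = 0.
      by apply: ef_ext => j; rewrite ?form_ff // form_ef; case: eqP => //= ->.
    by rewrite f00 skew0r; decide_eqs; rewrite /=; ring.
  - by decide_eqs; rewrite /=; ring.
  - have -> : '[p, f i] = 0.
      rewrite -(prednK (ltnW i1)) -x_f; last by lia.
      by rewrite -x_adj xp skew0l.
    by decide_eqs; rewrite /=; ring.
rewrite !(skewDr, skewNr, skewZr) form_ee form_ef.
have : i = n \/ (i < n)%N \/ (n < i)%N by lia.
case=> [->|[i_n|i_n]].
- by decide_eqs; rewrite /=; ring.
- have -> : '[e i, p] = 0.
    rewrite (_ : i = i.+1.-1) // -x_e //.
    by rewrite x_adj xp skew0r.
  by decide_eqs; rewrite /=; ring.
- have -> : e i = 0 by apply: ef_ext => j; rewrite ?form_ee // form_ef; decide_eqs.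
  by rewrite skew0l; decide_eqs; rewrite /=; ring.
Qed.

Section Relation.
Variables (F : nat -> {vspace V}) (a b c D : K).
Hypothesis relF : cone_rel a b c (D * a * a) (D * a * b) (D * b * b) F.

(** By [flag_cond], [F_{m+3}] lies in the preimage of [F_{m+1}] under [x]. This preimage has
    dimension at most [m+3], because the kernel of [x] has dimension at most 2, so the two coincide
    and membership can be tested after applying [x]. *)
Lemma cone_rel_quad al be : (m.+3 <= n)%N ->
  quad al be 0 0 \in F m.+3 /\ quad 0 0 a b \in F m.+3.
Proof.
move=> mn3; have [exF [eF xF _] g1F _ _] := relF.
have FE : F m.+3 = (x @^-1: F m.+1)%VS.
  apply/eqP; rewrite eqEdim; apply/andP; split.
    by apply/subvP => p pF; rewrite -memv_preim; apply: xF.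
  rewrite (exotic_dim exF) //; last by lia.
  set W := (x @^-1: _)%VS; rewrite -(limg_ker_dim x W).
  have d1 : (\dim (x @: W) <= m.+1)%N.
    rewrite -(exotic_dim (i := m.+1) exF); last by lia.
    by apply: dimvS; apply/subvP => _ /memv_imgP[p pW ->]; rewrite memv_preim.
  suff d2 : (\dim (W :&: lker x) <= 2)%N by apply: leq_trans (leq_add d2 d1) _.
  apply: leq_trans (_ : \dim (<[e 1]> + <[f n]>) <= _)%N.
    apply/dimvS/subvP => p; rewrite memv_cap => /andP[_].
    by rewrite memv_ker => /eqP; apply: ker_x.
  apply: leq_trans (dimv_add_leqif _ _).1 _.
  by rewrite !dim_vline; do 2 case: (_ == _).
have z0 : e m \in F m.+1 by apply: (exotic_le exF (leqnSn m)); apply: eF.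
split; rewrite FE -memv_preim x_quad ?quad0 ?addr0 ?rpredZ //.
by rewrite scale0r add0r.
Qed.

Lemma cone_rel_sec al be D0 l : (l < n)%N ->
  flag_section al be D0 a b c (D * a * a) (D * a * b) (D * b * b) l \in F l.+1.
Proof.
move=> ln; have [exF [eF xF efF] g1F s1F s2F] := relF; rewrite /flag_section.
case: ifP => lm; first exact: eF.
case: eqP => [->//|l0].
case: eqP => [->|l1]; first by apply: rpredB; apply: rpredZ.
case: eqP => [lE|l2].
  have mn3 : (m.+3 <= n)%N by lia.
  by have [h1 h2] := @cone_rel_quad al be mn3; rewrite lE; case: ifP.
case: eqP => [lE|l3]; last by case: (efF l.+1) => //; lia.
rewrite quadE !scale0r !add0r lE; have [|h1 h2] := efF m.+4; first by lia.
by rewrite rpredD ?rpredZ.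
Qed.

End Relation.

Lemma cone_rel_span F (a b c D al be : K) i :
  cone_rel a b c (D * a * a) (D * a * b) (D * b * b) F ->
  a * be - b * al != 0 -> (c != 0) || (D != 0) -> (i <= n)%N ->
  <<mkseq (cone_section a b c D al be) i>>%VS = F i.
Proof.
move=> relF de0 cD i_n; have [/exotic_lagrangian lagF _ _ _ _] := relF.
apply: (lagrangian_flag_span nd dimV lagF) => // [|l ln]; first exact: cone_section_free.
exact: cone_rel_sec.
Qed.

Lemma cone_rel_uniq F F' (a b c D : K) :
  (a != 0) || (b != 0) -> (c != 0) || (D != 0) ->
  cone_rel a b c (D * a * a) (D * a * b) (D * b * b) F ->
  cone_rel a b c (D * a * a) (D * a * b) (D * b * b) F' -> F = F'.
Proof.
move=> ab cD relF relF'; have [al [be de0]] := frame_complement ab.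
have [/exotic_lagrangian lagF _ _ _ _] := relF.
have [/exotic_lagrangian lagF' _ _ _ _] := relF'.
apply: (eq_lagrangian_flag nd dimV lagF lagF') => i i_n.
by rewrite -(cone_rel_span relF de0 cD i_n) -(cone_rel_span relF' de0 cD i_n).
Qed.

Lemma flag_step F i : exotic_flag form n v x F -> (i < 2 * n)%N ->
  exists2 p, p \in F i.+1 & p \notin F i.
Proof.
move=> exF i2n; apply: contrapT => h.
have : (F i.+1 <= F i)%VS.
  by apply/subvP => p pF; apply: contrapT => /negP pF'; apply: h; exists p.
by move/dimvS; rewrite !(exotic_dim exF) ?ltnn // ltnW.
Qed.

Lemma form_quad0_f (a b : K) i : i != m.+1 -> '[quad a b 0 0, f i] = 0.
Proof.
by move=> hi; rewrite !quadE !skewE !form_ff !form_ef; decide_eqs; rewrite /=; ring.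
Qed.

Lemma form_quad0_f1 (a b : K) : '[quad a b 0 0, f m.+1] = a.
Proof. by rewrite -dual_quad_e1 form_quad_dual mulr1 !mulr0 !addr0. Qed.

Lemma form_e_quad0 (a b : K) i : (1 <= i <= n)%N ->
  '[e i, quad a b 0 0] = (i == n)%:R * b.
Proof.
move=> hi; rewrite !quadE !skewE !form_ee !form_ef; decide_eqs.
by rewrite /= hi andbT; ring.
Qed.

(** Choose [p] in [F_{m+1}] outside [F_m] and [p2] in [F_{m+2}] outside [F_{m+1}]. As [x p] lies in
    [E], only the first two coordinates [(a, b)] of [p] survive modulo [E]; as [x p2] lies in
    [F_{m+1}], the last two coordinates of [p2] are [t (a, b)]. *)
Lemma param_exists F : exotic_flag form n v x F ->
  (forall i, (i <= m)%N -> e i \in F i) ->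
  exists a b c D : K, [/\ (a != 0) || (b != 0), (c != 0) || (D != 0),
    line_vec a b \in F m.+1, plane_vec1 c (D * a * a) (D * a * b) \in F m.+2
    & plane_vec2 c (D * a * b) (D * b * b) \in F m.+2].
Proof.
move=> exF eF; have m2n : (m.+1 < 2 * n)%N by lia.
have n1 : n.-1.+1 = n by lia.
have hn : (1 <= n.-1.+1 <= n)%N by lia.
have n1_n : (n.-1 < n)%N by lia.
pose E := <<mkseq (fun i => e i.+1) m>>%VS.
have EF i : (m <= i)%N -> (E <= F i)%VS.
  move=> mi; apply: span_mkseq_sub => l lm; apply: exotic_le (eF _ lm) => //; lia.
have fE : free (mkseq (fun i => e i.+1) m).
  apply: (free_triangular (form := form) (p := fun i => f i.+1)) => [l j jl|l lm].
    by rewrite form_ef; decide_eqs.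
  by rewrite form_ef; decide_eqs; rewrite oner_eq0.
have FmE : F m = E.
  apply/esym/span_mkseq_free => // [i im|]; last by rewrite (exotic_dim exF) // ltnW // ltnW.
  by apply: exotic_le (eF _ im).
have Ef p i : p \in E -> (m < i)%N -> '[p, f i] = 0.
  move=> /mem_span_mkseqP[t ->] mi; rewrite skew_suml big1 // => j _.
  by rewrite skewZl form_ef; have := ltn_ord j => jm; decide_eqs; rewrite mulr0.
have eE p i : p \in E -> '[e i, p] = 0.
  move=> /mem_span_mkseqP[t ->]; rewrite skew_sumr big1 // => j _.
  by rewrite skewZr form_ee mulr0.
have shift_f p i : (0 < i)%N -> '[p, f i.+1] = '[x p, f i].
  by move=> i0; rewrite -x_f // x_adj.
have shift_e p i : (i < n)%N -> '[e i, p] = '[e i.+1, x p].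
  by move=> i_n; rewrite -x_adj x_e.
have [p pF1 pF0] := flag_step exF (ltnW m2n).
have xpE : x p \in E by rewrite -FmE; apply: exotic_x pF1.
have pf i : (m.+2 <= i)%N -> '[p, f i] = 0.
  by case: i => // i mi; rewrite shift_f ?Ef //; lia.
have pe i : (i < n)%N -> '[e i, p] = 0 by move=> i_n; rewrite shift_e // eE.
pose a := '[p, f m.+1]; pose b := '[e n, p].
have pq : p - quad a b 0 0 \in E.
  have pf' i : (m.+3 <= i <= n)%N -> '[p, f i] = 0 by move=> /andP[/ltnW hi _]; apply: pf.
  have pe' i : (1 <= i <= n - 2)%N -> '[e i, p] = 0 
    by move=> hi; apply: pe; clear -hi; lia.
  by have := quad_coord pf' pe'; rewrite (pf m.+2) // (pe n.-1).
have abF : quad a b 0 0 \in F m.+1.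
  rewrite -(subKr p (quad a b 0 0)) rpredB //.
  exact: (subvP (EF _ (leqnSn m))).
have ab : (a != 0) || (b != 0).
  apply: contraNT pF0; rewrite negb_or !negbK => /andP[/eqP a0 /eqP b0].
  by move: pq; rewrite a0 b0 quad0 subr0 FmE.
have F1E : F m.+1 = (E + <[quad a b 0 0]>)%VS.
  apply/esym/eqP; rewrite eqEdim subv_add (EF _ (leqnSn m)) -memvE abF /=.
  rewrite (exotic_dim exF); last exact: ltnW.
  have gE : quad a b 0 0 \notin E.
    apply: contra pF0 => gE; rewrite FmE -(subrK (quad a b 0 0) p).
    exact: rpredD.
  rewrite dimv_disjoint_sum.
    rewrite -FmE (exotic_dim exF); last by rewrite ltnW // ltnW.
    rewrite dim_vline; case: eqP gE => [->|]; first by rewrite mem0v.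
    by rewrite addn1.
  apply/eqP; rewrite -subv0; apply/subvP => q; rewrite memv_cap => /andP[qE].
  move=> /vlineP[t qt]; rewrite memv0 qt; case: (eqVneq t 0) => [->|t0].
    by rewrite scale0r.
  by move: qE; rewrite qt rpredZeq (negPf t0) (negPf gE).
have [p2 pF2 pF1'] := flag_step exF m2n.
have := exotic_x exF pF2; rewrite F1E => /memv_addP[u uE [_ /vlineP[t ->] xp2]].
have p2f i : (m.+2 <= i)%N -> '[p2, f i] = t * '[quad a b 0 0, f i.-1].
  case: i => // i mi; rewrite shift_f; last exact: leq_ltn_trans (leq0n m) mi.
  by rewrite xp2 skewDl Ef // add0r skewZl.
have p2e i : (i < n)%N -> '[e i, p2] = t * '[e i.+1, quad a b 0 0].
  by move=> i_n; rewrite shift_e // xp2 skewDr eE // add0r skewZr.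
pose c1 := '[p2, f m.+1]; pose c2 := '[e n, p2].
have p2q : p2 - quad c1 c2 (t * a) (t * b) \in E.
  have ge i : (1 <= i <= n)%N -> '[e i, quad a b 0 0] = (i == n)%:R * b.
    exact: form_e_quad0.
  have pf' i : (m.+3 <= i <= n)%N -> '[p2, f i] = 0.
    move=> hi; have [h1 h2] : (i.-1 != m.+1)%N /\ (m.+2 <= i)%N by clear -hi; lia.
    by rewrite p2f // form_quad0_f ?mulr0.
  have pe' i : (1 <= i <= n - 2)%N -> '[e i, p2] = 0.
    move=> hi; have [h1 [h2 h3]] : (i < n)%N /\ (0 < i.+1 <= n)%N /\ (i.+1 == n) = false.
      by clear -hi; lia.
    by rewrite p2e // ge // h3 mul0r mulr0.
  have := quad_coord pf' pe'; rewrite (p2f m.+2) //= (p2e n.-1) //.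
  rewrite form_quad0_f1 ge; last exact: hn.
  by rewrite n1 eqxx mul1r.
have qF2 : quad c1 c2 (t * a) (t * b) \in F m.+2.
  rewrite -(subKr p2 (quad _ _ _ _)) rpredB //.
  exact: (subvP (EF m.+2 (leqW (leqnSn m))) _ p2q).
have gF2 : quad a b 0 0 \in F m.+2 by apply: exotic_le abF.
(* The coordinate [c] is the minor of [(a, b)] and [(c1, c2)]. If it and [t] both vanish, [(c1, c2)]
   is a multiple of [(a, b)] and [p2] falls into [F_{m+1}]. *)
exists a, b, (a * c2 - b * c1), t; split; first exact: ab.
- apply: contraNT pF1'; rewrite negb_or !negbK subr_eq0 => /andP[/eqP ac /eqP t0].
  have [r [r1 r2]] : exists r, c1 = r * a /\ c2 = r * b.
    case/orP: ab => h; [exists (c1 / a) | exists (c2 / b)].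
      by split; [field | apply: (mulfI h); rewrite ac; field].
    by split; [apply: (mulfI h); rewrite -ac; field | field].
  move: p2q; rewrite t0 !mul0r => p2q.
  rewrite -(subrK (quad c1 c2 0 0) p2) rpredD //.
    exact: (subvP (EF _ (leqnSn m))).
  have -> : quad c1 c2 0 0 = r *: quad a b 0 0 by rewrite quadZ r1 r2 !mulr0.
  exact: rpredZ.
- by rewrite -F1E; exact: abF.
- rewrite (_ : plane_vec1 _ _ _ =
    a *: quad c1 c2 (t * a) (t * b) + (- c1) *: quad a b 0 0).
    by rewrite rpredD ?rpredZ.
  by rewrite /plane_vec1 !quadZ quadD; congr quad; ring.
- rewrite (_ : plane_vec2 _ _ _ =
    b *: quad c1 c2 (t * a) (t * b) + (- c2) *: quad a b 0 0).
    by rewrite rpredD ?rpredZ.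
  by rewrite /plane_vec2 !quadZ quadD; congr quad; ring.
Qed.

End Flags.

(** * Pluecker coordinates of a flag as Gram determinants *)

Section Minors.
Variables (K : fieldType) (V : vectType K) (form : {skew_symmetric V}).
Local Notation "''[' v , w ]" := (form v%R w%R).
Variables (n m : nat) (v : V) (x : 'End(V)) (e f : nat -> V).
Hypothesis J : jordan_basis form n m v x e f.
Local Notation dq := (dual_quad n m e f).

(** The vectors [f 1 .. f m] are dual to the basis of [E], so the remaining [P1], [P2] read off a
    minor of the flag modulo [E]. *)
Definition proj_dual (P1 P2 : V) (j : nat) : V :=
  if (j < m)%N then f j.+1 else if j == m then P1 else P2.

Lemma cone_rel_minors F a b c D (y : nat -> V) :
  (a != 0) || (b != 0) -> (c != 0) || (D != 0) ->
  cone_rel form n m v x e f a b c (D * a * a) (D * a * b) (D * b * b) F ->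
  (forall i, (i <= m.+2)%N -> <<mkseq y i>>%VS = F i) ->
  let minor2 P1 P2 := gram form (m + 2) y (proj_dual P1 P2) in
  exists t1 t2, [/\ t1 != 0, t2 != 0,
    forall p q, gram form (m + 1) y (proj_dual (dq p q 0 0) 0) = t1 * (a * p + b * q)
  & [/\ minor2 (dq 1 0 0 0) (dq 0 1 0 0) = t2 * c,
        minor2 (dq 1 0 0 0) (dq 0 0 1 0) = t2 * (D * a * a),
        minor2 (dq 1 0 0 0) (dq 0 0 0 1) = t2 * (D * a * b)
      & minor2 (dq 0 1 0 0) (dq 0 0 0 1) = t2 * (D * b * b)]].
Proof.
move=> ab cD relF yF minor2.
have [al [be de0]] := frame_complement ab.
pose w := cone_section n m e f a b c D al be; set de := a * be - b * al in de0.
have mn := jb_mn J.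
have wF i : (i <= n)%N -> <<mkseq w i>>%VS = F i by apply: (cone_rel_span J).
have prop r : (r <= m.+2)%N -> exists t,
    (forall p, gram form r y p = t * gram form r w p) /\
    forall p, gram form r w p != 0 -> t != 0.
  move=> rm; apply: gram_proportional => i ir.
    by rewrite wF ?(leq_trans rm) // -yF // mem_mkseq_span.
  by rewrite yF // -wF ?(leq_trans rm) // mem_mkseq_span.
have we i : (i < m)%N -> w i = e i.+1 by apply: cone_section_lt.
have w0 : w m = quad n m e f a b 0 0 by apply: cone_section0.
have w1 : w m.+1 = quad n m e f (c * al) (c * be) (D * de * a) (D * de * b).
  exact: (cone_section1 J).
have wp P1 P2 i j : (i < m)%N -> (j < m)%N -> '[w i, proj_dual P1 P2 j] = (i == j)%:R.
  move=> im jm; rewrite we // /proj_dual jm (jb_ef J) eqSS.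
  by rewrite (_ : (0 < i.+1 <= n)%N) ?andbT //; lia.
have p0 P1 P2 : proj_dual P1 P2 m = P1 by rewrite /proj_dual ltnn eqxx.
have p1 P1 P2 : proj_dual P1 P2 m.+1 = P2.
  by rewrite /proj_dual ltnNge leqnSn /= gtn_eqF.
have [t1 [t1E t1N]] := prop _ (leqnSn m.+1).
have [t2 [t2E t2N]] := prop _ (leqnn m.+2).
have G1 p q : gram form (m + 1) w (proj_dual (dq p q 0 0) 0) = a * p + b * q.
  rewrite gram_block; first by rewrite gram1 addn0 p0 w0 (form_quad_dual J); ring.
    exact: wp.
  move=> i j im; rewrite ltnS leqn0 => /eqP->.
  by rewrite addn0 p0 we // (form_e_dual J).
have G2 p q r s p' q' r' s' :
    gram form (m + 2) w (proj_dual (dq p q r s) (dq p' q' r' s')) =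
    '[w m, dq p q r s] * '[w m.+1, dq p' q' r' s']
    - '[w m, dq p' q' r' s'] * '[w m.+1, dq p q r s].
  rewrite gram_block; first by rewrite gram2 addn0 addn1 p0 p1.
    exact: wp.
  move=> i j im; rewrite ltnS leq_eqVlt ltnS leqn0 => /orP[]/eqP->.
    by rewrite addn1 p1 we // (form_e_dual J).
  by rewrite addn0 p0 we // (form_e_dual J).
have t1E' p q : gram form (m + 1) y (proj_dual (dq p q 0 0) 0) = t1 * (a * p + b * q).
  by rewrite -G1 addn1 t1E.
have t2E' P1 P2 : minor2 P1 P2 = t2 * gram form (m + 2) w (proj_dual P1 P2).
  by rewrite /minor2 addn2 t2E.
(* Modulo [E], the wedge of the sections of index [m] and [m+1] is [de] times the bivector with
   coordinates [(c, D a^2, D a b, D b^2)]; hence the extra factor. *)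
exists t1, (t2 * de); split=> //.
- case/orP: ab => h; [apply: (t1N (proj_dual (dq 1 0 0 0) 0))
                     | apply: (t1N (proj_dual (dq 0 1 0 0) 0))].
    by rewrite -addn1 G1 mulr1 mulr0 addr0.
  by rewrite -addn1 G1 mulr1 mulr0 add0r.
- rewrite mulf_neq0 //.
  case/orP: cD => h; last case/orP: ab => h'.
  + apply: (t2N (proj_dual (dq 1 0 0 0) (dq 0 1 0 0))).
    rewrite -addn2 G2 w0 w1 !(form_quad_dual J).
    by rewrite (_ : _ - _ = c * de) ?mulf_neq0 // /de; ring.
  + apply: (t2N (proj_dual (dq 1 0 0 0) (dq 0 0 1 0))).
    rewrite -addn2 G2 w0 w1 !(form_quad_dual J).
    by rewrite (_ : _ - _ = D * de * a * a) ?mulf_neq0 //; ring.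
  + apply: (t2N (proj_dual (dq 0 1 0 0) (dq 0 0 0 1))).
    rewrite -addn2 G2 w0 w1 !(form_quad_dual J).
    by rewrite (_ : _ - _ = D * de * b * b) ?mulf_neq0 //; ring.
- by split; rewrite t2E' G2 w0 w1 !(form_quad_dual J) /de; ring.
Qed.

End Minors.

(** * Exotic types of subquotients *)

Section OneRow.
Variables (K : fieldType) (W : vectType K) (form : {skew_symmetric W}).
Local Notation "''[' v , w ]" := (form v%R w%R).
Variable x : 'End(W).

Lemma cells1 N : cells [:: N] = [seq (0, j)%N | j <- iota 1 N].
Proof. by case: N => [|N] //; rewrite /cells /nparts /= /allpairs_dep /= cats0. Qed.

Lemma mem_cells1 N c : (c \in cells [:: N]) = (c.1 == 0)%N && (1 <= c.2 <= N)%N.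
Proof.
rewrite cells1; case: c => i j /=; apply/mapP/andP => [[l]|[/eqP-> h]].
  by rewrite mem_iota => h [-> ->]; split=> //; lia.
by exists j => //; rewrite mem_iota; lia.
Qed.

(** In a single Jordan row [v] is the vector at height [a], and [x] lowers the height by one, so [a]
    is the order of [v] under [x]. *)
Lemma eType_order v a b : eType form v x [:: a] [:: b] ->
  iter a x v = 0 /\ ((0 < a)%N -> iter a.-1 x v != 0).
Proof.
move=> [_ _ [e [f [la bas dual ee ff vE xe xf]]]].
case: a => [|a] in la dual ee ff vE xe xf bas *.
  by split=> //; rewrite vE big_nil.
have incells j : (0 < j <= a.+1)%N -> (0, j)%N \in cells la.
  by rewrite /la mem_cells1 /= => h; lia.
have {}vE : v = e 0%N a.+1 by rewrite vE big_nat1.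
have it p : (p <= a)%N -> iter p x v = e 0%N (a.+1 - p)%N.
  elim: p => [|p IH] pa; first by rewrite subn0.
  rewrite iterS IH 1?ltnW // (xe (0, a.+1 - p)%N) /=; last by apply: incells; lia.
  by rewrite ifN; [congr (e 0%N _); lia | lia].
have c1 : (0, 1)%N \in cells la by apply: incells.
split=> [|_].
  by rewrite iterS it // subSnn (xe (0, 1)%N).
rewrite it // subSnn; apply/eqP => e0; have := dual _ _ c1 c1.
by rewrite e0 skew0l eqxx => /eqP; rewrite eq_sym oner_eq0.
Qed.

Hypothesis nd : nondegenerate form.
Hypothesis two : 2%:R != 0 :> K.
Hypothesis x_adj : forall u w, '[x u, w] = '[u, x w].

Lemma iter_adj c u w : '[iter c x u, w] = '[u, iter c x w].
Proof. by elim: c w => // c IH w; rewrite iterS x_adj IH -iterSr. Qed.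

(** Self-adjointness gives [<u, x^c u> = <x^c u, u>], and skewness gives the opposite sign. *)
Lemma cyclic_isotropic c c' u : '[iter c x u, iter c' x u] = 0.
Proof.
rewrite iter_adj -iterD; move: (c + c')%N => {c'}c.
have : '[u, iter c x u] + '[u, iter c x u] = 0.
  by rewrite -{2}iter_adj [X in _ + X]skewC subrr.
by rewrite -mulr2n -mulr_natl => /eqP; rewrite mulf_eq0 (negPf two) => /eqP.
Qed.

Lemma iter0 c : iter c x 0 = 0.
Proof. by elim: c => //= c ->; rewrite linear0. Qed.

(* A Jordan basis with a single pair of rows is generated by [u], of maximal order, and
   by any vector [phi] dual to the orbit of [u]. *)
Lemma eType_cyclic j a b u : \dim {:W} = (2 * j)%N ->
  iter j x u = 0 -> ((0 < j)%N -> iter j.-1 x u != 0) -> (a + b)%N = j ->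
  eType form (iter b x u) x [:: a] [:: b].
Proof.
move=> dimW xju xj1u abj; split=> //.
have cE : cells (padd [:: a] [:: b]) = [seq (0, l)%N | l <- iota 1 j].
  by rewrite -abj -cells1.
have xge c : (j <= c)%N -> iter c x u = 0.
  by move=> jc; rewrite -(subnK jc) iterD xju iter0.
have [phi phiP] : exists phi, forall c, (c < j)%N -> '[iter c x u, phi] = (c == j.-1)%:R.
  case: (posnP j) => [j0|j0]; first by exists 0 => c; rewrite j0.
  (* Any [psi] detecting [x^{j-1} u] shows, through its own iterates, that the reversed orbit of [u]
     is free; the first vector of a dual family is then [phi]. *)
  have [psi _ psiP] : exists2 psi, psi \in orthov form 0%VS & '[iter j.-1 x u, psi] != 0.
    by apply: form_separates => //; rewrite memv0 xj1u.
  have fw : free (mkseq (fun l => iter (j.-1 - l) x u) j).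
    apply: (free_triangular (form := form) (p := fun l => iter l x psi)) => [l i li|l lj].
      by rewrite -iter_adj -iterD xge ?skew0l //; lia.
    by rewrite -iter_adj -iterD subnKC //; lia.
  have [t tP] := dual_family nd fw; exists (t 0%N) => c cj.
  have := tP (j.-1 - c)%N 0%N; rewrite subKn; last by lia.
  move=> ->; [|lia|lia]; congr (nat_of_bool _)%:R; apply/eqP/eqP; lia.
pose e (i l : nat) := iter (j - l) x u; pose f (i l : nat) := iter l.-1 x phi.
have ef l l' : (1 <= l <= j)%N -> (1 <= l' <= j)%N -> '[e 0%N l, f 0%N l'] = (l == l')%:R.
  move=> hl hl'; rewrite /e /f -iter_adj -iterD.
  case: (ltnP l l') => ll'; first by rewrite xge ?skew0l ?ltn_eqF //; lia.
  by rewrite phiP; [congr (nat_of_bool _)%:R; apply/eqP/eqP; lia | lia].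
have ee l l' : '[e 0%N l, e 0%N l'] = 0 by apply: cyclic_isotropic.
have ff l l' : '[f 0%N l, f 0%N l'] = 0 by apply: cyclic_isotropic.
pose g i := if (i < j)%N then e 0%N i.+1 else f 0%N (i - j).+1.
have gE : mkseq g (2 * j) = [seq e c.1 c.2 | c <- cells (padd [:: a] [:: b])]
       ++ [seq f c.1 c.2 | c <- cells (padd [:: a] [:: b])].
  rewrite cE -!map_comp mul2n -addnn /mkseq iotaD map_cat; congr (_ ++ _).
    rewrite -[1%N]addn0 iotaDl -map_comp; apply/eq_in_map => i.
    by rewrite mem_iota /g => /andP[_ ->].
  rewrite -[1%N]addn0 -[(0 + j)%N]addnC !iotaDl -!map_comp; apply/eq_in_map => i _ /=.
  by rewrite /g ltnNge leq_addr addKn.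
have fg : free (mkseq g (2 * j)).
  pose p i := if (i < j)%N then f 0%N i.+1 else e 0%N (i - j).+1.
  apply: (free_triangular (form := form) (p := p)) => [l i /andP[il lj]|l lj].
    rewrite /g /p; case: (ltnP i j) => ij; case: (ltnP l j) => lj'.
    - by rewrite ef ?ltn_eqF //; lia.
    - exact: ee.
    - by lia.
    - by rewrite skewC ef ?gtn_eqF ?oppr0 //; lia.
  rewrite /g /p; case: (ltnP l j) => lj'; first by rewrite ef ?eqxx ?oner_eq0 //; lia.
  by rewrite skewC ef ?eqxx ?oppr_eq0 ?oner_eq0 //; lia.
have gfull : <<mkseq g (2 * j)>>%VS = fullv.
  by apply: span_mkseq_free => //; [move=> i _; apply: memvf | rewrite dimW].
(* Needed for the row of the [f] to end after [j] steps: [x^j phi] is orthogonal to the orbit of [u]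
   because [x^j u = 0], and to the orbit of [phi] by cyclic isotropy. *)
have xphi : iter j x phi = 0.
  apply: (form_eq0 nd) => q; apply: (mem_orthovP _ q (memvf q)).
  rewrite -gfull; apply: mem_orthov_span => i _; rewrite /g; case: ifP => _.
    by rewrite /e iter_adj -iterD xge ?skew0r //; lia.
  exact: cyclic_isotropic.
have cP c : c \in cells (padd [:: a] [:: b]) -> c = (0, c.2)%N /\ (1 <= c.2 <= j)%N.
  rewrite mem_cells1 /=; case: c => i l /= /andP[/eqP-> h]; split=> //; lia.
exists e, f; split.
- by rewrite -gE basisEfree fg subvf size_mkseq /= dimW.
- move=> c c' /cP[-> h] /cP[-> h'] /=; rewrite ef //.
- by move=> c c' _ _; apply: cyclic_isotropic.
- by move=> c c' _ _; apply: cyclic_isotropic.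
(* For [a = 0] the sum is empty, and [x^b u] vanishes because [b = j]. *)
- case: a abj {cE gE cP} => [|a] abj; first by rewrite big_nil -[b]/(0 + b)%N abj.
  by rewrite big_nat1 /= /e -abj addKn.
- move=> c /cP[-> /= h]; rewrite /e /= -iterS; case: eqP => [->|c1].
    by rewrite xge //; lia.
  by congr (iter _ x u); lia.
- move=> c /cP[-> /= h]; rewrite /f /= abj -iterS.
  case: eqP => [->|c1]; first by rewrite prednK //; lia.
  by congr (iter _ x phi); lia.
Qed.

End OneRow.

Section PerpQuotient.
Variables (K : fieldType) (V : vectType K) (form : {skew_symmetric V}).
Local Notation "''[' v , w ]" := (form v%R w%R).
Variables (x : 'End(V)) (W : {vspace V}).
Hypothesis nd : nondegenerate form.
Hypothesis x_adj : forall u w, '[x u, w] = '[u, x w].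
Hypothesis isoW : (W <= orthov form W)%VS.
Hypothesis xW : (x @: W <= W)%VS.
Local Notation cl := (perp_class form W).
Local Notation px := (perp_end form W x).

Lemma x_orthov w : w \in orthov form W -> x w \in orthov form W.
Proof.
move=> /mem_orthovP wW; apply/mem_orthovP => u uW.
by rewrite x_adj wW // (subvP xW) // memv_img.
Qed.

Lemma iter_x_orthov p w : w \in orthov form W -> iter p x w \in orthov form W.
Proof. by move=> wW; elim: p => //= p; apply: x_orthov. Qed.

Lemma perp_iter p w : w \in orthov form W -> iter p px (cl w) = cl (iter p x w).
Proof.
move=> wW; elim: p => // p IH; rewrite !iterS IH perp_class_end //.
exact: iter_x_orthov.
Qed.

Lemma perp_end_adj u w : perp_form (px u) w = perp_form u (px w).
Proof.
rewrite -(perp_class_surj u) -(perp_class_surj w).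
have uW := perp_quo_mem u; have wW := perp_quo_mem w.
by rewrite !perp_class_end // !perp_class_form ?x_orthov // x_adj.
Qed.

Lemma perp_nondegenerate :
  nondegenerate (@perp_form K V form W : {skew_symmetric (perp_quo form W)}).
Proof.
rewrite /nondegenerate -subv0; apply/subvP => u /mem_orthovP u0.
have uW := perp_quo_mem u.
rewrite memv0 -(perp_class_surj u) perp_class_eq0 //.
suff: vsval u \in orthov form (orthov form W) by rewrite orthovK.
apply/mem_orthovP => w wW.
rewrite -(perp_class_form uW wW) perp_class_surj.
exact: (u0 _ (memvf _)).
Qed.

Lemma dim_perp_quo : (\dim {: perp_quo form W} + 2 * \dim W = \dim {:V})%N.
Proof.
have -> : \dim {: perp_quo form W} = \dim (orthov form W :\: W).
  by rewrite dimvf.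
have := dimv_cap_compl (orthov form W) W; rewrite (capv_idPr isoW).
by have := dim_orthov nd W; lia.
Qed.

End PerpQuotient.

(** * Flags in the cell and their subquotient types *)

Section PhiFibre.
Variables (K : fieldType) (V : vectType K) (form : {skew_symmetric V}).
Local Notation "''[' v , w ]" := (form v%R w%R).
Variables (n m : nat) (v : V) (x : 'End(V)) (e f : nat -> V).
Hypothesis J : jordan_basis form n m v x e f.
Hypothesis two : 2%:R != 0 :> K.
Let mn := jb_mn J.
Local Notation exotic := (exotic_flag form n v x).

Lemma orthov_exotic F i : exotic F -> (i <= 2 * n)%N -> orthov form (F i) = F (2 * n - i)%N.
Proof. by case=> _ + _ _; apply. Qed.

Lemma exotic_isotropic F i : exotic F -> (i <= n)%N -> (F i <= orthov form (F i))%VS.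
Proof.
move=> exF i_n; rewrite (orthov_exotic exF); last by lia.
by apply/subvP => p; apply: (exotic_le exF); lia.
Qed.

Lemma exotic_stable F i : exotic F -> (x @: F i <= F i)%VS.
Proof.
move=> exF; apply/subvP => _ /memv_imgP[p pF ->].
by apply: (exotic_x exF); apply: (exotic_le exF) pF.
Qed.

Lemma exotic_v F i : exotic F -> (i <= n)%N -> v \in orthov form (F i).
Proof.
move=> exF i_n; rewrite (orthov_exotic exF); last by lia.
by have [_ _ vF _] := exF; apply: (exotic_le exF) vF; lia.
Qed.

Lemma Phi_order F i a b : exotic F -> (i <= n)%N ->
  Phi form v x i F [:: a] [:: b] ->
  iter a x v \in F i /\ ((0 < a)%N -> iter a.-1 x v \notin F i).
Proof.
move=> exF i_n /eType_order[].
have iso := exotic_isotropic exF i_n; have vF := exotic_v exF i_n.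
have xF := exotic_stable i exF.
rewrite !(perp_iter (jb_adj J) iso xF _ vF) => /eqP.
rewrite !perp_class_eq0 //; exact: (iter_x_orthov (jb_adj J) xF).
Qed.

(** A type is certified by a vector [u] of maximal order modulo [F i] such that [v] is [x^b u]
    modulo [F i]. *)
Lemma Phi_cyclic F i a b u : exotic F -> (i <= n)%N -> (a + b = n - i)%N ->
  u \in orthov form (F i) -> iter (a + b) x u \in F i ->
  ((0 < a + b)%N -> iter (a + b).-1 x u \notin F i) -> v - iter b x u \in F i ->
  Phi form v x i F [:: a] [:: b].
Proof.
move=> exF i_n abE uF xjF xj1F vuF.
have iso := exotic_isotropic exF i_n; have vF := exotic_v exF i_n.
have xF := exotic_stable i exF.
have orb c : iter c x u \in orthov form (F i) by apply: (iter_x_orthov (jb_adj J) xF).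
have vE : perp_class form (F i) v = iter b (perp_end form (F i) x) (perp_class form (F i) u).
  rewrite (perp_iter (jb_adj J) iso xF _ uF); apply/eqP.
  by rewrite -subr_eq0 -linearB /= perp_class_eq0 // rpredB.
rewrite /Phi vE.
have pnd := perp_nondegenerate (F i) (jb_nd J).
apply: (eType_cyclic pnd two (perp_end_adj (jb_adj J) iso xF) (j := a + b)) => //.
- have := dim_perp_quo (jb_nd J) iso xF.
  rewrite (jb_dim J) (exotic_dim J exF); last by clear -i_n; lia.
  rewrite abE; clear -i_n; lia.
- by rewrite (perp_iter (jb_adj J) iso xF _ uF); apply/eqP; rewrite perp_class_eq0.
- by move=> /xj1F; rewrite (perp_iter (jb_adj J) iso xF _ uF) perp_class_eq0.
Qed.

Lemma iter_xe p q : (q <= n)%N -> iter p x (e q) = e (q - p).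
Proof.
move=> qn; elim: p => [|p IH]; first by rewrite subn0.
rewrite iterS IH (jb_xe J); last by lia.
by congr e; lia.
Qed.

Lemma iter_xv p : iter p x v = e (n - 2 - p).
Proof. by rewrite (jb_v J) iter_xe //; lia. Qed.

(** The two removed entries are easier to count than the remaining ones, so the count is taken
    through the complementary filter. *)
Lemma count_shape k j : (1 <= k < n)%N -> (j <= n)%N ->
  count (geq j) [seq r <- iota 1 n | (r != k) && (r != k.+1)] =
  (j - (k <= j) - (k < j))%N.
Proof.
move=> kn jn.
have total p : (p <= n)%N -> count (geq j) (iota 1 p) = minn j p.
  elim: p => [|p IH] pn; first by rewrite minn0.
  by rewrite -[p.+1]addn1 iotaD count_cat IH 1?ltnW //=; lia.
have comp : count (geq j) [seq r <- iota 1 n | ~~ ((r != k) && (r != k.+1))] =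
    ((k <= j) + (k < j))%N.
  have -> : [seq r <- iota 1 n | ~~ ((r != k) && (r != k.+1))] = [:: k; k.+1].
    have -> : n = (k.-1 + (2 + (n - k.+1)))%N by lia.
    rewrite !iotaD !filter_cat.
    rewrite (_ : [seq _ <- iota 1 k.-1 | _] = [::]); last first.
      by apply/eqP; rewrite -(negbK (_ == _)) -has_filter; apply/hasPn => r;
         rewrite mem_iota; lia.
    rewrite (_ : [seq _ <- iota _ (n - k.+1) | _] = [::]); last first.
      by apply/eqP; rewrite -(negbK (_ == _)) -has_filter; apply/hasPn => r;
         rewrite mem_iota; lia.
    have -> : (1 + k.-1 = k)%N by lia.
    by rewrite /= !eqxx /= andbF.
  by rewrite /= addn0.
set P := fun r => (r != k) && (r != k.+1).
have /permP/(_ (geq j)) : perm_eq ([seq r <- iota 1 n | P r] ++ [seq r <- iota 1 n | ~~ P r])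
    (iota 1 n) by rewrite (perm_filterC P).
rewrite count_cat total // (minn_idPl jn) [X in (_ + X)%N = _]comp -subnDA => E.
by rewrite -[LHS](addnK ((k <= j) + (k < j))) [X in (X - _)%N]E.
Qed.


Local Notation tab := (Tab n (n - m.+1) (n - m.+1).+1).

(** With [i = n - k] the booleans encode the types [((n-i-2), (2))] for [i <= m], [((n-m-2), (1))]
    for [i = m+1], and [((n-i), (0))] beyond. *)
Lemma Phi_fibreP F : Phi_fibre form n v x tab F <->
  exotic F /\ forall i, (i <= n)%N ->
    Phi form v x i F [:: n - i - (i <= m.+1) - (i <= m)]%N [:: (i <= m.+1) + (i <= m)]%N.
Proof.
have k1 : (0 < n - m.+1 < n)%N by lia.
have shapes i : (i <= n)%N ->
    shape_upto (n - i) tab.1 = [:: n - i - (i <= m.+1) - (i <= m)]%N /\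
    shape_upto (n - i) tab.2 = [:: (i <= m.+1) + (i <= m)]%N.
  move=> i_n.
  have h1 : ((n - m.+1 <= n - i) = (i <= m.+1))%N by clear -i_n mn; lia.
  have h2 : ((n - m.+1 < n - i) = (i <= m))%N by clear -i_n mn; lia.
  by rewrite /shape_upto /= addn0 count_shape ?leq_subr // h1 h2.
split=> -[exF PhiF]; split=> // i i_n.
  by have := PhiF (n - i)%N (leq_subr _ _); rewrite subKn //; have [-> ->] := shapes i i_n.
have := PhiF (n - i)%N (leq_subr _ _); have [] := shapes (n - i)%N (leq_subr _ _).
by rewrite subKn // => -> ->.
Qed.

Local Notation q4 := (quad n m e f).

(* The first part of the type of a subquotient is the order of [v] modulo [F_i]. *)
Lemma Phi_fibre_flags F : Phi_fibre form n v x tab F ->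
  [/\ exotic F, forall i, (i <= m)%N -> e i \in F i,
      forall i, (m.+2 <= i <= n)%N -> e i.-2 \in F i
    & forall i, (m.+2 <= i < n)%N -> e i.-1 \notin F i].
Proof.
move=> /Phi_fibreP[exF PhiF]; split=> // i hi.
- have i_n : (i <= n)%N by clear -hi mn; lia.
  have [h _] := Phi_order exF i_n (PhiF i i_n).
  by move: h; rewrite iter_xv (_ : n - 2 - _ = i)%N //; clear -hi mn; lia.
- have i_n : (i <= n)%N by clear -hi; lia.
  have [h _] := Phi_order exF i_n (PhiF i i_n).
  by move: h; rewrite iter_xv (_ : n - 2 - _ = i.-2)%N //; clear -hi mn; lia.
- have i_n : (i <= n)%N by clear -hi; lia.
  have [_ h] := Phi_order exF i_n (PhiF i i_n).
  have hE : (n - 2 - (n - i - (i <= m.+1) - (i <= m)).-1 = i.-1)%N.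
    by clear -hi mn; lia.
  by move: h; rewrite iter_xv hE; apply; clear -hi mn; lia.
Qed.

(** When [m+2 < n], the vector [e m.+1] enters the flag exactly at [F_{m+3}]. Hence
    [F_{m+3} = F_{m+2} + <e_{m+1}>], which [x] maps into [F_{m+1}]. Its absence from [F_{m+2}] also
    forces [b] and [D] to be nonzero, and dividing by them puts [f n.-1] in [F_{m+4}]. *)
Lemma Phi_fibre_cond F : Phi_fibre form n v x tab F -> flag_cond n m x e f F.
Proof.
move=> /Phi_fibre_flags[exF eF eF2 eF1].
have e1F : (m.+3 <= n)%N -> e m.+1 \in F m.+3 by move=> h; apply: (eF2 m.+3); rewrite h leqW.
have e1F' : (m.+3 <= n)%N -> e m.+1 \notin F m.+2.
  by move=> h; apply: (eF1 m.+2); rewrite leqnn.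
split=> // [mn3 p pF|i /andP[mi i_n]].
  have F3E : F m.+3 = (F m.+2 + <[e m.+1]>)%VS.
    apply/esym/eqP; rewrite eqEdim subv_add -memvE e1F // andbT.
    have -> : (F m.+2 <= F m.+3)%VS.
      by apply/subvP => q; apply: (exotic_le exF); apply: leqnSn.
    rewrite (exotic_dim J exF) /=; last by clear -mn mn3; lia.
    rewrite -[m.+3]addn1 dimv_disjoint_sum.
      rewrite (exotic_dim J exF) ?leq_add2l ?dim_vline; last by clear -mn mn3; lia.
      case: eqP (e1F' mn3) => // ->; by rewrite mem0v.
    apply/eqP; rewrite -subv0; apply/subvP => q; rewrite memv_cap => /andP[qF].
    move=> /vlineP[t qt]; rewrite memv0 qt; case: (eqVneq t 0) => [->|t0].
      by rewrite scale0r.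
    by move: qF; rewrite qt rpredZeq (negPf t0) (negPf (e1F' mn3)).
  move: pF; rewrite F3E => /memv_addP[u uF [_ /vlineP[t ->] ->]].
  rewrite linearD linearZ /= (jb_xe J) /=; last by clear -mn; lia.
  apply: rpredD; first exact: (exotic_x exF).
  by apply: rpredZ; apply: (exotic_le exF (leqnSn m)); apply: eF.
have mn3 : (m.+3 <= n)%N by apply: leq_trans i_n; apply: ltnW.
split; first by apply: eF2; rewrite i_n andbT; clear -mi; lia.
have [a [b [c [D [ab cD gF s1F s2F]]]]] := param_exists J exF eF.
have b0 : b != 0.
  apply: contraNneq (e1F' mn3) => b0; move: gF ab; rewrite b0 eqxx orbF => gF a0.
  apply: (exotic_le exF (leqnSn m.+1)).
  have -> : e m.+1 = a^-1 *: line_vec n m e f a 0.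
    by rewrite /line_vec quadZ mulVf // mulr0 quad_e1.
  exact: rpredZ.
have D0 : D != 0.
  apply: contraNneq (e1F' mn3) => D0; move: s2F cD; rewrite D0 eqxx orbF !mul0r => s2F c0.
  have -> : e m.+1 = (- c)^-1 *: plane_vec2 n m e f c 0 0.
    by rewrite /plane_vec2 quadZ mulVf ?oppr_eq0 // !mulr0 quad_e1.
  exact: rpredZ.
have gF3 : q4 0 0 a b \in F m.+3.
  have -> : q4 0 0 a b =
      (D * b)^-1 *: (plane_vec2 n m e f c (D * a * b) (D * b * b) + c *: q4 1 0 0 0).
    by rewrite /plane_vec2 quadZ quadD quadZ; congr quad; field; apply/andP.
  apply: rpredZ; apply: rpredD; first exact: (exotic_le exF (leqnSn _)) s2F.
  by rewrite quad_e1 rpredZ ?e1F.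
apply: (exotic_le exF mi).
have e2F : e m.+2 \in F m.+4.
  by apply: (eF2 m.+4); rewrite (leq_trans mi) // ltnW.
have -> : f n.-1 = b^-1 *: (q4 0 0 a b + (- a) *: q4 0 0 1 0).
  by rewrite -(quad_f2 n m e f) quadZ quadD quadZ; congr quad; field.
apply: rpredZ; apply: rpredD; first exact: (exotic_le exF (leqnSn _)) gF3.
by rewrite quad_e2 rpredZ.
Qed.

Lemma cone_rel_generic F (a b c D : K) : b != 0 -> D != 0 ->
  cone_rel form n m v x e f a b c (D * a * a) (D * a * b) (D * b * b) F ->
  Phi_fibre form n v x tab F.
Proof.
move=> b0 D0 relF; have [exF [eF xF efF] gF s1F s2F] := relF.
have de0 : a * 0 - b * 1 != 0 by rewrite mulr0 sub0r mulr1 oppr_eq0.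
have cD : (c != 0) || (D != 0) by rewrite D0 orbT.
(* The choice [al = 1], [be = 0] is admissible since [b <> 0]; together with [D <> 0] it makes every
   section of index [i >= m+2] equal to [e i.-1]. *)
pose w := cone_section n m e f a b c D 1 0.
have fw : free (mkseq w n) by apply: (cone_section_free J).
have wF i : (i <= n)%N -> <<mkseq w i>>%VS = F i by apply: (cone_rel_span J relF).
have we i : (i < m)%N -> w i = e i.+1 by apply: cone_section_lt.
have we' i : (m.+2 <= i)%N -> w i = e i.-1.
  have : i = m.+2 \/ i = m.+3 \/ (m.+4 <= i)%N \/ (i < m.+2)%N by lia.
  case=> [->|[->|[h|h]]].
  - by rewrite /w (cone_section2 J) (negPf D0) quad_e1.
  - by rewrite /w (cone_section3 J) quad_e2.
  - by rewrite /w (cone_section_ge J).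
  - by rewrite leqNgt h.
have notin i : (i < n)%N -> w i \notin F i.
  by move=> i_n; rewrite -wF 1?ltnW //; apply: free_notin fw i_n.
have e1F : e m.+1 \notin F m.+1.
  apply/negP; rewrite -wF 1?ltnW // -(quad_e1 n m e f) => h.
  have : dual_quad n m e f (- b) a 0 0 \in orthov form <<mkseq w m.+1>>.
    apply: mem_orthov_span => i; rewrite skewC ltnS leq_eqVlt => /orP[/eqP->|im].
      by rewrite /w cone_section0 (form_quad_dual J); ring.
    by rewrite we // (form_e_dual J) ?oppr0.
  move=> /mem_orthovP/(_ _ h)/eqP; rewrite skewC (form_quad_dual J).
  by rewrite (_ : - (_ + _) = b) ?(negPf b0) //; ring.
apply/Phi_fibreP; split=> // i i_n.
(* The generators are [e n], [e n.-1] and [v] in the three ranges; [v] is their image under [x^2],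
   [x] and the identity, which accounts for the second parts 2, 1 and 0. *)
have [im|[im|im]] : (i <= m)%N \/ i = m.+1 \/ (m.+2 <= i)%N by clear; lia.
- have -> : (i <= m.+1)%N = true by rewrite leqW.
  rewrite im; apply: (Phi_cyclic (u := e n) exF i_n); first by clear -im mn; lia.
  + rewrite -wF //; apply: mem_orthov_span => l li.
    by rewrite we ?(jb_ee J) // (leq_trans li).
  + rewrite iter_xe // (_ : n - _ = i)%N ?eF //; clear -im mn; lia.
  + move=> _; rewrite iter_xe // (_ : n - _ = i.+1)%N; last by clear -im mn; lia.
    move: im; rewrite leq_eqVlt => /orP[/eqP->|im].
      by apply: contra e1F; apply: (exotic_le exF).
    by rewrite -we // notin // (leq_trans im) // ltnW // ltnW.
  + by rewrite iter_xe // (jb_v J) subrr mem0v.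
- have -> : (i <= m.+1)%N = true by rewrite im leqnn.
  have -> : (i <= m)%N = false by rewrite im ltnn.
  have n1 : (n.-1 <= n)%N by apply: leq_pred.
  apply: (Phi_cyclic (u := e n.-1) exF i_n); first by clear -im mn; lia.
  + rewrite -wF //; apply: mem_orthov_span => l; rewrite im ltnS leq_eqVlt.
    case/orP=> [/eqP->|lm]; last by rewrite we ?(jb_ee J).
    rewrite /w cone_section0 (form_e_quad0 J); last by clear -mn; lia.
    by rewrite (_ : (n.-1 == n) = false) ?mul0r //; clear -mn; lia.
  + rewrite iter_xe // (_ : n.-1 - _ = m)%N; last by clear -im mn; lia.
    by rewrite im; apply: (exotic_le exF (leqnSn m)); apply: eF.
  + move=> _; rewrite iter_xe // (_ : n.-1 - _ = m.+1)%N ?im //; clear -im mn; lia.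
  + rewrite iter_xe // (jb_v J) (_ : n.-1 - _ = n - 2)%N ?subrr ?mem0v //; clear; lia.
- have -> : (i <= m.+1)%N = false by clear -im; lia.
  have -> : (i <= m)%N = false by clear -im; lia.
  apply: (Phi_cyclic (u := v) exF i_n); first by clear -i_n; lia.
  + exact: exotic_v.
  + rewrite iter_xv (_ : n - 2 - _ = i.-2)%N; last by clear -i_n im; lia.
    have [->|[iE|mi]] : i = m.+2 \/ i = m.+3 \/ (m.+4 <= i)%N by clear -im; lia.
    * by apply: (exotic_le exF (leqW (leqnSn m))); apply: eF.
    * rewrite iE in i_n *; have [h _] := cone_rel_quad J relF 1 0 i_n.
      by rewrite -(quad_e1 n m e f).
    * by case: (efF i) => //; rewrite mi.
  + rewrite iter_xv => i0; rewrite (_ : n - 2 - _ = i.-1)%N; last by clear -i_n im i0; lia.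
    by rewrite -we' // notin //; clear -i0; lia.
  + by rewrite /= subrr mem0v.
Qed.

End PhiFibre.

(** * The Hirzebruch surface and the closure of the cell *)

Section Hirzebruch.
Variable K : fieldType.
Implicit Types (z y : 'rV[K]_(2 + (1 + 3))).

(* [z] has homogeneous coordinates [((a, b), (c, d))]. *)
Definition za z := lsubmx z 0 0.
Definition zb z := lsubmx z 0 1.
Definition zc z := lsubmx (rsubmx z) 0 0.
Definition zd z (i : 'I_3) := rsubmx (rsubmx z) 0 i.
Local Notation i0 := (@Ordinal 3 0 isT).
Local Notation i1 := (@Ordinal 3 1 isT).
Local Notation i2 := (@Ordinal 3 2 isT).

Definition bicone : set 'rV[K]_(2 + (1 + 3)) := [set z | lsubmx z != 0 /\ rsubmx z != 0].
Definition bilines z := (<[lsubmx z]>%VS, <[rsubmx z]>%VS).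
Definition Sigma2 := [set p : {vspace 'rV[K]_2} * {vspace 'rV[K]_(1 + 3)} |
  forall w, w \in p.2 -> bundle_fibre p.1 w].

Lemma ord3_ind (P : 'I_3 -> Prop) : P i0 -> P i1 -> P i2 -> forall i, P i.
Proof.
move=> h0 h1 h2 i; case: i => [[|[|[|//]]] h].
- by rewrite (_ : Ordinal h = i0) //; apply: val_inj.
- by rewrite (_ : Ordinal h = i1) //; apply: val_inj.
- by rewrite (_ : Ordinal h = i2) //; apply: val_inj.
Qed.

Lemma ord2_ind (P : 'I_2 -> Prop) : P 0 -> P 1 -> forall i, P i.
Proof.
move=> h0 h1 i; case: i => [[|[|//]] h].
- by rewrite (_ : Ordinal h = 0) //; apply: val_inj.
- by rewrite (_ : Ordinal h = 1) //; apply: val_inj.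
Qed.

Lemma bicone_ab z : bicone z -> (za z != 0) || (zb z != 0).
Proof.
case=> u0 _; apply: contraNT u0; rewrite negb_or !negbK => /andP[/eqP a0 /eqP b0].
by apply/eqP/rowP; apply: ord2_ind; rewrite [RHS]mxE.
Qed.

Lemma Sigma2P z : bicone z -> Sigma2 (bilines z) <->
  exists D, [/\ zd z i0 = D * za z * za z, zd z i1 = D * za z * zb z
              & zd z i2 = D * zb z * zb z].
Proof.
case=> u0 w0; split=> [/(_ _ (memv_line _))|[D [d0 d1 d2]] w /= /vlineP[t ->]].
  rewrite /bundle_fibre /= taut_power_line // => /vlineP[D /rowP wE]; exists D.
  by split; rewrite /zd wE /za /zb !mxE /=; ring.
rewrite /bundle_fibre /= taut_power_line //; apply/vlineP; exists (t * D).
apply/rowP; move: d0 d1 d2; rewrite /zd /za /zb !mxE => d0 d1 d2.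
by apply: ord3_ind; rewrite !mxE /= ?d0 ?d1 ?d2; ring.
Qed.

Lemma bicone_cd z : bicone z ->
  [|| zc z != 0, zd z i0 != 0, zd z i1 != 0 | zd z i2 != 0].
Proof.
case=> _; apply: contraNT; rewrite !negb_or !negbK.
case/and4P=> /eqP c0 /eqP d0 /eqP d1 /eqP d2.
apply/eqP; rewrite -[LHS]hsubmxK (_ : lsubmx (rsubmx z) = 0); last first.
  by apply/rowP => i; rewrite ord1 [RHS]mxE.
rewrite (_ : rsubmx (rsubmx z) = 0) ?row_mx0 //; apply/rowP.
by apply: ord3_ind; rewrite [RHS]mxE.
Qed.

Lemma bicone_cD z D : bicone z ->
  zd z i0 = D * za z * za z -> zd z i1 = D * za z * zb z -> zd z i2 = D * zb z * zb z ->
  (zc z != 0) || (D != 0).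
Proof.
move=> /bicone_cd cd d0 d1 d2; move: cd; rewrite d0 d1 d2.
by case: (eqVneq D 0) => [->|_]; rewrite ?orbT // !mul0r eqxx !orbF.
Qed.

Lemma vline_eq (W : vectType K) (u w : W) :
  u != 0 -> w != 0 -> <[u]>%VS = <[w]>%VS -> exists2 t, t != 0 & w = t *: u.
Proof.
move=> u0 w0 uw; have /vlineP[t wE] : w \in <[u]>%VS by rewrite uw memv_line.
by exists t => //; apply: contraNneq w0 => t0; rewrite wE t0 scale0r.
Qed.

Lemma vline_scale (W : vectType K) (u : W) t : t != 0 -> <[t *: u]>%VS = <[u]>%VS.
Proof.
move=> t0; apply/eqP; rewrite eqEsubv -!memvE memvZ ?memv_line //=.
by rewrite -{1}[u]scale1r -(mulVf t0) -scalerA memvZ ?memv_line.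
Qed.

Lemma bilines_eq z y : bicone z -> bicone y -> bilines z = bilines y ->
  exists l k, [/\ l != 0, k != 0, lsubmx y = l *: lsubmx z & rsubmx y = k *: rsubmx z].
Proof.
move=> [zl zr] [yl yr] zy.
have [l l0 lE] := vline_eq zl yl (congr1 fst zy).
have [k k0 kE] := vline_eq zr yr (congr1 snd zy).
by exists l, k.
Qed.

Definition cone_point (a b c d0 d1 d2 : K) : 'rV[K]_(2 + (1 + 3)) :=
  row_mx (\row_(i < 2) (if i == 0 then a else b))
   (row_mx (\row_(i < 1) c)
      (\row_(i < 3) (if i == i0 then d0 else if i == i1 then d1 else d2))).

Lemma cone_pointE a b c d0 d1 d2 (z := cone_point a b c d0 d1 d2) :
  [/\ za z = a, zb z = b, zc z = c & [/\ zd z i0 = d0, zd z i1 = d1 & zd z i2 = d2]].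
Proof.
by rewrite /z /za /zb /zc /zd /cone_point row_mxKr !row_mxKl !row_mxKr !mxE. Qed.

Lemma cone_point_coords z : cone_point (za z) (zb z) (zc z) (zd z i0) (zd z i1) (zd z i2) = z.
Proof.
rewrite /cone_point -[RHS]hsubmxK -[X in _ = row_mx _ X]hsubmxK; congr row_mx.
  by apply/rowP; apply: ord2_ind; rewrite [LHS]mxE.
congr row_mx; first by apply/rowP => i; rewrite [LHS]mxE ord1.
by apply/rowP; apply: ord3_ind; rewrite [LHS]mxE.
Qed.

Lemma cone_point_bicone a b c d0 d1 d2 :
  (a != 0) || (b != 0) -> [|| c != 0, d0 != 0, d1 != 0 | d2 != 0] ->
  bicone (cone_point a b c d0 d1 d2).
Proof.
move=> ab cd; have [aE bE cE [d0E d1E d2E]] := cone_pointE a b c d0 d1 d2; split.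
  apply: contraTneq ab; set z := cone_point _ _ _ _ _ _ in aE bE * => z0.
  by rewrite -aE -bE /za /zb z0 !mxE eqxx.
apply: contraTneq cd; set z := cone_point _ _ _ _ _ _ in aE bE cE d0E d1E d2E * => z0.
by rewrite -cE -d0E -d1E -d2E /zc /zd z0 !mxE eqxx.
Qed.

Lemma bicone_open : opn (affine_space K (2 + (1 + 3))) bicone.
Proof.
apply/opn_affineP => z [zl zr].
have [i zi] : exists i, lsubmx z 0 i != 0.
  by apply/existsP; apply: contraNT zl; rewrite negb_exists => /forallP h;
     apply/eqP/rowP => i; rewrite [RHS]mxE; apply/eqP; rewrite -[_ == _]negbK.
have [j zj] : exists j, rsubmx z 0 j != 0.
  by apply/existsP; apply: contraNT zr; rewrite negb_exists => /forallP h;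
     apply/eqP/rowP => j; rewrite [RHS]mxE; apply/eqP; rewrite -[_ == _]negbK.
exists (fun y => y 0 (lshift _ i) * y 0 (rshift _ j)); split.
- by apply: polyfunM; apply: polyfun_coord.
- by rewrite mulf_neq0 //; [move: zi | move: zj]; rewrite mxE.
move=> y; rewrite mulf_eq0 negb_or => /andP[yi yj]; split.
  by apply: contraNneq yi => /rowP/(_ i); rewrite !mxE => ->.
by apply: contraNneq yj => /rowP/(_ j); rewrite !mxE => ->.
Qed.

Lemma polyfun_coords : [/\ polyfun za, polyfun zb, polyfun zc & forall i, polyfun (zd^~ i)].
Proof.
split=> [||| i].
- by apply: polyfun_ext (polyfun_coord K (lshift _ 0)) => z; rewrite /za mxE.
- by apply: polyfun_ext (polyfun_coord K (lshift _ 1)) => z; rewrite /zb mxE.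
- by apply: polyfun_ext (polyfun_coord K (rshift _ (lshift _ 0))) => z; rewrite /zc !mxE.
- by apply: polyfun_ext (polyfun_coord K (rshift _ (rshift _ i))) => z; rewrite /zd !mxE.
Qed.

Lemma polymap_cone_point d (a b c d0 d1 d2 : 'rV[K]_d -> K) :
  polyfun a -> polyfun b -> polyfun c -> polyfun d0 -> polyfun d1 -> polyfun d2 ->
  polymap (fun t => cone_point (a t) (b t) (c t) (d0 t) (d1 t) (d2 t)).
Proof.
move=> pa pb pc p0 p1 p2 j; rewrite /cone_point.
case: (split_ordP j) => [i ->|j' ->].
  apply: (polyfun_ext (f := fun t => if i == 0 then a t else b t)) => [t|].
    by rewrite row_mxEl mxE.
  by case: (i == 0).
case: (split_ordP j') => [i ->|i ->].
  by apply: polyfun_ext pc => t; rewrite row_mxEr row_mxEl mxE.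
apply: (polyfun_ext (f := fun t => if i == i0 then d0 t else if i == i1 then d1 t else d2 t)).
  by move=> t; rewrite !row_mxEr mxE.
by case: (i == i0) => //; case: (i == i1).
Qed.

(* The witness lies on the curve on which [b] and [D] move to [b + t] and [D + t]. *)
Lemma cone_curve (p : 'rV[K]_(2 + (1 + 3)) -> K) a b c D :
  (forall h : {poly K}, h != 0 -> exists t, h.[t] != 0) ->
  polyfun p -> p (cone_point a b c (D * a * a) (D * a * b) (D * b * b)) != 0 ->
  exists b' D', [/\ b' != 0, D' != 0 &
    p (cone_point a b' c (D' * a * a) (D' * a * b') (D' * b' * b')) != 0].
Proof.
move=> inf pp p0; pose B := 'X + b%:P; pose E := 'X + D%:P.
pose A := a%:P.
have [q qE] : exists q : 'I_(2 + (1 + 3)) -> {poly K}, forall i t,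
   cone_point a B.[t] c (E.[t] * a * a) (E.[t] * a * B.[t]) (E.[t] * B.[t] * B.[t]) 0 i
     = (q i).[t].
  apply: (@fin_all_exists _ _
    (fun i (q : {poly K}) => forall t, cone_point _ _ _ _ _ _ 0 i = q.[t])) => j.
  rewrite /cone_point; case: (split_ordP j) => [i ->|j' ->].
    exists (if i == 0 then A else B) => t; rewrite row_mxEl mxE.
    by case: ifP; rewrite ?hornerC.
  case: (split_ordP j') => [i ->|i ->].
    by exists c%:P => t; rewrite row_mxEr row_mxEl mxE hornerC.
  exists (if i == i0 then E * A * A else if i == i1 then E * A * B else E * B * B) => t.
  by rewrite !row_mxEr mxE; case: (i == i0); case: (i == i1); rewrite !hornerM ?hornerC.
have [h hE] := polyfun_curve q pp.
have hE' t :
    p (cone_point a B.[t] c (E.[t] * a * a) (E.[t] * a * B.[t]) (E.[t] * B.[t] * B.[t])) = h.[t].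
  by rewrite -hE; congr p; apply/rowP => i; rewrite qE mxE.
have B0 : B.[0] = b by rewrite hornerD hornerX hornerC add0r.
have E0 : E.[0] = D by rewrite hornerD hornerX hornerC add0r.
have h0 : h != 0.
  by apply: contraNneq p0 => h0; have := hE' 0; rewrite B0 E0 h0 horner0 => ->.
have Xn0 (r : K) : 'X + r%:P != 0 :> {poly K}.
  by rewrite -size_poly_eq0 size_XaddC.
have [|t] := inf (h * B * E); first by rewrite !mulf_neq0 ?Xn0.
rewrite !hornerM !mulf_eq0 !negb_or -andbA => /and3P[ht Bt Et].
by exists B.[t], E.[t]; split=> //; rewrite hE'.
Qed.

End Hirzebruch.

(** * The two morphisms between the component and the Hirzebruch surface *)

Section Component.
Variables (K : fieldType) (V : vectType K) (form : {skew_symmetric V}).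
Variables (n m : nat) (v : V) (x : 'End(V)) (e f : nat -> V).
Hypothesis J : jordan_basis form n m v x e f.
Local Notation d := (\dim {:V}).
Local Notation i0 := (@Ordinal 3 0 isT).
Local Notation i1 := (@Ordinal 3 1 isT).
Local Notation i2 := (@Ordinal 3 2 isT).
Local Notation exotic := (exotic_flag form n v x).
Local Notation cond := (flag_cond n m x e f).
Local Notation dq := (dual_quad n m e f).
Local Notation GL := ([set z : 'rV[K]_(d * d) | vec_mx z \in unitmx]).
Local Notation Fl := (@flag_of_frame K V).
Local Notation Q := (flag_variety V).
Local Notation bicone := (@bicone K).
Local Notation bilines := (@bilines K).
Implicit Types z : 'rV[K]_(2 + (1 + 3)).

Definition component (F : nat -> {vspace V}) : Prop := exotic F /\ cond F.

Definition flag_rel z F : Prop :=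
  cone_rel form n m v x e f (za z) (zb z) (zc z) (zd z i0) (zd z i1) (zd z i2) F.

Definition on_Sigma z : Prop := bicone z /\ Sigma2 (bilines z).

Lemma rel_component z F : flag_rel z F -> component F.
Proof. by case. Qed.

Lemma on_SigmaP z : on_Sigma z -> exists D, [/\ (za z != 0) || (zb z != 0),
  (zc z != 0) || (D != 0) & [/\ zd z i0 = D * za z * za z,
  zd z i1 = D * za z * zb z & zd z i2 = D * zb z * zb z]].
Proof.
case=> bz /(Sigma2P bz)[D [d0 d1 d2]]; exists D; split=> //; first exact: bicone_ab.
exact: bicone_cD d0 d1 d2.
Qed.

Lemma on_Sigma_cone_point a b c D : (a != 0) || (b != 0) -> (c != 0) || (D != 0) ->
  on_Sigma (cone_point a b c (D * a * a) (D * a * b) (D * b * b)).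
Proof.
move=> ab cD; have bz : bicone (cone_point a b c (D * a * a) (D * a * b) (D * b * b)).
  apply: cone_point_bicone => //; case/orP: cD => [->//|D0].
  case/orP: ab => h.
    by rewrite (mulf_neq0 (mulf_neq0 D0 h) h) orbT.
  by rewrite (mulf_neq0 (mulf_neq0 D0 h) h) !orbT.
split=> //; apply/Sigma2P => //.
by have [-> -> _ [-> -> ->]] := cone_pointE a b c (D * a * a) (D * a * b) (D * b * b); exists D.
Qed.

Lemma rel_exists z : on_Sigma z -> exists F, flag_rel z F.
Proof.
move=> /on_SigmaP[D [ab cD [d0 d1 d2]]]; rewrite /flag_rel d0 d1 d2.
exact: (cone_rel_exists J).
Qed.

Lemma rel_uniq z F F' : on_Sigma z -> flag_rel z F -> flag_rel z F' -> F = F'.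
Proof.
move=> /on_SigmaP[D [ab cD [d0 d1 d2]]]; rewrite /flag_rel d0 d1 d2.
exact: (cone_rel_uniq J).
Qed.

Lemma component_rel F : component F -> exists2 z, on_Sigma z & flag_rel z F.
Proof.
case=> exF cF; have [eF _ _] := cF.
have [a [b [c [D [ab cD gF s1F s2F]]]]] := param_exists J exF eF.
exists (cone_point a b c (D * a * a) (D * a * b) (D * b * b)); first exact: on_Sigma_cone_point.
rewrite /flag_rel.
have [-> -> -> [-> -> ->]] := cone_pointE a b c (D * a * a) (D * a * b) (D * b * b).
by split.
Qed.

Lemma rel_bilines z y F : bicone z -> bicone y -> bilines z = bilines y ->
  flag_rel z F -> flag_rel y F.
Proof.
move=> bz bY zy [exF cF gF s1F s2F].
have [l [k [_ _ lE kE]]] := bilines_eq bz bY zy.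
have aE : za y = l * za z by rewrite /za lE mxE.
have bE : zb y = l * zb z by rewrite /zb lE mxE.
have cE : zc y = k * zc z by rewrite /zc kE linearZ mxE.
have dE i : zd y i = k * zd z i by rewrite /zd kE linearZ mxE.
rewrite /flag_rel aE bE cE !dE; split; [by []|by []| | |].
- have -> : line_vec n m e f (l * za z) (l * zb z) = l *: line_vec n m e f (za z) (zb z).
    by rewrite /line_vec quadZ mulr0.
  exact: rpredZ.
- have -> : plane_vec1 n m e f (k * zc z) (k * zd z i0) (k * zd z i1) =
      k *: plane_vec1 n m e f (zc z) (zd z i0) (zd z i1).
    by rewrite /plane_vec1 quadZ mulr0.
  exact: rpredZ.
- have -> : plane_vec2 n m e f (k * zc z) (k * zd z i1) (k * zd z i2) =
      k *: plane_vec2 n m e f (zc z) (zd z i1) (zd z i2).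
    by rewrite /plane_vec2 quadZ mulr0 mulrN.
  exact: rpredZ.
Qed.

Definition Pluecker (y : 'rV[K]_(d * d)) : 'rV[K]_(2 + (1 + 3)) :=
  let rows i := (frame (vec_mx y : 'M[K]_d))`_i in
  let minor1 P := gram form (m + 1) rows (proj_dual m f P 0) in
  let minor2 P1 P2 := gram form (m + 2) rows (proj_dual m f P1 P2) in
  cone_point (minor1 (dq 1 0 0 0)) (minor1 (dq 0 1 0 0))
    (minor2 (dq 1 0 0 0) (dq 0 1 0 0)) (minor2 (dq 1 0 0 0) (dq 0 0 1 0))
    (minor2 (dq 1 0 0 0) (dq 0 0 0 1)) (minor2 (dq 0 1 0 0) (dq 0 0 0 1)).

Lemma polymap_Pluecker : polymap Pluecker.
Proof. by apply: polymap_cone_point; apply: polyfun_gram. Qed.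

Lemma cone_point_scale (t1 t2 a b c d0 d1 d2 : K) :
  lsubmx (cone_point (t1 * a) (t1 * b) (t2 * c) (t2 * d0) (t2 * d1) (t2 * d2)) =
    t1 *: lsubmx (cone_point a b c d0 d1 d2) /\
  rsubmx (cone_point (t1 * a) (t1 * b) (t2 * c) (t2 * d0) (t2 * d1) (t2 * d2)) =
    t2 *: rsubmx (cone_point a b c d0 d1 d2).
Proof.
rewrite /cone_point !row_mxKl !row_mxKr; split.
  by apply/rowP; apply: ord2_ind; rewrite !mxE.
rewrite scale_row_mx; congr row_mx; first by apply/rowP => i; rewrite !mxE.
by apply/rowP; apply: ord3_ind; rewrite !mxE.
Qed.

Lemma bicone_scale t1 t2 z y : t1 != 0 -> t2 != 0 ->
  lsubmx y = t1 *: lsubmx z -> rsubmx y = t2 *: rsubmx z -> bicone z ->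
  bicone y /\ bilines y = bilines z.
Proof.
move=> t10 t20 yl yr [zl zr]; split.
  by rewrite /bicone /= yl yr !scaler_eq0 (negPf t10) (negPf t20).
by rewrite /bilines yl yr !vline_scale.
Qed.

Lemma Pluecker_rel z F y : on_Sigma z -> flag_rel z F -> GL y -> Fl y = F ->
  bicone (Pluecker y) /\ bilines (Pluecker y) = bilines z.
Proof.
move=> zS; have [D [ab cD [d0 d1 d2]]] := on_SigmaP zS.
rewrite /flag_rel d0 d1 d2 => relF yGL FE.
have mn := jb_mn J; have dV := jb_dim J.
have spans i : (i <= m.+2)%N -> <<mkseq (fun i => (frame (vec_mx y : 'M[K]_d))`_i) i>>%VS = F i.
  by move=> im; rewrite -FE flag_of_frameE // dV; clear -im mn; lia.
have [t1 [t2 [t10 t20 min1 [m0 m1 m2 m3]]]] := cone_rel_minors J ab cD relF spans.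
rewrite /Pluecker m0 m1 m2 m3 !min1 !mulr1 !mulr0 addr0 add0r -d0 -d1 -d2.
set y' := cone_point _ _ _ _ _ _.
have [yl yr] : lsubmx y' = t1 *: lsubmx z /\ rsubmx y' = t2 *: rsubmx z.
  have := cone_point_scale t1 t2 (za z) (zb z) (zc z) (zd z i0) (zd z i1) (zd z i2).
  by rewrite cone_point_coords.
by apply: bicone_scale yl yr _; case: zS.
Qed.

(** This concerns arbitrary flags: a change of frame multiplies each of the two blocks of minors by
    one factor, nonzero because some minor in the block of [y0] is nonzero. *)
Lemma Pluecker_invariant y0 y : GL y0 -> GL y -> Fl y0 = Fl y -> bicone (Pluecker y0) ->
  bicone (Pluecker y) /\ bilines (Pluecker y0) = bilines (Pluecker y).
Proof.
move=> y0GL yGL zy; have mn := jb_mn J; have dV := jb_dim J.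
have prop r : (r <= m.+2)%N -> exists t,
    (forall p, gram form r (fun i => (frame (vec_mx y : 'M[K]_d))`_i) p =
      t * gram form r (fun i => (frame (vec_mx y0 : 'M[K]_d))`_i) p) /\
    forall p, gram form r (fun i => (frame (vec_mx y0 : 'M[K]_d))`_i) p != 0 -> t != 0.
  move=> rm; have rd : (r <= d)%N by rewrite dV; clear -rm mn; lia.
  apply: gram_proportional => i ir; rewrite -flag_of_frameE //.
    rewrite zy flag_of_frameE //.
    exact: (mem_mkseq_span (fun i => (frame (vec_mx _ : 'M[K]_d))`_i) ir).
  rewrite -zy flag_of_frameE //.
  exact: (mem_mkseq_span (fun i => (frame (vec_mx _ : 'M[K]_d))`_i) ir).
have m1 : (m + 1 <= m.+2)%N by rewrite addn1.
have m2 : (m + 2 <= m.+2)%N by rewrite addn2.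
have [t1 [t1E t1N]] := prop _ m1; have [t2 [t2E t2N]] := prop _ m2.
set y0' := Pluecker y0 => bz'.
have yE : Pluecker y = cone_point (t1 * za y0') (t1 * zb y0')
    (t2 * zc y0') (t2 * zd y0' i0) (t2 * zd y0' i1) (t2 * zd y0' i2).
  rewrite /y0' /Pluecker !t1E !t2E.
  set g0 := gram _ _ _ _; set g1' := gram _ _ _ _; set g2 := gram _ _ _ _.
  set g3 := gram _ _ _ _; set g4 := gram _ _ _ _; set g5 := gram _ _ _ _.
  by have [-> -> -> [-> -> ->]] := cone_pointE g0 g1' g2 g3 g4 g5.
have [yl yr] : lsubmx (Pluecker y) = t1 *: lsubmx y0' /\
    rsubmx (Pluecker y) = t2 *: rsubmx y0'.
  have := cone_point_scale t1 t2 (za y0') (zb y0') (zc y0') (zd y0' i0) (zd y0' i1) (zd y0' i2).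
  by rewrite cone_point_coords -yE.
have t10 : t1 != 0.
  have := bicone_ab bz'; rewrite /y0' /Pluecker.
  set g0 := gram _ _ _ _; set g1' := gram _ _ _ _; set g2 := gram _ _ _ _.
  set g3 := gram _ _ _ _; set g4 := gram _ _ _ _; set g5 := gram _ _ _ _.
  have [-> -> _ _] := cone_pointE g0 g1' g2 g3 g4 g5.
  by case/orP; apply: t1N.
have t20 : t2 != 0.
  have := bicone_cd bz'; rewrite /y0' /Pluecker.
  set g0 := gram _ _ _ _; set g1' := gram _ _ _ _; set g2 := gram _ _ _ _.
  set g3 := gram _ _ _ _; set g4 := gram _ _ _ _; set g5 := gram _ _ _ _.
  have [_ _ -> [-> -> ->]] := cone_pointE g0 g1' g2 g3 g4 g5.
  by case/or4P; apply: t2N.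
by have [h ->] := bicone_scale t10 t20 yl yr bz'.
Qed.

Lemma polysec_quad p q r t : polyfun p -> polyfun q -> polyfun r -> polyfun t ->
  polysec (fun z => quad n m e f (p z) (q z) (r z) (t z)).
Proof.
move=> pp pq pr pt j.
apply: (polyfun_ext (f := fun z => coord (vbasis {:V}) j
   (p z *: e m.+1 + q z *: f n + r z *: e m.+2 + t z *: f n.-1))) => [z|].
  by rewrite quadE.
by move: j; do !apply: polysecD; apply: polysecZ => //; apply: polysec_cst.
Qed.

Local Notation sec_at al be D0 z l :=
  (flag_section n m e f al be D0 (za z) (zb z) (zc z) (zd z i0) (zd z i1) (zd z i2) l).

Lemma polysec_flag_section al be D0 l : polysec (fun z => sec_at al be D0 z l).
Proof.
have [pa pb pc pd] := polyfun_coords K; have p0 := fun a : K => polyfun_cst (2 + (1 + 3)) a.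
rewrite /flag_section; case: (l < m)%N; first exact: polysec_cst.
case: (l == m); first exact: polysec_quad.
case: (l == m.+1).
  have ext z : be *: plane_vec1 n m e f (zc z) (zd z i0) (zd z i1)
      - al *: plane_vec2 n m e f (zc z) (zd z i1) (zd z i2) =
    be *: plane_vec1 n m e f (zc z) (zd z i0) (zd z i1)
      + (- al) *: plane_vec2 n m e f (zc z) (zd z i1) (zd z i2) by rewrite scaleNr.
  move=> j; apply: (polyfun_ext (fun z => congr1 (coord (vbasis {:V}) j) (esym (ext z)))).
  move: j; apply: polysecD; apply: polysecZ => //; apply: polysec_quad => //.
  exact: polyfunN.
case: (l == m.+2); first by case: D0; apply: polysec_quad.
by case: (l == m.+3); [apply: polysec_quad | apply: polysec_cst].
Qed.

(** Each section is homogeneous in one of the two blocks of coordinates or constant, so a change of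
    representative rescales it separately, as the construction of the lift demands. *)
Lemma flag_section_scale z y c1 c2 al be D0 l : c1 != 0 -> c2 != 0 ->
  lsubmx y = c1 *: lsubmx z -> rsubmx y = c2 *: rsubmx z ->
  exists2 c, c != 0 & sec_at al be D0 y l = c *: sec_at al be D0 z l.
Proof.
move=> c10 c20 yl yr.
have aE : za y = c1 * za z by rewrite /za yl mxE.
have bE : zb y = c1 * zb z by rewrite /zb yl mxE.
have cE : zc y = c2 * zc z by rewrite /zc yr linearZ mxE.
have dE i : zd y i = c2 * zd z i by rewrite /zd yr linearZ mxE.
rewrite aE bE cE !dE /flag_section.
have one : 1 != 0 :> K by apply: oner_neq0.
case: (l < m)%N; first by exists 1; rewrite ?scale1r.
case: (l == m); first by exists c1; rewrite // /line_vec quadZ mulr0.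
case: (l == m.+1).
  have swap (a : K) (u : V) : c2 *: (a *: u) = a *: (c2 *: u).
    by rewrite !scalerA mulrC.
  by exists c2 => //; rewrite scalerBr !swap /plane_vec1 /plane_vec2 !quadZ !(mulr0, mulrN).
case: (l == m.+2).
  case: D0; last by exists 1; rewrite ?scale1r.
  by exists c1; rewrite // quadZ mulr0.
by case: (l == m.+3); exists 1; rewrite ?scale1r.
Qed.

Lemma frame_of F : component F -> exists2 y, GL y & Fl y = F.
Proof. by case=> -[cF _ _ _] _; have [y [_ yGL] yF] := (dom_flags F).2 cF; exists y. Qed.

Section Maps.
(** The relation determines the two maps only on the component and on the surface, so they are kept
    abstract with their defining property; choice supplies them later. *)
Variables (flag_line : (nat -> {vspace V}) -> {vspace 'rV[K]_2} * {vspace 'rV[K]_(1 + 3)}).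
Variable (line_flag : {vspace 'rV[K]_2} * {vspace 'rV[K]_(1 + 3)} -> (nat -> {vspace V})).
Hypothesis flag_lineP : forall F, component F ->
  exists z, [/\ on_Sigma z, flag_rel z F & bilines z = flag_line F].
Hypothesis line_flagP : forall p, (exists2 z, on_Sigma z & bilines z = p) ->
  exists z, [/\ on_Sigma z, flag_rel z (line_flag p) & bilines z = p].

(** All points related to a flag give the same lines, because these lines are computed by the minors
    of a common frame. *)
Lemma flag_lineE z F : on_Sigma z -> flag_rel z F -> flag_line F = bilines z.
Proof.
move=> zS zF; have [z' [z'S z'F <-]] := flag_lineP (rel_component zF).
have [y yGL yF] := frame_of (rel_component zF).
have [_ <-] := Pluecker_rel z'S z'F yGL yF.
by have [_ <-] := Pluecker_rel zS zF yGL yF.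
Qed.

Lemma line_flagE z : on_Sigma z -> flag_rel z (line_flag (bilines z)).
Proof.
move=> zS; have [|z' [z'S z'F z'z]] := line_flagP (p := bilines z); first by exists z.
exact: rel_bilines z'S.1 zS.1 z'z z'F.
Qed.

Lemma flag_lineK F : component F -> line_flag (flag_line F) = F.
Proof.
move=> /flag_lineP[z [zS zF <-]]; exact: rel_uniq zS (line_flagE zS) zF.
Qed.

Lemma line_flagK z : on_Sigma z -> flag_line (line_flag (bilines z)) = bilines z.
Proof. by move=> zS; apply: flag_lineE (line_flagE zS). Qed.

Local Notation Sig := (Sigma_neg K 2).

Lemma flag_line_morphism :
  morphism (X := subspace (X := Q) component) (Y := Sig) flag_line.
Proof.
apply: morphism_of_lifts; first exact: bicone_open.
  move=> y _ /flag_lineP[z [[_ zS] _ <-]]; exact: zS.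
move=> y0 y0GL cF; have [z0 [z0S z0F z0E]] := flag_lineP cF.
exists Pluecker; split; first exact: polymap_Pluecker.
- by have [] := Pluecker_rel z0S z0F y0GL erefl.
- exact: Pluecker_invariant.
- move=> y yGL /flag_lineP[z [zS zF <-]] _.
  by have [] := Pluecker_rel zS zF yGL erefl.
Qed.

Lemma line_flag_morphism :
  morphism (X := Sig) (Y := subspace (X := Q) component) line_flag.
Proof.
apply: morphism_of_lifts.
- apply/opn_affineP => y; rewrite /= unitmxE unitfE => y0.
  exists (fun y => \det (vec_mx y : 'M[K]_d)); split=> // [|z].
    apply: polyfun_det => i j.
    by apply: polyfun_ext (polyfun_coord K (mxvec_index i j)) => z; rewrite mxE.
  by rewrite /= unitmxE unitfE.
- move=> z bz zS; have := line_flagE (conj bz zS); exact: rel_component.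
- move=> z0 bz0 zS0; have [D [ab cD [d0 d1 d2]]] := on_SigmaP (conj bz0 zS0).
  (* Both [(al, be)] and the test [D == 0] are taken at [z0] and then kept constant in [z], which
     keeps the sections polynomial. *)
  have [al [be de0]] := frame_complement ab.
  pose w l z := flag_section n m e f al be (D == 0)
    (za z) (zb z) (zc z) (zd z i0) (zd z i1) (zd z i2) l.
  apply: (lift_of_sections (jb_nd J) (jb_dim J) (w := w)) => //.
  + by move=> l _; apply: polysec_flag_section.
  + move=> l z y _ bz bY zy; have [c1 [c2 [c10 c20 yl yr]]] := bilines_eq bz bY zy.
    exact: flag_section_scale c10 c20 yl yr.
  + move=> z bz zS; have zF := line_flagE (conj bz zS); split.
      by case: (rel_component zF) => /exotic_lagrangian.
    move=> l ln; have [D' [_ _ [d0' d1' d2']]] := on_SigmaP (conj bz zS).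
    move: zF; rewrite /w /flag_rel d0' d1' d2' => zF; exact: (cone_rel_sec J zF).
  + by rewrite /w d0 d1 d2; apply: (cone_section_free J).
Qed.

Lemma component_iso : isomorphic (subspace (X := Q) component) Sig.
Proof.
exists flag_line, line_flag; split.
- exact: flag_line_morphism.
- exact: line_flag_morphism.
- by move=> F [_ cF]; apply: flag_lineK.
- by move=> p [/dom_quotP[z bz <-] zS]; apply: line_flagK.
Qed.

End Maps.
End Component.

(** * The component as the closure of the cell *)

Section Closure.
Variables (K : fieldType) (V : vectType K) (form : {skew_symmetric V}).
Variables (n m : nat) (v : V) (x : 'End(V)) (e f : nat -> V).
Hypothesis J : jordan_basis form n m v x e f.
Hypothesis two : 2%:R != 0 :> K.
Hypothesis inf : forall h : {poly K}, h != 0 -> exists t, h.[t] != 0.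
Local Notation d := (\dim {:V}).
Local Notation exotic := (exotic_flag form n v x).
Local Notation cond := (flag_cond n m x e f).
Local Notation tab := (Tab n (n - m.+1) (n - m.+1).+1).
Local Notation Q := (flag_variety V).
Local Notation component := (component form n m v x e f).
Local Notation springer := (springer_fibre form n v x).
Local Notation on_Sigma := (@on_Sigma K).
Local Notation bilines := (@bilines K).
Local Notation flag_rel := (flag_rel form n m v x e f).

Lemma ringed_flags : ringed Q.
Proof. exact: ringed_quot. Qed.

Lemma open_notin_cst i (p : V) : (i <= d)%N ->
  opn Q [set F : nat -> {vspace V} | p \notin F i].
Proof.
move=> id; apply/opn_quotP => z zGL pF.
exact: (open_notin (w := fun=> p) (polysec_cst _ p) zGL id pF).
Qed.

(** A failure of stability is already witnessed by one vector of the frame, and its image under [x]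
    stays outside the smaller space for nearby frames. *)
Lemma open_not_stable i j : (i <= d)%N -> (j <= d)%N ->
  opn Q [set F : nat -> {vspace V} | exists2 p, p \in F j & x p \notin F i].
Proof.
move=> id jd; apply/opn_quotP => z zGL [p pF xpF].
pose y (l : nat) (z : 'rV[K]_(d * d)) := (frame (vec_mx z))`_l.
have [l lj xl] : exists2 l, (l < j)%N & x (y l z) \notin flag_of_frame z i.
  apply: contrapT => h; move/negP: xpF; apply.
  move: pF; rewrite flag_of_frameE // => /mem_span_mkseqP[a ->].
  rewrite linear_sum; apply: rpred_sum => l _; rewrite linearZ; apply: rpredZ.
  by apply: contrapT => /negP hl; apply: h; exists l.
have pxy : polysec (fun z => x (y l z)) by apply: polysec_linear; apply: polysec_frame.
have [h [ph hz hF]] := open_notin pxy zGL id xl.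
exists h; split=> // z' z'GL hz'; exists (y l z'); last exact: hF.
rewrite flag_of_frameE //; exact: (mem_mkseq_span (fun l => y l z')).
Qed.

Lemma open_not_cond F : dom Q F -> exotic F -> ~ cond F ->
  exists B, [/\ opn Q B, B F & forall G, B G -> ~ cond G].
Proof.
move=> _ exF ncF; have dV := jb_dim J; have mn := jb_mn J.
(* Assuming that no such neighbourhood exists, each condition is proved by noting that the flags
   violating it would form one. *)
apply: contrapT => nB; apply: ncF.
have id i : (i <= n)%N -> (i <= d)%N by rewrite dV; clear; lia.
have closed i p : (i <= n)%N -> (forall G, cond G -> p \in G i) -> p \in F i.
  move=> i_n pG; apply: contrapT => /negP pF; apply: nB.
  exists [set G : nat -> {vspace V} | p \notin G i]; split=> //; first exact/open_notin_cst/id.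
  by move=> G /negP pG' /pG.
split=> [i im|mn3 p pF|i hi].
- by apply: closed => [|G [h _ _]]; [clear -im mn; lia | apply: h].
- apply: contrapT => /negP xpF; apply: nB.
  exists [set G : nat -> {vspace V} | exists2 p, p \in G m.+3 & x p \notin G m.+1]; split.
  + by apply: open_not_stable; apply: id; clear -mn3; lia.
  + by exists p.
  + by move=> G [q qG /negP xq] [_ /(_ mn3) h _]; apply/xq/h.
- have i_n : (i <= n)%N by clear -hi; lia.
  by split; apply: closed => // G [_ _ /(_ i hi)[]].
Qed.

Lemma maps_exist : exists flag_line line_flag,
  (forall F, component F ->
     exists z, [/\ on_Sigma z, flag_rel z F & bilines z = flag_line F]) /\
  (forall p, (exists2 z, on_Sigma z & bilines z = p) ->
     exists z, [/\ on_Sigma z, flag_rel z (line_flag p) & bilines z = p]).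
Proof.
have /choice[fl flP] : forall F, exists p, component F ->
    exists z, [/\ on_Sigma z, flag_rel z F & bilines z = p].
  move=> F; case: (pselect (component F)) => cF; last by exists (bilines 0).
  by have [z zS zF] := component_rel J cF; exists (bilines z) => _; exists z.
have /choice[lf lfP] : forall p, exists F, (exists2 z, on_Sigma z & bilines z = p) ->
     exists z, [/\ on_Sigma z, flag_rel z F & bilines z = p].
  move=> p; case: (pselect (exists2 z, on_Sigma z & bilines z = p)) => [[z zS zp]|np].
    by have [F zF] := rel_exists J zS; exists F => _; exists z.
  by exists (fun=> 0%VS).
by exists fl, lf.
Qed.

(** The cell satisfies [flag_cond], which is closed in the Springer fibre. For density, a
    neighbourhood of [F] is pulled back along the continuous map [lf] to the surface, where it
    contains the locus of a nonvanishing polynomial; this locus meets [b <> 0], [D <> 0] along a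
    curve. *)
Lemma component_closure F : dom Q F ->
  (component F <-> exotic F /\
     zariski_closure (X := springer) (Phi_fibre form n v x tab) F).
Proof.
move=> QF; split=> [cF|[exF [_ clF]]]; last first.
  split=> //; apply: (clF cond); last first.
    by move=> G [_ Gphi]; apply: (Phi_fibre_cond J two Gphi).
  apply/(opn_subspaceP ringed_flags) => G QG exG ncG.
  have [B [oB BG Bn]] := open_not_cond QG exG ncG.
  by exists B; split=> // G' _ _; apply: Bn.
have [exF condF] := cF; split=> //; split; first by split.
move=> Z oZ PhiZ; apply: contrapT => nZF.
have [fl [lf [flP lfP]]] := maps_exist.
have [_ lf_open _] := line_flag_morphism J lfP.
have [B [oB BF BZ]] := (opn_subspaceP ringed_flags _).1 oZ F QF exF nZF.
have {}lf_open := lf_open B (ex_intro2 _ _ B oB erefl).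
have [z zS zF] := component_rel J cF.
have lfE z' F' : on_Sigma z' -> flag_rel z' F' -> lf (bilines z') = F'.
  by move=> z'S z'F; apply: (rel_uniq J z'S (line_flagE lfP z'S) z'F).
have domz z' : on_Sigma z' -> dom (biproj K 2 (1 + 3)) (bilines z').
  by case=> bz' _; apply/dom_quotP; exists z'.
have Bz : B (lf (bilines z)) by rewrite (lfE z F).
have [B' [oB' B'z B'B]] :=
  (opn_subspaceP (ringed_quot _ _) _).1 lf_open _ (domz z zS) zS.2 Bz.
have [p [pp pz pB']] := (opn_quotP _).1 oB' z zS.1 B'z.
have [D [ab cD [d0 d1 d2]]] := on_SigmaP zS.
rewrite -(cone_point_coords z) d0 d1 d2 in pz.
have [b' [D' [b'0 D'0 py]]] := cone_curve inf pp pz.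
have ab' : (za z != 0) || (b' != 0) by rewrite b'0 orbT.
have cD' : (zc z != 0) || (D' != 0) by rewrite D'0 orbT.
have yS := on_Sigma_cone_point ab' cD'; have [G yG] := rel_exists J yS.
have Gphi : Phi_fibre form n v x tab G.
  move: yG; rewrite /flag_rel.
  have [-> -> -> [-> -> ->]] := cone_pointE (za z) b' (zc z) (D' * za z * za z)
     (D' * za z * b') (D' * b' * b').
  exact: (cone_rel_generic J two b'0 D'0).
have [exG _] := Gphi; have QG : dom Q G by apply/dom_flags; case: exG.
apply: (BZ G QG exG).
  by rewrite -(lfE _ _ yS yG); apply: B'B; [apply: domz | case: yS | apply: pB'; case: yS].
by apply: PhiZ; split=> //; split.
Qed.

Lemma C_closure_iso :
  isomorphic (C_closure form n v x (n - m.+1) (n - m.+1).+1) (Sigma_neg K 2).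
Proof.
have [fl [lf [flP lfP]]] := maps_exist.
apply: isomorphic_trans (component_iso J flP lfP).
by apply: subspace_subspace_iso; [apply: ringed_flags | apply: component_closure].
Qed.

End Closure.

(** * From a normal basis of the given type to the Jordan basis *)

Section JordanBasis.
Variables (K : fieldType) (U : vectType K) (v : dbl U) (x : 'End(dbl U)) (n : nat).
Local Notation om := (@omega K U).

Lemma jordan_basis_exists k : (2 <= n)%N -> (1 <= k <= n - 1)%N ->
  exotic_cone om v x -> eType om v x [:: (n - 2)%N] [:: 2%N] ->
  exists e f, jordan_basis om n (n - k.+1) v x e f.
Proof.
move=> n2 kn [x_adj _] [_ _ [e [f [la bas dual ee ff vE xe xf]]]].
have laE : la = [:: n] by congr [:: _]; rewrite /=; lia.
rewrite laE in bas dual ee ff xe xf; clear la laE.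
have incells j : ((0, j)%N \in cells [:: n]) = (1 <= j <= n)%N by rewrite mem_cells1.
have [nd _ _] := omega_symplectic U.
(* Extending by zero outside [1 .. n] makes the shift rules uniform at the ends, where [e 0] and
   [f n.+1] must vanish. *)
pose E j := if (1 <= j <= n)%N then e 0%N j else 0.
pose F j := if (1 <= j <= n)%N then f 0%N j else 0.
exists E, F; split.
- exact: nd.
- have /eqP := basis_free bas; rewrite (span_basis bas) => ->.
  by rewrite size_cat !size_map cells1 size_map size_iota mul2n addnn.
- lia.
- exact: x_adj.
- move=> i j; rewrite /E; case: ifP => hi; last exact: skew0l.
  case: ifP => hj; last exact: skew0r.
  by apply: (ee (0, i)%N (0, j)%N); rewrite incells.
- move=> i j; rewrite /F; case: ifP => hi; last exact: skew0l.
  case: ifP => hj; last exact: skew0r.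
  by apply: (ff (0, i)%N (0, j)%N); rewrite incells.
- move=> i j; rewrite /E /F; case: ifP => hi; last by rewrite andbF skew0l.
  rewrite andbT; case: ifP => hj.
    by rewrite (dual (0, i)%N (0, j)%N) ?incells // xpair_eqE eqxx.
  by rewrite skew0r; case: eqP => // ij; rewrite -ij hi in hj.
- move=> i i_n; rewrite /E; case: i i_n => [|i] i_n /=; first by rewrite linear0.
  rewrite i_n (xe (0, i.+1)%N) ?incells //= eqSS.
  by case: i i_n => //= i i_n; rewrite ifT // ltnW.
- move=> i i0; rewrite /F i0 /=; case: (ltngtP i n) => i_n.
  + by rewrite (xf (0, i)%N) ?incells ?i0 1?ltnW //= ltn_eqF.
  + by rewrite linear0.
  + by rewrite (xf (0, i)%N) ?incells ?i0 ?i_n //= eqxx.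
- rewrite vE /E /nparts /= addn0; case: (n - 2)%N (leq_subr 2 n) => [|j] jn.
    by rewrite big_nil.
  by rewrite big_nat1 jn.
- move=> p pf pe; apply: (form_eq0 nd) => q; apply: (mem_orthovP _ q (memvf q)).
  rewrite mem_orthov_sym -(span_basis bas); apply/span_subvP => b.
  rewrite mem_cat => /orP[] /mapP[[i j]]; rewrite mem_cells1 /= => /andP[/eqP-> hj] ->.
    by rewrite mem_orthov1; have := pe j; rewrite /E hj => ->.
  by rewrite mem_orthov1 skewC; have := pf j; rewrite /F hj => ->; rewrite oppr0.
Qed.

End JordanBasis.

Theorem proposition8p11 (R : realType) (n : nat) (U : vectType R[i]%C)
    (v : dbl U) (x : 'End(dbl U)) (k : nat)
    (n_ge2 : (2 <= n)%N) (dimU : \dim {:U} = n)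
    (vx_cone : exotic_cone (@omega _ U) v x)
    (vx_type : eType (@omega _ U) v x [:: (n - 2)%N] [:: 2%N])
    (k_range : (1 <= k <= n - 1)%N) :
  isomorphic (C_closure (@omega _ U) n v x k k.+1) (Sigma_neg R[i]%C 2).
Proof.
have [e [f J]] := jordan_basis_exists n_ge2 k_range vx_cone vx_type.
have kE : (n - (n - k.+1).+1)%N = k by lia.
have := C_closure_iso J; rewrite kE; apply; first by rewrite Num.Theory.pnatr_eq0.
(* Algebraic closedness makes the field infinite: every nonzero polynomial has a non-root, as
   density of the cell requires. *)
by move=> h /closed_nonrootP[t ht]; exists t.
Qed.
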